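(* For all $s\in\mathbb{C}$ the following three identities hold: $$s(s-1)\frac{3^{-s}-1}{2}\zeta(s+1)+\left(\frac{2\pi}{3}\right)^2\frac{3^{2-s}-1}{2}\zeta(s-1)=\sum_{k=0}^\infty(-1)^k\frac{(s-2k)(s+2k-1)}{(2k)!}\left(\frac{2\pi}{3}\right)^{2k}\zeta(s+1-2k);$$ $$s(s-1)\frac{2^{-s}-1}{2^{s+1}}\zeta(s+1)+\left(\frac{\pi}{2}\right)^2\frac{2^{2-s}-1}{2^{s-1}}\zeta(s-1)=\sum_{k=0}^\infty(-1)^k\frac{(s-2k)(s+2k-1)}{(2k)!}\left(\frac{\pi}{2}\right)^{2k}\zeta(s+1-2k);$$ $$s(s-1)\frac{6^{-s}-3^{-s}-2^{-s}+1}{2}\zeta(s+1)+\left(\frac{\pi}{3}\right)^2\frac{6^{2-s}-3^{2-s}-2^{2-s}+1}{2}\zeta(s-1)=\sum_{k=0}^\infty(-1)^k\frac{(s-2k)(s+2k-1)}{(2k)!}\left(\frac{\pi}{3}\right)^{2k}\zeta(s+1-2k).$$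
   Context: $\zeta$ is the Riemann zeta function, analytically continued to $\mathbb{C}\setminus\{1\}$. At values of $s$ where some factor $\zeta(\cdot)$ is evaluated at its pole $1$, the corresponding term is interpreted by continuity in $s$ (these singularities are removable, e.g. $(s-2j)\zeta(s+1-2j)$ at $s=2j$ is understood as $\lim_{w\to1}(w-1)\zeta(w)=1$). *)

(* Defs.v *)
From Stdlib Require Import Reals Factorial ClassicalEpsilon.
From Coquelicot Require Import Coquelicot.

Open Scope C_scope.

(* [cpow a z] is a^z = exp (z ln a), for a real base a > 0. *)
Definition cpow (a : R) (z : C) : C :=
  (exp (Re z * ln a) * cos (Im z * ln a), exp (Re z * ln a) * sin (Im z * ln a))%R.

Definition analytic_at (f : C -> C) (z0 : C) : Prop :=
  exists (a : nat -> C) (r : R), (0 < r)%R /\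
    forall z : C, (Cmod (z - z0) < r)%R ->
      is_pseries (K := C_AbsRing) (V := C_NormedModule) a (z - z0) (f z).

Definition is_riemann_zeta (f : C -> C) : Prop :=
  (forall s : C, s <> 1 -> analytic_at f s) /\
  (forall s : C, (1 < Re s)%R ->
     is_series (K := C_AbsRing) (V := C_NormedModule)
       (fun n : nat => cpow (INR (S n)) (- s)) (f s)).

(* By the identity theorem [is_riemann_zeta] determines the function on
   C \ {1}; the value chosen at the pole 1 is arbitrary. *)
Definition zeta : C -> C :=
  epsilon (inhabits (fun _ : C => RtoC 0)) is_riemann_zeta.

(* The value at s of the function f, which has a removable singularity at p
   and is given by its formula everywhere else. [C_lim f p] equals the limit
   of f along [locally' p] whenever that limit exists ([is_C_lim_unique]). *)
Definition by_continuity (p : C) (f : C -> C) (s : C) : C :=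
  if excluded_middle_informative (s = p) then C_lim f p else f s.

(* zeta (s + 1 - 2 k) meets the pole of zeta exactly when s = 2 k. *)
Definition rhs_term (theta : R) (s : C) (k : nat) : C :=
  by_continuity (RtoC (2 * INR k))
    (fun w : C =>
       (-1) ^ k
       * ((w - 2 * INR k) * (w + 2 * INR k - 1) / INR (fact (2 * k)))
       * RtoC theta ^ (2 * k)
       * zeta (w + 1 - 2 * INR k))
    s.

(* Main.v *)
Require Import Defs.
From Stdlib Require Import Reals Lra Lia Psatz ClassicalEpsilon FunctionalExtensionality Factorial List.
From Coquelicot Require Import Coquelicot.
Open Scope C_scope.

(* Write z = 1/2 + it and w(t) = 2 pi / (e^(pi t) + e^(-pi t))^2, and let
   Q(theta, s) be the integral over R of z^(-s) e^(i theta z) w(t) dt, which is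
   entire in s for |theta| < 2 pi.  On the lines Re z = n - 1/2 and Re z = n + 1/2
   the weight w is the restriction of one function with a double pole at n, so for
   g(z) = z^(-s) e^(i theta z) the residue theorem and a telescoping sum give
   Q(theta, s) = - sum g'(n) when Re s > 0.  For theta = 0 this says
   (s - 1) zeta(s) = Q(0, s - 1), which continues zeta.  Expanding e^(i theta z)
   under the integral gives, for every s,
   Q(theta, s) = sum_k (i theta)^k / k! Q(0, s - k); hence the right-hand side of
   each identity is the even part in theta of
   (s - 1) Q(theta, s) + i theta Q(theta, s - 1).  For Re s > 1 the latter equals
   sum_n (s (s - 1) n^(-s-1) + theta^2 n^(1-s)) cos(n theta), and at the three
   angles cos(n theta) is a combination of indicators of d | n, which for Re s > 2
   produces the left-hand side.  The identity theorem extends this to all s. *)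

Definition cexp (z : C) : C :=
  (exp (Re z) * cos (Im z), exp (Re z) * sin (Im z))%R.

Lemma C_ext (a b : C) : Re a = Re b -> Im a = Im b -> a = b.
Proof. destruct a, b; simpl; congruence. Qed.

Lemma Re_minus (a b : C) : Re (a - b) = (Re a - Re b)%R.
Proof. reflexivity. Qed.

Lemma Im_minus (a b : C) : Im (a - b) = (Im a - Im b)%R.
Proof. reflexivity. Qed.

Lemma im_le_Cmod (c : C) : (Rabs (Im c) <= Cmod c)%R.
Proof.
  apply Rle_trans with (2 := Rmax_Cmod c). apply Rmax_r.
Qed.

Lemma Cmod_le_abs (c : C) : (Cmod c <= Rabs (Re c) + Rabs (Im c))%R.
Proof.
  destruct c as [x y]; simpl.
  replace (x, y) with (RtoC x + Ci * RtoC y) by (apply C_ext; simpl; ring).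
  eapply Rle_trans; [apply Cmod_triangle|].
  rewrite Cmod_mult, Cmod_Ci, !Cmod_R; lra.
Qed.

Lemma Cmod_minus_sym (a b : C) : Cmod (a - b) = Cmod (b - a).
Proof. rewrite <- Cmod_opp; f_equal; ring. Qed.

Lemma Cmod_minus_ge (a b : C) : (Cmod a - Cmod b <= Cmod (a - b))%R.
Proof.
  assert (H := Cmod_triangle (a - b) b).
  replace (a - b + b) with a in H by ring. lra.
Qed.

Lemma Cmod_minus_le (a b : C) : (Cmod (a - b) <= Cmod a + Cmod b)%R.
Proof. unfold Cminus. rewrite <- (Cmod_opp b). apply Cmod_triangle. Qed.

Lemma exp_le (x y : R) : (x <= y)%R -> (exp x <= exp y)%R.
Proof. intros [H|H]; [left; apply exp_increasing; auto|right; congruence]. Qed.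

Lemma cexp_0 : cexp 0 = 1.
Proof. unfold cexp; simpl; rewrite exp_0, cos_0, sin_0; apply C_ext; simpl; ring. Qed.

Lemma cexp_plus (a b : C) : cexp (a + b) = cexp a * cexp b.
Proof.
  unfold cexp; rewrite re_plus, im_plus, exp_plus, cos_plus, sin_plus.
  apply C_ext; simpl; ring.
Qed.

Lemma Cmod_cexp (z : C) : Cmod (cexp z) = exp (Re z).
Proof.
  unfold cexp, Cmod; simpl fst; simpl snd.
  replace ((exp (Re z) * cos (Im z)) ^ 2 + (exp (Re z) * sin (Im z)) ^ 2)%R
    with (exp (Re z) * exp (Re z) * (Rsqr (sin (Im z)) + Rsqr (cos (Im z))))%R
    by (unfold Rsqr; ring).
  rewrite sin2_cos2, Rmult_1_r, sqrt_square; auto. apply Rlt_le, exp_pos.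
Qed.

Lemma Cmod_cexp_le (z : C) : (Cmod (cexp z) <= exp (Cmod z))%R.
Proof.
  rewrite Cmod_cexp. apply exp_le.
  apply Rle_trans with (1 := Rle_abs _). apply re_le_Cmod.
Qed.

Lemma cexp_neq_0 (z : C) : cexp z <> 0.
Proof. apply Cmod_gt_0. rewrite Cmod_cexp. apply exp_pos. Qed.

Lemma cexp_opp (z : C) : cexp (- z) = / cexp z.
Proof.
  assert (H : cexp (- z) * cexp z = 1)
    by (rewrite <- cexp_plus, <- cexp_0; f_equal; ring).
  rewrite <- (Cmult_1_l (/ cexp z)), <- H. field. apply cexp_neq_0.
Qed.

Lemma cexp_R (x : R) : cexp x = exp x.
Proof. unfold cexp; simpl; rewrite cos_0, sin_0. apply C_ext; simpl; ring. Qed.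

Lemma cpow_cexp (a : R) (z : C) : cpow a z = cexp (z * ln a).
Proof. unfold cpow, cexp. rewrite re_scal_r, im_scal_r. reflexivity. Qed.

(** * Functions of a real variable with complex values *)

Definition Rder (f : R -> C) (t : R) (l : C) : Prop :=
  is_derive (fun u => Re (f u)) t (Re l) /\ is_derive (fun u => Im (f u)) t (Im l).

Lemma Rder_const (c : C) (t : R) : Rder (fun _ => c) t 0.
Proof. split; apply (is_derive_const (K := R_AbsRing) (V := R_NormedModule)). Qed.

Lemma Rder_ext (f g : R -> C) (t : R) (l : C) :
  (forall x, f x = g x) -> Rder f t l -> Rder g t l.
Proof.
  intros E [H1 H2]; split; eapply is_derive_ext; eauto; intros x; cbv beta; rewrite E; reflexivity.
Qed.

Lemma Rder_plus (f g : R -> C) (t : R) (a b : C) :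
  Rder f t a -> Rder g t b -> Rder (fun u => f u + g u) t (a + b).
Proof.
  intros [H1 H2] [H3 H4]; split.
  - exact (is_derive_plus _ _ _ _ _ H1 H3).
  - exact (is_derive_plus _ _ _ _ _ H2 H4).
Qed.

Lemma Rder_mult (f g : R -> C) (t : R) (a b : C) :
  Rder f t a -> Rder g t b -> Rder (fun u => f u * g u) t (a * g t + f t * b).
Proof.
  intros [H1 H2] [H3 H4]; split; simpl.
  - apply (is_derive_ext (fun u => minus (mult (Re (f u)) (Re (g u))) (mult (Im (f u)) (Im (g u))))).
    { intros u; reflexivity. }
    evar_last.
    { apply (is_derive_minus (K := R_AbsRing) (V := R_NormedModule));
        apply (is_derive_mult (K := R_AbsRing)); eauto; intros; apply Rmult_comm. }
    unfold minus, plus, opp, mult, Re, Im; simpl; ring.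
  - apply (is_derive_ext (fun u => plus (mult (Re (f u)) (Im (g u))) (mult (Im (f u)) (Re (g u))))).
    { intros u; reflexivity. }
    evar_last.
    { apply (is_derive_plus (K := R_AbsRing) (V := R_NormedModule));
        apply (is_derive_mult (K := R_AbsRing)); eauto; intros; apply Rmult_comm. }
    unfold minus, plus, opp, mult, Re, Im; simpl; ring.
Qed.

Lemma Rder_RtoC (t : R) : Rder RtoC t 1.
Proof.
  split; simpl.
  - apply (is_derive_id (K := R_AbsRing)).
  - apply (is_derive_const (K := R_AbsRing) (V := R_NormedModule)).
Qed.

Lemma Rder_lin (u : C) (t : R) : Rder (fun x : R => x * u) t u.
Proof.
  assert (H := Rder_mult _ _ _ _ _ (Rder_RtoC t) (Rder_const u t)).
  cbv beta in H. replace (1 * u + t * 0) with u in H by ring. exact H.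
Qed.

Lemma Rder_cexp (f : R -> C) (t : R) (a : C) :
  Rder f t a -> Rder (fun u => cexp (f u)) t (a * cexp (f t)).
Proof.
  intros [H1 H2]; split; simpl.
  - evar_last.
    { apply (is_derive_mult (K := R_AbsRing)); [| |intros; apply Rmult_comm].
      - apply (is_derive_comp (K := R_AbsRing) exp (fun u => Re (f u))); [apply is_derive_exp|exact H1].
      - apply (is_derive_comp (K := R_AbsRing) cos (fun u => Im (f u))); [apply is_derive_cos|exact H2]. }
    unfold plus, mult, scal, Re, Im; simpl; unfold mult; simpl; ring.
  - evar_last.
    { apply (is_derive_mult (K := R_AbsRing)); [| |intros; apply Rmult_comm].
      - apply (is_derive_comp (K := R_AbsRing) exp (fun u => Re (f u))); [apply is_derive_exp|exact H1].
      - apply (is_derive_comp (K := R_AbsRing) sin (fun u => Im (f u))); [apply is_derive_sin|exact H2]. }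
    unfold plus, mult, scal, Re, Im; simpl; unfold mult; simpl; ring.
Qed.

Lemma Rder_pow (f : R -> C) (t : R) (a : C) (n : nat) :
  Rder f t a -> Rder (fun u => f u ^ S n) t (INR (S n) * a * f t ^ n).
Proof.
  intros H. induction n as [|n IH].
  - replace (INR 1 * a * f t ^ 0) with (a * 1 + f t * 0) by (simpl; ring).
    apply (Rder_mult f (fun _ => 1)); auto. apply Rder_const.
  - replace (INR (S (S n)) * a * f t ^ S n) with (a * f t ^ S n + f t * (INR (S n) * a * f t ^ n)).
    + apply (Rder_mult f (fun u => f u ^ S n)); auto.
    + rewrite (S_INR (S n)), RtoC_plus, Cpow_S. ring.
Qed.

(* Comparing with the projection of f on the direction of its total increment
   keeps the constant 1. *)
Lemma mvt_Rder (f f' : R -> C) (G G' : R -> R) (a b : R) :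
  (a <= b)%R ->
  (forall t, (a <= t <= b)%R -> Rder f t (f' t)) ->
  (forall t, (a <= t <= b)%R -> is_derive G t (G' t)) ->
  (forall t, (a <= t <= b)%R -> (Cmod (f' t) <= G' t)%R) ->
  (Cmod (f b - f a) <= G b - G a)%R.
Proof.
  intros Hab Hf HG Hle.
  assert (Mono : forall p q m : R, (forall z : C, p * Re z + q * Im z <= m * Cmod z)%R -> (0 <= m)%R ->
            (p * (Re (f b) - Re (f a)) + q * (Im (f b) - Im (f a)) <= m * (G b - G a))%R).
  { intros p q m Hpq Hm.
    assert (Hd : forall t, (a <= t <= b)%R ->
              is_derive (fun t => p * Re (f t) + q * Im (f t) - m * G t)%R t
                (p * Re (f' t) + q * Im (f' t) - m * G' t)%R).
    { intros t Ht. destruct (Hf t Ht) as [H1 H2].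
      apply (is_derive_minus (K := R_AbsRing) (V := R_NormedModule)).
      - apply (is_derive_plus (K := R_AbsRing) (V := R_NormedModule)).
        + exact (is_derive_scal _ _ p _ H1).
        + exact (is_derive_scal _ _ q _ H2).
      - exact (is_derive_scal _ _ m _ (HG t Ht)). }
    destruct (MVT_gen (fun t => p * Re (f t) + q * Im (f t) - m * G t)%R a b
                (fun t => p * Re (f' t) + q * Im (f' t) - m * G' t)%R) as [c [Hc He]].
    - rewrite Rmin_left, Rmax_right by lra. intros t Ht. apply Hd; lra.
    - rewrite Rmin_left, Rmax_right by lra. intros t Ht.
      apply derivable_continuous_pt, ex_derive_Reals_0. eexists. apply Hd; lra.
    - rewrite Rmin_left, Rmax_right in Hc by lra. simpl in He.
      assert (p * Re (f' c) + q * Im (f' c) - m * G' c <= 0)%R.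
      { assert (H := Hpq (f' c)). assert (H0 := Hle c Hc).
        assert (m * Cmod (f' c) <= m * G' c)%R by (apply Rmult_le_compat_l; auto). lra. }
      assert ((p * Re (f' c) + q * Im (f' c) - m * G' c) * (b - a) <= 0)%R by nra.
      lra. }
  set (d := f b - f a).
  destruct (Rle_lt_or_eq_dec 0 (Cmod d) (Cmod_ge_0 _)) as [Hd|Hd].
  - assert (H := Mono (Re d) (Im d) (Cmod d)).
    assert (Hs : (Cmod d * Cmod d = Re d * Re d + Im d * Im d)%R).
    { assert (X := Cmod2_alt d). simpl in X. rewrite <- !Rmult_assoc, !Rmult_1_r in X. exact X. }
    assert (HH : (Re d * (Re (f b) - Re (f a)) + Im d * (Im (f b) - Im (f a)) <= Cmod d * (G b - G a))%R).
    { apply H; [|lra]. intros z.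
      replace (Re d * Re z + Im d * Im z)%R with (Re (Cconj d * z)).
      2:{ destruct d, z; simpl; ring. }
      rewrite <- (Cmod_conj d), <- Cmod_mult.
      apply Rle_trans with (1 := Rle_abs _). apply re_le_Cmod. }
    change (Re (f b) - Re (f a))%R with (Re d) in HH.
    change (Im (f b) - Im (f a))%R with (Im d) in HH.
    rewrite <- Hs in HH. nra.
  - rewrite <- Hd.
    assert (H := Mono 0%R 0%R 1%R). assert (forall z : C, 0 * Re z + 0 * Im z <= 1 * Cmod z)%R.
    { intros z. assert (X := Cmod_ge_0 z). lra. }
    assert (X := H H0 ltac:(lra)). lra.
Qed.

Definition ctay (u : C) (n : nat) : C :=
  sum_n (fun k => u ^ k / INR (fact k)) n.

Lemma INR_fact_pos (n : nat) : (0 < INR (fact n))%R.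
Proof. apply lt_0_INR, lt_O_fact. Qed.

Lemma RtoC_neq_0 (x : R) : x <> 0%R -> RtoC x <> 0.
Proof. intros H E. apply H. apply RtoC_inj. exact E. Qed.

Lemma fact_neq_0_C (n : nat) : RtoC (INR (fact n)) <> 0.
Proof. apply RtoC_neq_0. assert (H := INR_fact_pos n). lra. Qed.

Lemma fact_S_C (n : nat) : RtoC (INR (fact (S n))) = INR (S n) * INR (fact n).
Proof. rewrite <- RtoC_mult, <- mult_INR. reflexivity. Qed.

Lemma Rder_ctay (u : C) (n : nat) (t : R) :
  Rder (fun x => ctay (x * u) (S n)) t (u * ctay (t * u) n).
Proof.
  assert (Hl := Rder_lin u t).
  assert (Ht : forall k, Rder (fun x : R => (x * u) ^ S k / INR (fact (S k))) t
                 (u * ((t * u) ^ k / INR (fact k)))).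
  { intros k.
    assert (H := Rder_mult _ _ _ _ _ (Rder_pow _ t _ k Hl) (Rder_const (/ INR (fact (S k))) t)).
    simpl in H.
    replace (u * ((t * u) ^ k / INR (fact k))) with
      (INR (S k) * u * (t * u) ^ k * / INR (fact (S k)) + t * u * (t * u) ^ k * 0).
    - exact H.
    - rewrite fact_S_C. field. split; [apply fact_neq_0_C|].
      apply RtoC_neq_0, not_0_INR. lia. }
  induction n as [|n IH].
  - replace (u * ctay (t * u) 0) with (0 + u * ((t * u) ^ 0 / INR (fact 0))).
    + unfold ctay. assert (E : forall x : R, sum_n (fun k => (x * u) ^ k / INR (fact k)) 1 =
                        1 + (x * u) ^ 1 / INR (fact 1)).
      { intros x. rewrite sum_Sn, sum_O. unfold plus; simpl. field. }
      eapply Rder_ext; [intros x; symmetry; apply E|].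
      apply (Rder_plus (fun _ => 1) _ t _ _ (Rder_const 1 t) (Ht 0%nat)).
    + unfold ctay. rewrite sum_O. ring.
  - assert (E : forall m (x : C), ctay x (S m) = ctay x m + x ^ S m / INR (fact (S m))).
    { intros m x. unfold ctay. rewrite sum_Sn. reflexivity. }
    rewrite E, Cmult_plus_distr_l.
    eapply Rder_ext; [intros x; symmetry; apply E|].
    apply (Rder_plus _ _ t _ _ IH (Ht (S n))).
Qed.

Lemma Rder_minus (f g : R -> C) (t : R) (a b : C) :
  Rder f t a -> Rder g t b -> Rder (fun u => f u - g u) t (a - b).
Proof.
  intros [H1 H2] [H3 H4]; split.
  - exact (is_derive_minus _ _ _ _ _ H1 H3).
  - exact (is_derive_minus _ _ _ _ _ H2 H4).
Qed.

Lemma ctay_S (u : C) (n : nat) : ctay u (S n) = ctay u n + u ^ S n / INR (fact (S n)).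
Proof. unfold ctay. rewrite sum_Sn. reflexivity. Qed.

Lemma ctay_0 (n : nat) : ctay 0 n = 1.
Proof.
  induction n as [|n IH].
  - unfold ctay. rewrite sum_O. simpl. field.
  - rewrite ctay_S, IH, Cpow_S. field. apply fact_neq_0_C.
Qed.

Lemma cexp_taylor_aux (u : C) (n : nat) (r : R) : (0 <= r <= 1)%R ->
  (Cmod (cexp (r * u) - ctay (r * u) n)
     <= exp (Cmod u) * ((r * Cmod u) ^ S n / INR (fact (S n))))%R.
Proof.
  revert r.
  assert (Hl := Rder_lin u).
  assert (Hu := Cmod_ge_0 u).
  assert (HG : forall k t, is_derive (fun t => exp (Cmod u) * ((t * Cmod u) ^ S k / INR (fact (S k))))%R t
                   (Cmod u * (exp (Cmod u) * ((t * Cmod u) ^ k / INR (fact k))))%R).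
  { intros k t. auto_derive; auto. change (fact k + k * fact k)%nat with (S k * fact k)%nat. rewrite mult_INR.
    assert (H := INR_fact_pos k). assert (0 < INR (S k))%R by (apply lt_0_INR; lia).
    replace (Init.Nat.pred (S k)) with k by reflexivity.
    change (match k with 0%nat => 1%R | S _ => (INR k + 1)%R end) with (INR (S k)).
    field; lra. }
  assert (Main : forall k (f' : R -> C),
     (forall t, Rder (fun x : R => cexp (x * u) - ctay (x * u) k) t (f' t)) ->
     (forall t, (0 <= t <= 1)%R ->
        (Cmod (f' t) <= Cmod u * (exp (Cmod u) * ((t * Cmod u) ^ k / INR (fact k))))%R) ->
     forall r, (0 <= r <= 1)%R -> (Cmod (cexp (r * u) - ctay (r * u) k)
     <= exp (Cmod u) * ((r * Cmod u) ^ S k / INR (fact (S k))))%R).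
  { intros k f' Hd Hb r Hr.
    assert (H := mvt_Rder _ f' _ _ 0 r (proj1 Hr) (fun t _ => Hd t) (fun t _ => HG k t)
                   (fun t Ht => Hb t ltac:(lra))).
    simpl in H. rewrite Cmult_0_l, cexp_0, ctay_0 in H.
    replace (cexp (r * u) - ctay (r * u) k - (1 - 1)) with (cexp (r * u) - ctay (r * u) k) in H by ring.
    eapply Rle_trans; [exact H|]. simpl. rewrite Rmult_0_l. unfold Rdiv. lra. }
  induction n as [|n IH].
  - apply Main with (f' := fun t => u * cexp (t * u) - 0).
    + intros t. apply Rder_minus; [apply Rder_cexp, Hl|].
      apply (Rder_ext (fun _ => 1 / INR (fact 0))); [|apply Rder_const].
      intros x. unfold ctay. rewrite sum_O. reflexivity.
    + intros t Ht. replace (u * cexp (t * u) - 0) with (u * cexp (t * u)) by ring.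
      rewrite Cmod_mult. apply Rmult_le_compat_l; auto. simpl.
      eapply Rle_trans; [apply Cmod_cexp_le|]. rewrite Cmod_mult, Cmod_R, Rabs_pos_eq by lra.
      replace (exp (Cmod u) * (1 / 1))%R with (exp (Cmod u)) by field.
      apply exp_le. nra.
  - apply Main with (f' := fun t => u * cexp (t * u) - u * ctay (t * u) n).
    + intros t. apply Rder_minus; [apply Rder_cexp, Hl|apply Rder_ctay].
    + intros t Ht. replace (u * cexp (t * u) - u * ctay (t * u) n) with
        (u * (cexp (t * u) - ctay (t * u) n)) by ring.
      rewrite Cmod_mult. apply Rmult_le_compat_l; auto.
Qed.

Lemma cexp_taylor (u : C) (n : nat) :
  (Cmod (cexp u - ctay u n) <= exp (Cmod u) * (Cmod u ^ S n / INR (fact (S n))))%R.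
Proof.
  assert (H := cexp_taylor_aux u n 1 ltac:(lra)).
  rewrite Cmult_1_l, Rmult_1_l in H. exact H.
Qed.

Lemma pow_fact_le_exp (x : R) (n : nat) : (0 <= x)%R -> (x ^ n / INR (fact n) <= exp x)%R.
Proof.
  intros Hx. eapply Rle_trans; [|apply (exp_ge_taylor x n Hx)].
  assert (Hp : forall k, (0 <= x ^ k / INR (fact k))%R).
  { intros k. apply Rdiv_le_0_compat; [apply pow_le; auto|apply INR_fact_pos]. }
  destruct n; [apply Rle_refl|]. rewrite tech5.
  assert (0 <= sum_f_R0 (fun k => x ^ k / INR (fact k)) n)%R by (apply cond_pos_sum; auto).
  lra.
Qed.

Lemma cexp_taylor_geom (u : C) (n : nat) (q : R) : (0 < q)%R ->
  (Cmod (cexp u - ctay u n) <= q ^ S n * exp ((1 + / q) * Cmod u))%R.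
Proof.
  intros Hq. eapply Rle_trans; [apply cexp_taylor|].
  assert (Hu := Cmod_ge_0 u).
  replace (Cmod u ^ S n)%R with (q ^ S n * (Cmod u / q) ^ S n)%R.
  2:{ rewrite <- Rpow_mult_distr. f_equal. field; lra. }
  replace ((1 + / q) * Cmod u)%R with (Cmod u + Cmod u / q)%R by (field; lra).
  rewrite exp_plus.
  assert (H := pow_fact_le_exp (Cmod u / q) (S n) ltac:(apply Rdiv_le_0_compat; lra)).
  assert (0 < q ^ S n)%R by (apply pow_lt; auto).
  assert (0 < exp (Cmod u))%R by apply exp_pos.
  replace (exp (Cmod u) * (q ^ S n * (Cmod u / q) ^ S n / INR (fact (S n))))%R with
    (q ^ S n * (exp (Cmod u) * ((Cmod u / q) ^ S n / INR (fact (S n)))))%R.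
  2:{ field. apply INR_fact_neq_0. }
  apply Rmult_le_compat_l; [lra|]. apply Rmult_le_compat_l; [lra|]. exact H.
Qed.

Definition Ccv (u : nat -> C) (l : C) : Prop :=
  is_lim_seq (fun n => Cmod (u n - l)) 0%R.

Lemma is_series_Ccv (a : nat -> C) (l : C) :
  is_series (K := C_AbsRing) (V := C_NormedModule) a l <-> Ccv (sum_n a) l.
Proof.
  unfold is_series, Ccv, is_lim_seq. split; intros H.
  - apply filterlim_locally. intros eps.
    assert (H2 : eventually (fun n => ball_norm (K := C_AbsRing) (V := C_NormedModule) l eps (sum_n a n))).
    { apply H, (locally_le_locally_norm (K := C_AbsRing) (V := C_NormedModule)).
      apply locally_norm_ball_norm. }
    destruct H2 as [N HN]. exists N. intros n Hn. specialize (HN n Hn).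
    unfold ball; simpl. unfold AbsRing_ball, abs, minus, plus, opp; simpl.
    rewrite Ropp_0, Rplus_0_r, Rabs_pos_eq by apply Cmod_ge_0. exact HN.
  - intros P HP.
    apply (locally_norm_le_locally (K := C_AbsRing) (V := C_NormedModule)) in HP.
    destruct HP as [eps He].
    assert (H1 := proj1 (filterlim_locally _ _) H eps).
    destruct H1 as [N HN]. exists N. intros n Hn. apply He. specialize (HN n Hn).
    unfold ball in HN; simpl in HN. unfold AbsRing_ball, abs, minus, plus, opp in HN; simpl in HN.
    rewrite Ropp_0, Rplus_0_r, Rabs_pos_eq in HN by apply Cmod_ge_0. exact HN.
Qed.

Lemma Ccv_spec (u : nat -> C) (l : C) :
  Ccv u l <-> forall eps : R, (0 < eps)%R ->
    exists N, forall n, (N <= n)%nat -> (Cmod (u n - l) < eps)%R.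
Proof.
  unfold Ccv. rewrite is_lim_seq_Reals. unfold Un_cv, Rdist. split; intros H eps He;
    destruct (H eps He) as [N HN]; exists N; intros n Hn; specialize (HN n Hn);
    rewrite Rminus_0_r, Rabs_pos_eq in * by apply Cmod_ge_0; exact HN.
Qed.

Lemma Ccv_squeeze (u : nat -> C) (l : C) (e : nat -> R) :
  (forall n, (Cmod (u n - l) <= e n)%R) -> is_lim_seq e 0%R -> Ccv u l.
Proof.
  intros H He. apply (is_lim_seq_le_le (fun _ => 0%R) _ e); auto.
  - intros n. split; [apply Cmod_ge_0|apply H].
  - apply is_lim_seq_const.
Qed.

Lemma Ccv_unique (u : nat -> C) (l l' : C) : Ccv u l -> Ccv u l' -> l = l'.
Proof.
  rewrite !Ccv_spec. intros H H'.
  apply Ceq_minus, Cmod_eq_0. apply Rle_antisym; [|apply Cmod_ge_0].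
  apply le_epsilon. intros eps He.
  destruct (H (eps / 2)%R ltac:(lra)) as [N HN]. destruct (H' (eps / 2)%R ltac:(lra)) as [N' HN'].
  specialize (HN (N + N')%nat ltac:(lia)). specialize (HN' (N + N')%nat ltac:(lia)).
  replace (l - l') with ((u (N + N')%nat - l') - (u (N + N')%nat - l)) by ring.
  eapply Rle_trans; [apply Cmod_minus_le|]. lra.
Qed.

Lemma Ccv_ext (u v : nat -> C) (l : C) : (forall n, u n = v n) -> Ccv u l -> Ccv v l.
Proof. intros E H. eapply is_lim_seq_ext; [|exact H]. intros n; simpl; rewrite E; auto. Qed.

Lemma Ccv_const (l : C) : Ccv (fun _ => l) l.
Proof.
  apply (Ccv_squeeze _ _ (fun _ => 0%R)); [|apply is_lim_seq_const].
  intros _. replace (l - l) with (RtoC 0) by ring. rewrite Cmod_0. lra.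
Qed.

Lemma Ccv_plus (u v : nat -> C) (a b : C) :
  Ccv u a -> Ccv v b -> Ccv (fun n => u n + v n) (a + b).
Proof.
  intros H1 H2. apply (Ccv_squeeze _ _ (fun n => Cmod (u n - a) + Cmod (v n - b))%R).
  - intros n. replace (u n + v n - (a + b)) with ((u n - a) + (v n - b)) by ring. apply Cmod_triangle.
  - replace (Finite 0) with (Finite (0 + 0)) by (f_equal; ring).
    apply is_lim_seq_plus'; auto.
Qed.

Lemma Ccv_scal (u : nat -> C) (c a : C) : Ccv u a -> Ccv (fun n => c * u n) (c * a).
Proof.
  intros H1. apply (Ccv_squeeze _ _ (fun n => Cmod c * Cmod (u n - a))%R).
  - intros n. replace (c * u n - c * a) with (c * (u n - a)) by ring. rewrite Cmod_mult. lra.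
  - replace (Finite 0) with (Rbar_mult (Cmod c) 0) by (simpl; f_equal; ring).
    apply is_lim_seq_scal_l. exact H1.
Qed.

Lemma Ccv_minus (u v : nat -> C) (a b : C) :
  Ccv u a -> Ccv v b -> Ccv (fun n => u n - v n) (a - b).
Proof.
  intros H1 H2. apply (Ccv_ext (fun n => u n + (-(1)) * v n)); [intros n; ring|].
  replace (a - b) with (a + (-(1)) * b) by ring.
  apply Ccv_plus; auto. apply Ccv_scal; auto.
Qed.

Lemma Ccv_subseq (u : nat -> C) (l : C) (phi : nat -> nat) :
  (forall n, (n <= phi n)%nat) -> Ccv u l -> Ccv (fun n => u (phi n)) l.
Proof.
  rewrite !Ccv_spec. intros Hp H eps He. destruct (H eps He) as [N HN].
  exists N. intros n Hn. apply HN. specialize (Hp n). lia.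
Qed.

Lemma Ccv_bound (u : nat -> C) (l : C) (M : R) :
  (forall n, (Cmod (u n) <= M)%R) -> Ccv u l -> (Cmod l <= M)%R.
Proof.
  rewrite Ccv_spec. intros Hb H. apply le_epsilon. intros eps He.
  destruct (H eps He) as [N HN]. specialize (HN N (Nat.le_refl _)). specialize (Hb N).
  assert (X := Cmod_minus_ge l (u N)). rewrite Cmod_minus_sym in X. lra.
Qed.

(** * Integrals of complex-valued functions *)

Definition contC (f : R -> C) : Prop :=
  forall t, continuous (fun t => Re (f t)) t /\ continuous (fun t => Im (f t)) t.

Lemma contC_ext (f g : R -> C) : (forall t, f t = g t) -> contC f -> contC g.
Proof.
  intros E H t. destruct (H t) as [H1 H2].
  split; [apply (continuous_ext (fun t => Re (f t)))|apply (continuous_ext (fun t => Im (f t)))];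
    auto; intros x; rewrite E; reflexivity.
Qed.

Lemma contC_const (c : C) : contC (fun _ => c).
Proof. intros t; split; apply continuous_const. Qed.

Lemma contC_RtoC (f : R -> R) : (forall t, continuous f t) -> contC (fun t => RtoC (f t)).
Proof. intros H t; split; simpl; [apply H|apply continuous_const]. Qed.

Lemma contC_plus (f g : R -> C) : contC f -> contC g -> contC (fun t => f t + g t).
Proof.
  intros Hf Hg t. destruct (Hf t), (Hg t).
  split; apply (continuous_plus (V := R_NormedModule)); assumption.
Qed.

Lemma contC_mult (f g : R -> C) : contC f -> contC g -> contC (fun t => f t * g t).
Proof.
  intros Hf Hg t. destruct (Hf t), (Hg t).
  split; [apply (continuous_minus (V := R_NormedModule))|apply (continuous_plus (V := R_NormedModule))];
    apply (continuous_mult (K := R_AbsRing)); assumption.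
Qed.

Lemma contC_minus (f g : R -> C) : contC f -> contC g -> contC (fun t => f t - g t).
Proof.
  intros Hf Hg. apply (contC_ext (fun t => f t + (-(1)) * g t)); [intros t; ring|].
  apply contC_plus; auto. apply contC_mult; auto. apply contC_const.
Qed.

Lemma contC_cexp (f : R -> C) : contC f -> contC (fun t => cexp (f t)).
Proof.
  intros Hf t. destruct (Hf t) as [H1 H2].
  split; apply (continuous_mult (K := R_AbsRing)).
  1,3: apply (continuous_comp _ exp); [exact H1|].
  3,4: apply (continuous_comp (fun t => Im (f t))); [exact H2|].
  all: apply (ex_derive_continuous (K := R_AbsRing) (V := R_NormedModule)); auto_derive; auto.
Qed.

Lemma contC_pow (f : R -> C) (n : nat) : contC f -> contC (fun t => f t ^ n).
Proof.
  intros Hf. induction n as [|n IH]; [apply (contC_const 1)|].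
  apply (contC_mult f); auto.
Qed.

Lemma contC_sum (f : nat -> R -> C) (n : nat) :
  (forall k, contC (f k)) -> contC (fun t => sum_n (fun k => f k t) n).
Proof.
  intros Hf. induction n as [|n IH].
  - apply (contC_ext (f 0%nat)); auto. intros t; rewrite sum_O; auto.
  - apply (contC_ext (fun t => sum_n (fun k => f k t) n + f (S n) t)).
    + intros t; rewrite sum_Sn; auto.
    + apply contC_plus; auto.
Qed.

Definition CI (f : R -> C) (a b : R) : C :=
  (RInt (fun t => Re (f t)) a b, RInt (fun t => Im (f t)) a b).

Lemma contC_ex_RInt (f : R -> C) (a b : R) : contC f ->
  ex_RInt (fun t => Re (f t)) a b /\ ex_RInt (fun t => Im (f t)) a b.
Proof.
  intros H; split; apply (ex_RInt_continuous (V := R_CompleteNormedModule)); intros t _.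
  - exact (proj1 (H t)).
  - exact (proj2 (H t)).
Qed.

Lemma CI_ext (f g : R -> C) (a b : R) :
  (forall t, (Rmin a b < t < Rmax a b)%R -> f t = g t) -> CI f a b = CI g a b.
Proof.
  intros E. unfold CI. f_equal; apply RInt_ext; intros t Ht; rewrite E; auto.
Qed.

Lemma CI_plus (f g : R -> C) (a b : R) : contC f -> contC g ->
  CI (fun t => f t + g t) a b = CI f a b + CI g a b.
Proof.
  intros Hf Hg. destruct (contC_ex_RInt f a b Hf), (contC_ex_RInt g a b Hg).
  apply C_ext; simpl.
  - exact (RInt_plus (V := R_CompleteNormedModule) _ _ a b H H1).
  - exact (RInt_plus (V := R_CompleteNormedModule) _ _ a b H0 H2).
Qed.

Lemma CI_scal (c : C) (f : R -> C) (a b : R) : contC f ->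
  CI (fun t => c * f t) a b = c * CI f a b.
Proof.
  intros Hf. destruct (contC_ex_RInt f a b Hf) as [H1 H2].
  assert (S1 := fun l => RInt_scal (V := R_CompleteNormedModule) _ a b l H1).
  assert (S2 := fun l => RInt_scal (V := R_CompleteNormedModule) _ a b l H2).
  assert (E1 := fun l => ex_RInt_scal (V := R_NormedModule) _ a b l H1).
  assert (E2 := fun l => ex_RInt_scal (V := R_NormedModule) _ a b l H2).
  apply C_ext; simpl.
  - rewrite (RInt_ext _ (fun t => minus (scal (fst c) (Re (f t))) (scal (snd c) (Im (f t))))) by reflexivity.
    rewrite (RInt_minus (V := R_CompleteNormedModule)) by auto.
    rewrite S1, S2. reflexivity.
  - rewrite (RInt_ext _ (fun t => plus (scal (fst c) (Im (f t))) (scal (snd c) (Re (f t))))) by reflexivity.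
    rewrite (RInt_plus (V := R_CompleteNormedModule)) by auto.
    rewrite S1, S2. reflexivity.
Qed.

Lemma CI_minus (f g : R -> C) (a b : R) : contC f -> contC g ->
  CI (fun t => f t - g t) a b = CI f a b - CI g a b.
Proof.
  intros Hf Hg.
  rewrite (CI_ext _ (fun t => f t + (-(1)) * g t)) by (intros; ring).
  rewrite CI_plus, CI_scal; auto; [ring|].
  apply contC_mult; auto. apply contC_const.
Qed.

Lemma CI_Chasles (f : R -> C) (a b c : R) : contC f -> CI f a b + CI f b c = CI f a c.
Proof.
  intros Hf. destruct (contC_ex_RInt f a b Hf), (contC_ex_RInt f b c Hf).
  apply C_ext; simpl.
  - exact (RInt_Chasles (V := R_CompleteNormedModule) _ a b c H H1).
  - exact (RInt_Chasles (V := R_CompleteNormedModule) _ a b c H0 H2).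
Qed.

Lemma CI_point (f : R -> C) (a : R) : CI f a a = 0.
Proof. unfold CI. rewrite !(RInt_point (V := R_CompleteNormedModule)). reflexivity. Qed.

Lemma CI_bound (f : R -> C) (a b M : R) :
  (a <= b)%R -> contC f -> (forall t, (a <= t <= b)%R -> (Cmod (f t) <= M)%R) ->
  (Cmod (CI f a b) <= (b - a) * M)%R.
Proof.
  intros Hab Hf HM. destruct (contC_ex_RInt f a b Hf) as [H1 H2].
  rewrite Cmod_norm.
  apply (norm_RInt_le_const (V := C_R_NormedModule) f a b (CI f a b) M Hab).
  { intros t Ht. rewrite <- Cmod_norm. auto. }
  apply (is_RInt_fct_extend_pair (U := R_NormedModule) (V := R_NormedModule)).
  - exact (RInt_correct (V := R_CompleteNormedModule) _ _ _ H1).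
  - exact (RInt_correct (V := R_CompleteNormedModule) _ _ _ H2).
Qed.

(** * Improper integrals over the real line *)

Definition isInt (f : R -> C) (l : C) : Prop :=
  Ccv (fun n => CI f (- INR n) (INR n)) l.

Definition expb (d B : R) (f : R -> C) : Prop :=
  contC f /\ forall t, (Cmod (f t) <= B * exp (- d * Rabs t))%R.

Lemma isInt_unique (f : R -> C) (l l' : C) : isInt f l -> isInt f l' -> l = l'.
Proof. apply Ccv_unique. Qed.

Lemma isInt_ext (f g : R -> C) (l : C) : (forall t, f t = g t) -> isInt f l -> isInt g l.
Proof. intros E. apply Ccv_ext. intros n. apply CI_ext. auto. Qed.

Lemma isInt_plus (f g : R -> C) (a b : C) : contC f -> contC g ->
  isInt f a -> isInt g b -> isInt (fun t => f t + g t) (a + b).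
Proof.
  intros Hf Hg Ha Hb. eapply Ccv_ext; [|apply (Ccv_plus _ _ _ _ Ha Hb)].
  intros n. cbv beta. rewrite CI_plus; auto.
Qed.

Lemma isInt_scal (c : C) (f : R -> C) (a : C) : contC f ->
  isInt f a -> isInt (fun t => c * f t) (c * a).
Proof.
  intros Hf Ha. eapply Ccv_ext; [|apply (Ccv_scal _ c _ Ha)].
  intros n. cbv beta. rewrite CI_scal; auto.
Qed.

Lemma isInt_minus (f g : R -> C) (a b : C) : contC f -> contC g ->
  isInt f a -> isInt g b -> isInt (fun t => f t - g t) (a - b).
Proof.
  intros Hf Hg Ha Hb. eapply Ccv_ext; [|apply (Ccv_minus _ _ _ _ Ha Hb)].
  intros n. cbv beta. rewrite CI_minus; auto.
Qed.

Lemma exp_INR (n : nat) (x : R) : exp (INR n * x) = (exp x ^ n)%R.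
Proof.
  induction n as [|n IH]; [simpl; rewrite Rmult_0_l, exp_0; auto|].
  rewrite S_INR, Rmult_plus_distr_r, exp_plus, IH, Rmult_1_l. simpl. ring.
Qed.

Lemma expb_isInt (d B : R) (f : R -> C) : (0 < d)%R -> expb d B f ->
  exists l, isInt f l /\ (Cmod l <= 2 * B / (1 - exp (- d)))%R.
Proof.
  intros Hd [Hc Hb].
  set (q := exp (- d)).
  assert (Hq : (0 < q < 1)%R).
  { split; [apply exp_pos|]. rewrite <- exp_0. apply exp_increasing. lra. }
  assert (HB : (0 <= B)%R).
  { specialize (Hb 0%R). rewrite Rabs_R0, Rmult_0_r, exp_0 in Hb.
    assert (X := Cmod_ge_0 (f 0%R)). lra. }
  set (u := fun n => CI f (- INR n) (INR n)).
  assert (Hstep : forall n, (Cmod (u (S n) - u n) <= 2 * B * q ^ n)%R).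
  { intros n. unfold u.
    rewrite <- (CI_Chasles f (- INR (S n)) (- INR n) (INR (S n)) Hc).
    rewrite <- (CI_Chasles f (- INR n) (INR n) (INR (S n)) Hc).
    match goal with |- (Cmod (?a + (?b + ?c) - ?b) <= _)%R =>
      replace (a + (b + c) - b) with (a + c) by ring end.
    eapply Rle_trans; [apply Cmod_triangle|].
    assert (Hn := pos_INR n).
    assert (X : forall t, (INR n <= Rabs t)%R -> (Cmod (f t) <= B * q ^ n)%R).
    { intros t Ht. eapply Rle_trans; [apply Hb|]. apply Rmult_le_compat_l; auto.
      unfold q. rewrite <- exp_INR. apply exp_le. nra. }
    assert (H1 : (Cmod (CI f (- INR (S n)) (- INR n)) <= (- INR n - - INR (S n)) * (B * q ^ n))%R).
    { apply CI_bound; auto; [rewrite S_INR; lra|].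
      intros t Ht. apply X. rewrite Rabs_left1; lra. }
    assert (H2 : (Cmod (CI f (INR n) (INR (S n))) <= (INR (S n) - INR n) * (B * q ^ n))%R).
    { apply CI_bound; auto; [rewrite S_INR; lra|].
      intros t Ht. apply X. rewrite Rabs_pos_eq; lra. }
    rewrite S_INR in *. lra. }
  assert (H0 : u 0%nat = 0).
  { unfold u. simpl. rewrite Ropp_0. apply CI_point. }
  assert (Hbd : forall n, (Cmod (u n) <= 2 * B / (1 - q))%R).
  { assert (Hn : forall n, (Cmod (u n) <= 2 * B * (1 - q ^ n) / (1 - q))%R).
    { induction n as [|n IH].
      - rewrite H0, Cmod_0. simpl. unfold Rdiv. rewrite Rminus_diag, Rmult_0_r, Rmult_0_l. lra.
      - replace (u (S n)) with ((u (S n) - u n) + u n) by ring.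
        eapply Rle_trans; [apply Cmod_triangle|]. specialize (Hstep n).
        replace (2 * B * (1 - q ^ S n) / (1 - q))%R with
          (2 * B * q ^ n + 2 * B * (1 - q ^ n) / (1 - q))%R by (simpl; field; lra).
        lra. }
    intros n. eapply Rle_trans; [apply Hn|]. unfold Rdiv.
    apply Rmult_le_compat_r; [left; apply Rinv_0_lt_compat; lra|].
    assert (0 < q ^ n)%R by (apply pow_lt; lra). nra. }
  assert (Hex : ex_series (K := C_AbsRing) (V := C_CompleteNormedModule) (fun n => u (S n) - u n)).
  { apply (ex_series_le (K := C_AbsRing) (V := C_CompleteNormedModule) _ (fun n => 2 * B * q ^ n)%R).
    - exact Hstep.
    - apply (ex_series_scal_l (K := R_AbsRing) (2 * B)%R (fun n => q ^ n)%R).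
      apply ex_series_geom. rewrite Rabs_pos_eq; lra. }
  destruct Hex as [l Hl]. exists l.
  apply is_series_Ccv in Hl.
  assert (E : forall n, sum_n (fun n => u (S n) - u n) n = u (S n)).
  { induction n as [|n IH].
    - rewrite sum_O, H0. change (u 1%nat - 0 = u 1%nat). ring.
    - rewrite sum_Sn, IH. change (u (S n) + (u (S (S n)) - u (S n)) = u (S (S n))). ring. }
  assert (Hcv : Ccv u l).
  { unfold Ccv. apply is_lim_seq_incr_1. eapply Ccv_ext in Hl; [|exact E]. exact Hl. }
  split; [exact Hcv|]. apply (Ccv_bound u); auto.
Qed.

Definition IntR (f : R -> C) : C := epsilon (inhabits (RtoC 0)) (isInt f).

Lemma IntR_correct (d B : R) (f : R -> C) : (0 < d)%R -> expb d B f -> isInt f (IntR f).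
Proof.
  intros Hd Hf. unfold IntR. apply epsilon_spec.
  destruct (expb_isInt d B f Hd Hf) as [l [Hl _]]. exists l; exact Hl.
Qed.

Lemma IntR_bound (d B : R) (f : R -> C) : (0 < d)%R -> expb d B f ->
  (Cmod (IntR f) <= 2 * B / (1 - exp (- d)))%R.
Proof.
  intros Hd Hf. destruct (expb_isInt d B f Hd Hf) as [l [Hl Hb]].
  rewrite (isInt_unique f _ l (IntR_correct d B f Hd Hf) Hl). exact Hb.
Qed.

Lemma IntR_eq (f : R -> C) (l : C) : isInt f l -> IntR f = l.
Proof.
  intros H. apply (isInt_unique f); auto. unfold IntR. apply epsilon_spec. exists l; exact H.
Qed.

Lemma IntR_cv (d B : R) (f : nat -> R -> C) (g : R -> C) (e : nat -> R) :
  (0 < d)%R ->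
  (forall n, exists l, contC (f n) /\ isInt (f n) l) -> (exists l, contC g /\ isInt g l) ->
  (forall n t, (Cmod (f n t - g t) <= e n * (B * exp (- d * Rabs t)))%R) ->
  is_lim_seq e 0%R ->
  Ccv (fun n => IntR (f n)) (IntR g).
Proof.
  intros Hd Hf [lg [Hgc Hg]] Hb He.
  apply (Ccv_squeeze _ _ (fun n => e n * (2 * B / (1 - exp (- d))))%R).
  - intros n. destruct (Hf n) as [lf [Hfc Hl]].
    assert (Hi := isInt_minus _ _ _ _ Hfc Hgc Hl Hg).
    rewrite (IntR_eq _ _ Hl), (IntR_eq _ _ Hg).
    rewrite <- (IntR_eq _ _ Hi).
    replace (e n * (2 * B / (1 - exp (- d))))%R with (2 * (e n * B) / (1 - exp (- d)))%R.
    + apply IntR_bound; auto. split; [apply contC_minus; auto|].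
      intros t. rewrite Rmult_assoc. apply Hb.
    + field. assert (exp (- d) < 1)%R; [|lra]. rewrite <- exp_0. apply exp_increasing. lra.
  - replace (Finite 0) with (Rbar_mult 0 (2 * B / (1 - exp (- d)))%R) by (simpl; f_equal; ring).
    apply is_lim_seq_scal_r. exact He.
Qed.

(** * Complex differentiability *)

Definition Cder (f : C -> C) (z l : C) : Prop :=
  is_derive (K := C_AbsRing) (V := AbsRing_NormedModule C_AbsRing) f z l.

Lemma Cder_spec (f : C -> C) (z l : C) :
  Cder f z l <-> forall eps : R, (0 < eps)%R -> exists d : R, (0 < d)%R /\
    forall y, (Cmod (y - z) < d)%R -> (Cmod (f y - f z - (y - z) * l) <= eps * Cmod (y - z))%R.
Proof.
  split.
  - intros [_ H] eps He.
    destruct (H z (fun P HP => HP) (mkposreal eps He)) as [d Hd].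
    exists d. split; [apply cond_pos|]. intros y Hy. exact (Hd y Hy).
  - intros H. split; [apply is_linear_scal_l|].
    intros x Hx. apply (is_filter_lim_locally_unique (K := C_AbsRing) (V := AbsRing_NormedModule C_AbsRing)) in Hx.
    subst x. intros eps. destruct (H eps (cond_pos eps)) as [d [Hd Hy]].
    exists (mkposreal d Hd). intros y Hyd. exact (Hy y Hyd).
Qed.

Lemma Cder_quad (f : C -> C) (z l : C) (M d : R) : (0 < d)%R ->
  (forall h, (Cmod h < d)%R -> (Cmod (f (z + h)%C - f z - h * l) <= M * Cmod h ^ 2)%R) ->
  Cder f z l.
Proof.
  intros Hd H. apply Cder_spec. intros eps He.
  set (M' := (Rabs M + 1)%R). assert (HM : (0 < M')%R) by (unfold M'; assert (X := Rabs_pos M); lra).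
  exists (Rmin d (eps / M')). split.
  - apply Rmin_pos; auto. apply Rdiv_lt_0_compat; auto.
  - intros y Hy. specialize (H (y - z)). replace (z + (y - z)) with y in H by ring.
    assert (H1 := Rmin_l d (eps / M')). assert (H2 := Rmin_r d (eps / M')).
    eapply Rle_trans; [apply H; lra|].
    assert (H3 := Cmod_ge_0 (y - z)).
    assert (M <= M')%R by (unfold M'; assert (X := Rle_abs M); lra).
    assert (M' * Cmod (y - z) <= eps)%R.
    { replace eps with (M' * (eps / M'))%R by (field; lra).
      apply Rmult_le_compat_l; lra. }
    simpl. rewrite Rmult_1_r. nra.
Qed.

Definition Ccont (f : C -> C) (z : C) : Prop :=
  forall eps : R, (0 < eps)%R -> exists d : R, (0 < d)%R /\
    forall y, (Cmod (y - z) < d)%R -> (Cmod (f y - f z) < eps)%R.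

Lemma Cder_lip (f : C -> C) (z l : C) : Cder f z l ->
  exists d : R, (0 < d)%R /\
    forall y, (Cmod (y - z) < d)%R -> (Cmod (f y - f z) <= (Cmod l + 1) * Cmod (y - z))%R.
Proof.
  intros H. destruct (proj1 (Cder_spec f z l) H 1%R ltac:(lra)) as [d [Hd Hy]].
  exists d; split; auto. intros y Hyz. specialize (Hy y Hyz).
  replace (f y - f z) with ((f y - f z - (y - z) * l) + (y - z) * l) by ring.
  eapply Rle_trans; [apply Cmod_triangle|]. rewrite Cmod_mult. lra.
Qed.

Lemma Cder_Ccont (f : C -> C) (z l : C) : Cder f z l -> Ccont f z.
Proof.
  intros H eps He. destruct (Cder_lip f z l H) as [d [Hd Hy]].
  assert (Hl := Cmod_ge_0 l).
  exists (Rmin d (eps / (Cmod l + 2))). split.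
  - apply Rmin_pos; auto. apply Rdiv_lt_0_compat; lra.
  - intros y Hyz.
    assert (H1 := Rmin_l d (eps / (Cmod l + 2))). assert (H2 := Rmin_r d (eps / (Cmod l + 2))).
    eapply Rle_lt_trans; [apply Hy; lra|].
    assert (H3 := Cmod_ge_0 (y - z)).
    apply Rle_lt_trans with ((Cmod l + 1) * (eps / (Cmod l + 2)))%R.
    + apply Rmult_le_compat_l; lra.
    + replace eps with ((Cmod l + 2) * (eps / (Cmod l + 2)))%R at 2 by (field; lra).
      apply Rmult_lt_compat_r; [apply Rdiv_lt_0_compat; lra|lra].
Qed.

Lemma Cder_eq (f : C -> C) (z l l' : C) : Cder f z l -> l = l' -> Cder f z l'.
Proof. intros H <-. exact H. Qed.

Lemma Cder_ext (f g : C -> C) (z l : C) : (forall x, f x = g x) -> Cder f z l -> Cder g z l.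
Proof. intros E H. exact (is_derive_ext (K := C_AbsRing) (V := AbsRing_NormedModule C_AbsRing) f g z l E H). Qed.

Lemma Cder_const (c z : C) : Cder (fun _ => c) z 0.
Proof. exact (is_derive_const (K := C_AbsRing) (V := AbsRing_NormedModule C_AbsRing) c z). Qed.

Lemma Cder_id (z : C) : Cder (fun x => x) z 1.
Proof. exact (is_derive_id (K := C_AbsRing) z). Qed.

Lemma Cder_plus (f g : C -> C) (z a b : C) :
  Cder f z a -> Cder g z b -> Cder (fun x => f x + g x) z (a + b).
Proof. exact (is_derive_plus (K := C_AbsRing) (V := AbsRing_NormedModule C_AbsRing) f g z a b). Qed.

Lemma Cder_minus (f g : C -> C) (z a b : C) :
  Cder f z a -> Cder g z b -> Cder (fun x => f x - g x) z (a - b).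
Proof. exact (is_derive_minus (K := C_AbsRing) (V := AbsRing_NormedModule C_AbsRing) f g z a b). Qed.

Lemma Cder_mult (f g : C -> C) (z a b : C) :
  Cder f z a -> Cder g z b -> Cder (fun x => f x * g x) z (a * g z + f z * b).
Proof. intros H1 H2. exact (is_derive_mult (K := C_AbsRing) f g z a b H1 H2 Cmult_comm). Qed.

Lemma Cder_comp (f g : C -> C) (z a b : C) :
  Cder f (g z) a -> Cder g z b -> Cder (fun x => f (g x)) z (b * a).
Proof. exact (is_derive_comp (K := C_AbsRing) (V := AbsRing_NormedModule C_AbsRing) f g z a b). Qed.

Lemma Cder_lin (c d z : C) : Cder (fun x => c * (x - d)) z c.
Proof.
  eapply Cder_eq; [apply Cder_mult; [apply Cder_const|apply Cder_minus; [apply Cder_id|apply Cder_const]]|].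
  cbv beta. ring.
Qed.

Lemma Cder_cexp (z : C) : Cder cexp z (cexp z).
Proof.
  apply (Cder_quad _ _ _ (exp (Re z) * exp 1) 1); [lra|].
  intros h Hh. rewrite cexp_plus.
  replace (cexp z * cexp h - cexp z - h * cexp z) with (cexp z * (cexp h - ctay h 1)).
  - rewrite Cmod_mult, Cmod_cexp, Rmult_assoc. apply Rmult_le_compat_l; [left; apply exp_pos|].
    eapply Rle_trans; [apply cexp_taylor|].
    assert (H1 := Cmod_ge_0 h).
    assert (0 <= Cmod h ^ 2)%R by (apply pow_le; auto).
    apply Rmult_le_compat; [left; apply exp_pos| |apply exp_le; lra|].
    + apply Rdiv_le_0_compat; [auto|apply INR_fact_pos].
    + change (INR (fact 2)) with 2%R. lra.
  - rewrite ctay_S. unfold ctay. rewrite sum_O. simpl. field.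
Qed.

Lemma Cder_inv (z : C) : z <> 0 -> Cder Cinv z (- / (z * z)).
Proof.
  intros Hz. assert (Hp := proj1 (Cmod_gt_0 z) Hz).
  apply (Cder_quad _ _ _ (2 / Cmod z ^ 3) (Cmod z / 2)); [lra|].
  intros h Hh.
  assert (Hzh : (Cmod z / 2 <= Cmod (z + h))%R).
  { assert (X := Cmod_minus_ge z (- h)). rewrite Cmod_opp in X.
    replace (z - - h) with (z + h) in X by ring. lra. }
  assert (Hn : z + h <> 0) by (apply Cmod_gt_0; lra).
  replace (/ (z + h) - / z - h * - / (z * z)) with ((h * h) / (z * z * (z + h))) by (field; auto).
  rewrite Cmod_div by (repeat apply Cmult_neq_0; auto). rewrite !Cmod_mult.
  unfold Rdiv at 1. rewrite Rmult_comm.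
  replace (2 / Cmod z ^ 3 * Cmod h ^ 2)%R with (/ (Cmod z * Cmod z * (Cmod z / 2)) * (Cmod h * Cmod h))%R by (field; lra).
  apply Rmult_le_compat_r; [assert (X := Cmod_ge_0 h); nra|].
  assert (Hpp : (0 < Cmod z * Cmod z)%R) by (apply Rmult_lt_0_compat; auto).
  apply Rinv_le_contravar; [apply Rmult_lt_0_compat; lra|apply Rmult_le_compat_l; lra].
Qed.

Lemma Rder_line (F : C -> C) (a v l : C) (t : R) :
  Cder F (a + t * v) l -> Rder (fun t : R => F (a + t * v)) t (v * l).
Proof.
  intros H. rewrite Cder_spec in H.
  assert (K : forall eps : R, (0 < eps)%R -> exists d : posreal, forall h : R, h <> 0%R -> (Rabs h < d)%R ->
     (Cmod ((F (a + (t + h)%R * v)%C - F (a + t * v)%C) / h - v * l) < eps)%R).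
  { intros eps He. assert (Hv := Cmod_ge_0 v).
    destruct (H (eps / (Cmod v + 1))%R) as [d [Hd Hy]]; [apply Rdiv_lt_0_compat; lra|].
    assert (Hd' : (0 < d / (Cmod v + 1))%R) by (apply Rdiv_lt_0_compat; lra).
    exists (mkposreal _ Hd'). intros h Hh Hhd. simpl in Hhd.
    assert (Hr := Rabs_pos_lt h Hh).
    specialize (Hy (a + (t + h)%R * v)).
    replace (a + (t + h)%R * v - (a + t * v)) with (h * v) in Hy by (rewrite RtoC_plus; ring).
    rewrite Cmod_mult, Cmod_R in Hy.
    assert (E : (Rabs h * Cmod v < d)%R).
    { apply Rle_lt_trans with (Rabs h * (Cmod v + 1))%R; [apply Rmult_le_compat_l; lra|].
      apply (Rmult_lt_compat_r (Cmod v + 1)) in Hhd; [|lra].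
      replace (d / (Cmod v + 1) * (Cmod v + 1))%R with d in Hhd by (field; lra). exact Hhd. }
    specialize (Hy E).
    assert (Hc : RtoC h <> 0) by (apply RtoC_neq_0; auto).
    replace ((F (a + (t + h)%R * v) - F (a + t * v)) / h - v * l) with
      ((F (a + (t + h)%R * v) - F (a + t * v) - h * v * l) / h) by (field; auto).
    rewrite Cmod_div, Cmod_R by auto.
    apply Rle_lt_trans with (eps / (Cmod v + 1) * Cmod v)%R.
    - apply Rmult_le_reg_r with (Rabs h); auto.
      match goal with |- (?x / Rabs h * Rabs h <= _)%R => replace (x / Rabs h * Rabs h)%R with x by (field; lra) end.
      lra.
    - replace eps with (eps / (Cmod v + 1) * (Cmod v + 1))%R at 2 by (field; lra).
      apply Rmult_lt_compat_l; [apply Rdiv_lt_0_compat; lra|lra]. }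
  split; apply is_derive_Reals; intros eps He; destruct (K eps He) as [d Hd]; exists d;
    intros h Hh Hhd; specialize (Hd h Hh Hhd).
  - eapply Rle_lt_trans; [|exact Hd]. eapply Rle_trans; [|apply re_le_Cmod].
    right. f_equal. rewrite Re_minus. f_equal. unfold Cdiv. rewrite <- RtoC_inv by auto.
    rewrite re_scal_r, Re_minus. reflexivity.
  - eapply Rle_lt_trans; [|exact Hd]. eapply Rle_trans; [|apply im_le_Cmod].
    right. f_equal. rewrite Im_minus. f_equal. unfold Cdiv. rewrite <- RtoC_inv by auto.
    rewrite im_scal_r, Im_minus. reflexivity.
Qed.

Lemma Rder_vert (F : C -> C) (l : C) (y t : R) :
  Cder F (y, t) l -> Rder (fun t : R => F (y, t)) t (Ci * l).
Proof.
  intros H. apply (Rder_ext (fun t : R => F (y + t * Ci))).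
  - intros x. f_equal. apply C_ext; simpl; ring.
  - apply Rder_line. replace (y + t * Ci) with ((y, t) : C); auto. apply C_ext; simpl; ring.
Qed.

Lemma Rder_horiz (F : C -> C) (l : C) (y t : R) :
  Cder F (y, t) l -> Rder (fun y : R => F (y, t)) y l.
Proof.
  intros H. apply (Rder_ext (fun y : R => F ((0%R, t) + y * 1))).
  - intros x. f_equal. apply C_ext; simpl; ring.
  - replace l with (1 * l) by ring. apply Rder_line.
    replace ((0%R, t) + y * 1) with ((y, t) : C); auto. apply C_ext; simpl; ring.
Qed.

Lemma contC_vert (F : C -> C) (y : R) :
  (forall t, exists l, Cder F (y, t) l) -> contC (fun t : R => F (y, t)).
Proof.
  intros H t. destruct (H t) as [l Hl]. destruct (Rder_vert F l y t Hl) as [H1 H2].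
  split; apply (ex_derive_continuous (K := R_AbsRing) (V := R_NormedModule)); eexists; eassumption.
Qed.

(** * The logarithm on the right half-plane *)

Definition Log (z : C) : C := (ln (Cmod z), atan (Im z / Re z)).

Lemma cexp_Log (z : C) : (0 < Re z)%R -> cexp (Log z) = z.
Proof.
  intros Hz. assert (Hm : (0 < Cmod z)%R).
  { assert (X := re_le_Cmod z). rewrite Rabs_pos_eq in X; lra. }
  unfold cexp, Log. simpl Re; simpl Im. rewrite exp_ln by auto.
  rewrite cos_atan, sin_atan.
  assert (E : (Cmod z = Re z * sqrt (1 + Rsqr (Im z / Re z)))%R).
  { unfold Cmod. change (fst z) with (Re z). change (snd z) with (Im z).
    rewrite <- (sqrt_square (Re z)) at 2 by lra.
    rewrite <- sqrt_mult_alt by nra. f_equal. unfold Rsqr. field. lra. }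
  assert (Hs : (0 < sqrt (1 + Rsqr (Im z / Re z)))%R).
  { apply sqrt_lt_R0. assert (X := Rle_0_sqr (Im z / Re z)). lra. }
  rewrite E. apply C_ext; simpl; field; lra.
Qed.

Lemma Rder_Log (z h : C) (t : R) : (0 < Re (z + t * h))%R ->
  Rder (fun t : R => Log (z + t * h)) t (h / (z + t * h)).
Proof.
  intros Hp. destruct z as [x y], h as [a b].
  assert (Hq : (0 < x + t * a)%R) by (simpl in Hp; lra).
  assert (Hd : (0 < (x + t * a) ^ 2 + (y + t * b) ^ 2)%R)
    by (apply Rplus_lt_le_0_compat; [apply pow_lt; auto|apply pow2_ge_0]).
  assert (E : forall s : R, (x, y) + s * (a, b) = (x + s * a, y + s * b)%R).
  { intros s. apply C_ext; simpl; ring. }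
  apply (Rder_ext (fun s : R => Log (x + s * a, y + s * b)%R)); [intros s; rewrite E; reflexivity|].
  rewrite E. unfold Log, Cmod. split; simpl.
  - auto_derive; simpl in Hd.
    + repeat split; auto. apply sqrt_lt_R0. exact Hd.
    + set (S := ((x + t * a) * ((x + t * a) * 1) + (y + t * b) * ((y + t * b) * 1))%R) in *.
      assert (Hm := sqrt_lt_R0 S Hd). assert (HS := sqrt_sqrt S (Rlt_le _ _ Hd)).
      set (m := sqrt S) in *. rewrite <- HS. field. lra.
  - auto_derive; [lra|]. unfold Rsqr. simpl in Hd. rewrite !Rmult_1_r in Hd. field. lra.
Qed.

Lemma Cder_Log (z : C) : (0 < Re z)%R -> Cder Log z (/ z).
Proof.
  intros Hz.
  assert (Hm : (Re z <= Cmod z)%R).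
  { assert (X := re_le_Cmod z). rewrite Rabs_pos_eq in X; lra. }
  assert (Hz0 : z <> 0) by (apply Cmod_gt_0; lra).
  apply (Cder_quad _ _ _ (2 / Cmod z ^ 2) (Re z / 2)); [lra|].
  intros h Hh.
  assert (Hh0 := Cmod_ge_0 h).
  assert (Hre : forall t, (0 <= t <= 1)%R -> (0 < Re (z + t * h))%R).
  { intros t Ht. rewrite re_plus, re_scal_l.
    assert (X := re_le_Cmod h). apply Rabs_le_between in X. nra. }
  assert (Hd : forall t, (0 <= t <= 1)%R ->
    Rder (fun t : R => Log (z + t * h) - t * (h * / z)) t (h / (z + t * h) - h * / z)).
  { intros t Ht. apply Rder_minus; [apply Rder_Log; auto|apply Rder_lin]. }
  assert (H := mvt_Rder _ _ (fun t => t * (2 / Cmod z ^ 2 * Cmod h ^ 2))%R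
                 (fun _ => 2 / Cmod z ^ 2 * Cmod h ^ 2)%R 0 1 ltac:(lra) Hd).
  cbv beta in H. rewrite !Cmult_1_l, Cmult_0_l, Cplus_0_r in H.
  replace (Log (z + h) - Log z - h * / z) with
    (Log (z + h) - h * / z - (Log z - 0 * (h * / z))) by ring.
  eapply Rle_trans; [apply H|].
  - intros t Ht. auto_derive; auto. apply Rmult_1_l.
  - intros t Ht.
    assert (Hzh : (Cmod z / 2 <= Cmod (z + t * h))%R).
    { assert (X := Cmod_minus_ge z (- (t * h))). rewrite Cmod_opp, Cmod_mult, Cmod_R, Rabs_pos_eq in X by lra.
      replace (z - - (t * h)) with (z + t * h) in X by ring.
      assert (t * Cmod h <= Cmod h)%R by nra. lra. }
    assert (Hn : z + t * h <> 0) by (apply Cmod_gt_0; lra).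
    replace (h / (z + t * h) - h * / z) with (- (t * (h * h) / (z * (z + t * h)))) by (field; auto).
    rewrite Cmod_opp, Cmod_div by (apply Cmult_neq_0; auto).
    rewrite !Cmod_mult, Cmod_R, Rabs_pos_eq by lra.
    replace (2 / Cmod z ^ 2 * Cmod h ^ 2)%R with ((Cmod h * Cmod h) * / (Cmod z * (Cmod z / 2)))%R by (field; lra).
    apply Rmult_le_compat; try nra.
    + left. apply Rinv_0_lt_compat. nra.
    + apply Rinv_le_contravar; nra.
  - right. ring.
Qed.

Lemma Re_Log (z : C) : Re (Log z) = ln (Cmod z).
Proof. reflexivity. Qed.

Lemma Log_R (x : R) : (0 < x)%R -> Log x = ln x.
Proof.
  intros Hx. unfold Log. rewrite Cmod_R, Rabs_pos_eq by lra. simpl.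
  unfold Rdiv. rewrite Rmult_0_l, atan_0. reflexivity.
Qed.

Lemma Im_Log_bound (z : C) : (Rabs (Im (Log z)) <= 2)%R.
Proof.
  simpl. destruct (atan_bound (Im z / Re z)) as [H1 H2].
  assert (X := PI_4). apply Rabs_le. lra.
Qed.

Lemma ln_le_sub1 (x : R) : (0 < x)%R -> (ln x <= x - 1)%R.
Proof.
  intros Hx. destruct (Req_dec (ln x) 0) as [E|E].
  - assert (x = 1)%R; [|lra]. rewrite <- (exp_ln x), E, exp_0; auto.
  - assert (H := exp_ineq1 (ln x) E). rewrite exp_ln in H; lra.
Qed.

Lemma Log_growth (eps a b : R) : (0 < eps)%R -> (0 < a)%R ->
  exists K, forall y t, (a <= y <= b)%R -> (Cmod (Log (y, t)) <= eps * Rabs t + K)%R.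
Proof.
  intros He Ha.
  exists (eps * b + Rabs (ln eps) + Rabs (ln a) + 2)%R.
  intros y t [Hay Hyb].
  eapply Rle_trans; [apply Cmod_le_abs|].
  assert (H1 := Im_Log_bound (y, t)). rewrite Re_Log.
  assert (Hm1 : (a <= Cmod (y, t))%R).
  { assert (X := re_le_Cmod (y, t)). simpl in X. rewrite Rabs_pos_eq in X; lra. }
  assert (Hm2 : (Cmod (y, t) <= b + Rabs t)%R).
  { eapply Rle_trans; [apply Cmod_le_abs|]. simpl. rewrite (Rabs_pos_eq y); lra. }
  set (m := Cmod (y, t)) in *.
  assert (Hlow : (ln a <= ln m)%R) by (apply ln_le; lra).
  assert (Hup : (ln m <= eps * m - 1 - ln eps)%R).
  { assert (X := ln_le_sub1 (eps * m) ltac:(nra)). rewrite ln_mult in X by lra. lra. }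
  assert (Hem : (eps * m <= eps * (b + Rabs t))%R) by (apply Rmult_le_compat_l; lra).
  assert (X1 := Rle_abs (ln eps)). assert (X2 := Rabs_maj2 (ln eps)).
  assert (X3 := Rabs_maj2 (ln a)). assert (X4 := Rabs_pos t). assert (X5 := Rabs_pos (ln eps)).
  assert (X6 := Rabs_pos (ln a)).
  assert (Rabs (ln m) <= eps * b + eps * Rabs t + Rabs (ln eps) + Rabs (ln a))%R; [|lra].
  apply Rabs_le. split; nra.
Qed.

(** * Contour integration *)

Lemma Ccont_continuous (p : C -> R) (G : C -> C) (y t : R) :
  (forall u v, p (u - v) = (p u - p v)%R) -> (forall u, (Rabs (p u) <= Cmod u)%R) ->
  Ccont G (y, t) -> continuous (fun t => p (G (y, t))) t.
Proof.
  intros Hlin Hb HG. apply continuity_pt_filterlim. intros eps He. destruct (HG eps He) as [d [Hd Hyd]].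
  exists d. split; auto. intros t' [_ Ht']. simpl in *. unfold Rdist in *.
  rewrite <- Hlin. eapply Rle_lt_trans; [apply Hb|]. apply Hyd.
  eapply Rle_lt_trans; [apply Cmod_le_abs|]. simpl. rewrite Rplus_opp_r, Rabs_R0.
  unfold Rminus in *. lra.
Qed.

Lemma is_derive_RInt_proj (p : C -> R) (F F' : C -> C) (a b y eta : R) :
  (forall u v, p (u - v) = (p u - p v)%R) -> (forall u, (Rabs (p u) <= Cmod u)%R) ->
  (a <= b)%R -> (0 < eta)%R ->
  (forall u t, (Rabs (u - y) < eta)%R -> (a - eta < t < b + eta)%R ->
     is_derive (fun u => p (F (u, t))) u (p (F' (u, t))) /\
     Ccont F (u, t) /\ Ccont F' (u, t)) ->
  is_derive (fun u => RInt (fun t => p (F (u, t))) a b) y (RInt (fun t => p (F' (y, t))) a b).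
Proof.
  intros Hlin Hb Hab Heta H.
  assert (Hcont : forall (G : C -> C) u t, Ccont G (u, t) -> continuity_2d_pt (fun u t => p (G (u, t))) u t).
  { intros G u t HG eps. destruct (HG eps (cond_pos eps)) as [d [Hd Hy]].
    assert (Hd2 : (0 < d / 2)%R) by lra.
    exists (mkposreal _ Hd2). simpl. intros u' t' Hu Ht.
    rewrite <- Hlin. eapply Rle_lt_trans; [apply Hb|]. apply Hy.
    eapply Rle_lt_trans; [apply Cmod_le_abs|]. simpl. unfold Rminus in *. lra. }
  assert (Hloc : locally (y : R) (fun u : R => (Rabs (u - y) < eta)%R)).
  { exists (mkposreal _ Heta). intros u Hu. exact Hu. }
  assert (Hy0 : (Rabs (y - y) < eta)%R) by (rewrite Rminus_diag, Rabs_R0; auto).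
  rewrite (RInt_ext _ (fun t => Derive (fun u => p (F (u, t))) y)).
  2:{ rewrite Rmin_left, Rmax_right by auto. intros t Ht. symmetry. apply is_derive_unique.
      apply H; auto; lra. }
  apply is_derive_RInt_param; rewrite ?Rmin_left, ?Rmax_right by auto.
  - eapply filter_imp; [|exact Hloc]. intros u Hu t Ht. eexists. apply H; auto; lra.
  - intros t Ht.
    apply (continuity_2d_pt_ext_loc (fun u t => p (F' (u, t)))).
    2:{ apply Hcont. apply H; auto; lra. }
    exists (mkposreal _ Heta). simpl. intros u' t' Hu' Ht'. symmetry. apply is_derive_unique.
    apply Rabs_lt_between in Ht'. apply H; auto; lra.
  - eapply filter_imp; [|exact Hloc]. intros u Hu. apply (ex_RInt_continuous (V := R_CompleteNormedModule)).
    rewrite Rmin_left, Rmax_right by auto. intros t Ht.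
    destruct (H u t Hu ltac:(lra)) as [_ [HF _]].
    apply (Ccont_continuous p); auto.
Qed.

Lemma rect_bound (F F' : C -> C) (a b y1 y2 eta E : R) :
  (a <= b)%R -> (y1 <= y2)%R -> (0 < eta)%R ->
  (forall y t, (y1 - eta < y < y2 + eta)%R -> (a - eta < t < b + eta)%R ->
     Cder F (y, t) (F' (y, t)) /\ Ccont F' (y, t)) ->
  (forall y, (y1 <= y <= y2)%R -> (Cmod (F (y, a)) <= E)%R /\ (Cmod (F (y, b)) <= E)%R) ->
  (Cmod (CI (fun t => F (y2, t)) a b - CI (fun t => F (y1, t)) a b) <= (y2 - y1) * (2 * E))%R.
Proof.
  intros Hab Hy Heta H HE.
  assert (Hd : forall y, (y1 <= y <= y2)%R ->
            Rder (fun y => CI (fun t => F (y, t)) a b) y (CI (fun t => F' (y, t)) a b)).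
  { intros y Hyy. split.
    - apply (is_derive_RInt_proj Re F F' a b y eta); auto; [apply re_le_Cmod|].
      intros u t Hu Ht. apply Rabs_lt_between in Hu. destruct (H u t ltac:(lra) Ht) as [H1 H2].
      split; [apply (Rder_horiz _ _ _ _ H1)|split; auto]. eapply Cder_Ccont; eauto.
    - apply (is_derive_RInt_proj Im F F' a b y eta); auto; [apply im_le_Cmod|].
      intros u t Hu Ht. apply Rabs_lt_between in Hu. destruct (H u t ltac:(lra) Ht) as [H1 H2].
      split; [apply (Rder_horiz _ _ _ _ H1)|split; auto]. eapply Cder_Ccont; eauto. }
  assert (Hftc : forall y, (y1 <= y <= y2)%R ->
            CI (fun t => F' (y, t)) a b = - Ci * (F (y, b) - F (y, a))).
  { intros y Hyy. apply C_ext; simpl.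
    - transitivity (minus (Im (F (y, b))) (Im (F (y, a)))).
      + apply is_RInt_unique.
        apply (is_RInt_derive (V := R_CompleteNormedModule) (fun t => Im (F (y, t))));
          rewrite Rmin_left, Rmax_right by auto; intros t Ht;
          destruct (H y t ltac:(lra) ltac:(lra)) as [H1 H2].
        * evar_last; [apply (proj2 (Rder_vert _ _ _ _ H1))|]. unfold Re; simpl; ring.
        * apply (Ccont_continuous Re); auto. apply re_le_Cmod.
      + unfold minus, plus, opp, Im; simpl; ring.
    - transitivity (- minus (Re (F (y, b))) (Re (F (y, a))))%R.
      + apply is_RInt_unique.
        apply (is_RInt_ext (fun t => opp (opp (Im (F' (y, t)))))); [intros t _; apply Ropp_involutive|].
        apply (is_RInt_opp (V := R_NormedModule)).
        apply (is_RInt_derive (V := R_CompleteNormedModule) (fun t => Re (F (y, t))));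
          rewrite Rmin_left, Rmax_right by auto; intros t Ht;
          destruct (H y t ltac:(lra) ltac:(lra)) as [H1 H2].
        * evar_last; [apply (proj1 (Rder_vert _ _ _ _ H1))|]. unfold opp, Im; simpl; ring.
        * apply (continuous_opp (V := R_NormedModule)). apply (Ccont_continuous Im); auto. apply im_le_Cmod.
      + unfold minus, plus, opp, Re; simpl; ring. }
  assert (M := mvt_Rder _ _ (fun y => y * (2 * E))%R (fun _ => 2 * E)%R y1 y2 Hy Hd).
  cbv beta in M.
  replace ((y2 - y1) * (2 * E))%R with (y2 * (2 * E) - y1 * (2 * E))%R by ring.
  apply M.
  - intros t Ht. auto_derive; auto. ring.
  - intros t Ht. rewrite Hftc by auto.
    rewrite Cmod_mult, Cmod_opp, Cmod_Ci, Rmult_1_l.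
    eapply Rle_trans; [apply Cmod_minus_le|]. destruct (HE t Ht). lra.
Qed.

Definition sinus (v : C) : C := cexp (Ci * PI * v) - cexp (- (Ci * PI * v)).

Definition kern (v : C) : C := - (2 * PI) / (sinus v * sinus v).

Definition weight (t : R) : R := (2 * PI / (exp (PI * t) + exp (- (PI * t))) ^ 2)%R.

Lemma sinus_half_l (t : R) : sinus ((- / 2)%R, t) = (0, - (exp (PI * t) + exp (- (PI * t))))%R.
Proof.
  unfold sinus, cexp.
  replace (Re (Ci * PI * ((- / 2)%R, t))) with (- (PI * t))%R by (simpl; ring).
  replace (Im (Ci * PI * ((- / 2)%R, t))) with (- (PI / 2))%R by (simpl; field).
  rewrite re_opp, im_opp.
  replace (Re (Ci * PI * ((- / 2)%R, t))) with (- (PI * t))%R by (simpl; ring).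
  replace (Im (Ci * PI * ((- / 2)%R, t))) with (- (PI / 2))%R by (simpl; field).
  rewrite !Ropp_involutive, cos_neg, sin_neg, cos_PI2, sin_PI2. apply C_ext; simpl; ring.
Qed.

Lemma sinus_half_r (t : R) : sinus ((/ 2)%R, t) = (0, exp (PI * t) + exp (- (PI * t)))%R.
Proof.
  unfold sinus, cexp.
  replace (Re (Ci * PI * ((/ 2)%R, t))) with (- (PI * t))%R by (simpl; ring).
  replace (Im (Ci * PI * ((/ 2)%R, t))) with (PI / 2)%R by (simpl; field).
  rewrite re_opp, im_opp.
  replace (Re (Ci * PI * ((/ 2)%R, t))) with (- (PI * t))%R by (simpl; ring).
  replace (Im (Ci * PI * ((/ 2)%R, t))) with (PI / 2)%R by (simpl; field).
  rewrite !Ropp_involutive, cos_neg, sin_neg, cos_PI2, sin_PI2. apply C_ext; simpl; ring.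
Qed.

Lemma cosh_pos (t : R) : (0 < exp (PI * t) + exp (- (PI * t)))%R.
Proof. assert (H := exp_pos (PI * t)). assert (H' := exp_pos (- (PI * t))). lra. Qed.

Lemma kern_half (x t : R) : (x = / 2 \/ x = - / 2)%R -> kern (x, t) = weight t.
Proof.
  intros Hx. assert (Hc := cosh_pos t). unfold kern, weight.
  set (m := (exp (PI * t) + exp (- (PI * t)))%R) in *.
  assert (Hm : RtoC m <> 0) by (apply RtoC_neq_0; lra).
  assert (E : sinus (x, t) * sinus (x, t) = - (m * m)).
  { destruct Hx; subst x; [rewrite sinus_half_r|rewrite sinus_half_l]; fold m; apply C_ext; simpl; ring. }
  rewrite E. rewrite RtoC_div, RtoC_mult, RtoC_pow by (apply pow_nonzero; lra).
  field. auto.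
Qed.

Lemma sinus_lower (a b : R) : (exp (PI * Rabs b) - exp (- (PI * Rabs b)) <= Cmod (sinus (a, b)))%R.
Proof.
  unfold sinus.
  assert (E : Re (Ci * PI * ((a, b) : C)) = (- (PI * b))%R) by (simpl; ring).
  destruct (Rle_dec 0 b) as [Hb|Hb].
  - rewrite Rabs_pos_eq by auto. rewrite Cmod_minus_sym.
    eapply Rle_trans; [|apply Cmod_minus_ge]. rewrite !Cmod_cexp, re_opp, E, Ropp_involutive. lra.
  - rewrite Rabs_left by lra.
    eapply Rle_trans; [|apply Cmod_minus_ge]. rewrite !Cmod_cexp, re_opp, E, Ropp_involutive.
    replace (PI * - b)%R with (- (PI * b))%R by ring. rewrite Ropp_involutive. lra.
Qed.

Lemma sinus_neq_0 (a b : R) : (Rabs a < 1)%R -> (a <> 0 \/ b <> 0)%R -> sinus (a, b) <> 0.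
Proof.
  intros Ha Hab. assert (HPI := PI_RGT_0). destruct (Req_dec b 0) as [Hb|Hb].
  - subst b. destruct Hab as [Hab|Hab]; [|lra].
    assert (Hs : sin (PI * a) <> 0%R).
    { destruct (Rlt_dec 0 a) as [H|H].
      - rewrite Rabs_pos_eq in Ha by lra. apply Rgt_not_eq, sin_gt_0; nra.
      - rewrite Rabs_left in Ha by lra.
        replace (PI * a)%R with (- (PI * - a))%R by ring. rewrite sin_neg.
        assert (0 < sin (PI * - a))%R by (apply sin_gt_0; nra). lra. }
    intros E. apply Hs. apply (f_equal Im) in E. unfold sinus, cexp in E. simpl in E.
    replace (0 * PI + 1 * 0)%R with 0%R in E by ring.
    replace ((0 * PI - 1 * 0) * 0 + (0 * 0 + 1 * PI) * a)%R with (PI * a)%R in E by ring.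
    replace ((0 * PI - 1 * 0) * a - (0 * 0 + 1 * PI) * 0)%R with 0%R in E by ring.
    rewrite sin_neg, Ropp_0, exp_0 in E. lra.
  - apply Cmod_gt_0. eapply Rlt_le_trans; [|apply sinus_lower].
    assert (0 < Rabs b)%R by (apply Rabs_pos_lt; auto).
    assert (exp (- (PI * Rabs b)) < exp (PI * Rabs b))%R by (apply exp_increasing; nra). lra.
Qed.

Lemma Cder_sinus (c z : C) :
  Cder (fun z => sinus (z - c)) z (Ci * PI * (cexp (Ci * PI * (z - c)) + cexp (- (Ci * PI * (z - c))))).
Proof.
  unfold sinus. eapply Cder_eq.
  - apply Cder_minus.
    + apply (Cder_comp cexp (fun z => Ci * PI * (z - c))); [apply Cder_cexp|apply Cder_lin].
    + apply (Cder_ext (fun z => cexp (- (Ci * PI) * (z - c)))); [intros x; f_equal; ring|].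
      apply (Cder_comp cexp (fun z => - (Ci * PI) * (z - c))); [apply Cder_cexp|apply Cder_lin].
  - replace (- (Ci * PI) * (z - c)) with (- (Ci * PI * (z - c))) by ring. ring.
Qed.

Lemma sinus_near_0 : exists r : R, (0 < r)%R /\ forall v, (Cmod v < r)%R -> (Cmod v <= Cmod (sinus v))%R.
Proof.
  destruct (proj1 (Cder_spec _ _ _) (Cder_sinus 0 0) 1%R ltac:(lra)) as [r [Hr H]].
  exists r. split; auto. intros v Hv. specialize (H v).
  replace (v - 0) with v in H by ring. specialize (H Hv).
  replace (0 - 0) with (RtoC 0) in H by ring.
  unfold sinus at 2 in H. rewrite Cmult_0_r, Copp_0, cexp_0 in H.
  replace (sinus v - (1 - 1) - v * (Ci * PI * (1 + 1))) with (sinus v - v * (Ci * PI * 2)) in H by ring.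
  assert (X := Cmod_minus_ge (v * (Ci * PI * 2)) (v * (Ci * PI * 2) - sinus v)).
  rewrite (Cmod_minus_sym (v * (Ci * PI * 2)) (sinus v)) in X.
  replace (v * (Ci * PI * 2) - (v * (Ci * PI * 2) - sinus v)) with (sinus v) in X by ring.
  rewrite !Cmod_mult, Cmod_Ci, !Cmod_R, (Rabs_pos_eq PI), (Rabs_pos_eq 2) in X by (assert (Y := PI_RGT_0); lra).
  assert (Y := PI2_1). assert (Z := Cmod_ge_0 v).
  assert (Cmod v * (1 * PI * 2) >= Cmod v * 4)%R by (apply Rmult_ge_compat_l; lra). lra.
Qed.

Lemma exp_ge_2 (x : R) : (1 <= x)%R -> (2 <= exp x)%R.
Proof.
  intros Hx. assert (X := exp_ineq1 x ltac:(lra)). lra.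
Qed.

Lemma kern_far (a b : R) : (1 <= Rabs b)%R ->
  (Cmod (kern (a, b)) <= 8 * PI * exp (- (2 * PI) * Rabs b))%R.
Proof.
  intros Hb. assert (HPI := PI_RGT_0). assert (HP2 := PI2_1).
  assert (Hl := sinus_lower a b).
  set (e := exp (PI * Rabs b)) in *.
  assert (He : (2 <= e)%R) by (apply exp_ge_2; nra).
  assert (Hi : exp (- (PI * Rabs b)) = (/ e)%R) by apply exp_Ropp.
  assert (Hi2 : exp (- (2 * PI) * Rabs b) = (/ (e * e))%R).
  { unfold e. rewrite <- exp_plus, <- exp_Ropp. f_equal. ring. }
  assert (Hie : (/ e <= / 2)%R) by (apply Rinv_le_contravar; lra).
  assert (Hs : (e / 2 <= Cmod (sinus (a, b)))%R) by lra.
  assert (Hn : sinus (a, b) <> 0) by (apply Cmod_gt_0; lra).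
  unfold kern. rewrite Cmod_div, Cmod_opp, !Cmod_mult, !Cmod_R, (Rabs_pos_eq PI), (Rabs_pos_eq 2)
    by (try apply Cmult_neq_0; auto; lra).
  rewrite Hi2. replace (8 * PI * / (e * e))%R with (2 * PI * / ((e / 2) * (e / 2)))%R by (field; lra).
  unfold Rdiv at 1. apply Rmult_le_compat_l; [lra|].
  apply Rinv_le_contravar; [nra|]. apply Rmult_le_compat; lra.
Qed.

Lemma weight_bound (t : R) : (0 < weight t <= 2 * PI * exp (- (2 * PI) * Rabs t))%R.
Proof.
  assert (HPI := PI_RGT_0). assert (Hc := cosh_pos t). unfold weight.
  assert (He : (exp (PI * Rabs t) <= exp (PI * t) + exp (- (PI * t)))%R).
  { assert (X := exp_pos (PI * t)). assert (X' := exp_pos (- (PI * t))).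
    destruct (Rle_dec 0 t); [rewrite Rabs_pos_eq by auto; lra|].
    rewrite Rabs_left by lra. replace (PI * - t)%R with (- (PI * t))%R by ring. lra. }
  split; [apply Rdiv_lt_0_compat; [lra|apply pow_lt; auto]|].
  replace (exp (- (2 * PI) * Rabs t)) with (/ (exp (PI * Rabs t)) ^ 2)%R.
  2:{ simpl. rewrite Rmult_1_r, <- exp_plus, <- exp_Ropp. f_equal. ring. }
  unfold Rdiv. apply Rmult_le_compat_l; [lra|].
  assert (X := exp_pos (PI * Rabs t)).
  apply Rinv_le_contravar; [apply pow_lt; auto|]. apply pow_incr. lra.
Qed.

Lemma weight_derive (t : R) : is_derive (fun t => / (1 + exp (- (2 * PI * t))))%R t (weight t).
Proof.
  assert (H := exp_pos (- (2 * PI * t))). auto_derive; [lra|]. unfold weight.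
  assert (H1 := exp_pos (PI * t)).
  replace (- (2 * PI * t))%R with (- (PI * t) + - (PI * t))%R by ring.
  rewrite exp_plus, exp_Ropp. field.
  assert (0 < exp (PI * t) ^ 2)%R by (apply pow_lt; auto). simpl in *. lra.
Qed.

Lemma weight_continuous (t : R) : continuous weight t.
Proof.
  apply (ex_derive_continuous (K := R_AbsRing) (V := R_NormedModule)). unfold weight.
  auto_derive. assert (H := cosh_pos t).
  apply Rgt_not_eq. nra.
Qed.

Lemma isInt_weight : isInt (fun t => RtoC (weight t)) 1.
Proof.
  assert (HPI := PI_RGT_0).
  apply (Ccv_squeeze _ _ (fun n => 2 * exp (- (2 * PI)) ^ n)%R).
  - intros n. set (q := exp (- (2 * PI))).
    assert (E : CI (fun t => RtoC (weight t)) (- INR n) (INR n) =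
      RtoC (/ (1 + exp (- (2 * PI * INR n))) - / (1 + exp (- (2 * PI * - INR n))))%R).
    { apply C_ext; simpl.
      - apply is_RInt_unique.
        apply (is_RInt_derive (V := R_CompleteNormedModule) (fun t => / (1 + exp (- (2 * PI * t))))%R).
        + intros t _. apply weight_derive.
        + intros t _. apply weight_continuous.
      - rewrite RInt_const. unfold scal; simpl. unfold mult; simpl. ring. }
    rewrite E, <- RtoC_minus, Cmod_R.
    replace (- (2 * PI * INR n))%R with (INR n * - (2 * PI))%R by ring.
    replace (- (2 * PI * - INR n))%R with (- (INR n * - (2 * PI)))%R by ring.
    rewrite exp_Ropp, exp_INR. fold q.
    assert (Hq : (0 < q ^ n)%R) by (apply pow_lt, exp_pos).
    set (x := (q ^ n)%R) in *.
    replace (/ (1 + x) - / (1 + / x) - 1)%R with (- (2 * x / (1 + x)))%R by (field; lra).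
    rewrite Rabs_Ropp, Rabs_pos_eq by (apply Rdiv_le_0_compat; lra).
    apply Rmult_le_reg_r with (1 + x)%R; [lra|]. field_simplify; nra.
  - replace (Finite 0) with (Rbar_mult 2 0) by (simpl; f_equal; ring).
    apply is_lim_seq_scal_l. apply is_lim_seq_geom.
    rewrite Rabs_pos_eq by (left; apply exp_pos).
    rewrite <- exp_0. apply exp_increasing. lra.
Qed.

Lemma taylor1_quad (g g1 g2 : C -> C) (c : C) (r0 : R) : (0 < r0)%R ->
  (forall z, (Cmod (z - c) < r0)%R -> Cder g z (g1 z)) -> Cder g1 c (g2 c) ->
  exists M r : R, (0 < r)%R /\ (0 <= M)%R /\ forall z, (Cmod (z - c) < r)%R ->
    (Cmod (g z - g c - g1 c * (z - c)) <= M * (Cmod (z - c) * Cmod (z - c)))%R.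
Proof.
  intros Hr0 Hd H1. destruct (Cder_lip g1 c (g2 c) H1) as [d [Hd0 Hlip]].
  exists (Cmod (g2 c) + 1)%R, (Rmin r0 d).
  assert (HM := Cmod_ge_0 (g2 c)).
  split; [apply Rmin_pos; auto|]. split; [lra|].
  intros z Hz. assert (X1 := Rmin_l r0 d). assert (X2 := Rmin_r r0 d).
  set (h := z - c) in *. assert (Hh := Cmod_ge_0 h).
  assert (Hth : forall t : R, (0 <= t <= 1)%R -> (Cmod (c + t * h - c) <= Cmod h)%R).
  { intros t Ht. replace (c + t * h - c) with (t * h) by ring.
    rewrite Cmod_mult, Cmod_R, Rabs_pos_eq by lra. nra. }
  assert (HR : forall t, (0 <= t <= 1)%R ->
     Rder (fun t : R => g (c + t * h) - t * (h * g1 c)) t (h * g1 (c + t * h) - h * g1 c)).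
  { intros t Ht. apply Rder_minus; [|apply Rder_lin]. apply Rder_line. apply Hd.
    eapply Rle_lt_trans; [apply Hth; auto|lra]. }
  assert (K := mvt_Rder _ _ (fun t => t * ((Cmod (g2 c) + 1) * (Cmod h * Cmod h)))%R
                (fun _ => (Cmod (g2 c) + 1) * (Cmod h * Cmod h))%R 0 1 ltac:(lra) HR).
  cbv beta in K. rewrite !Cmult_1_l, Cmult_0_l, Cplus_0_r in K.
  replace (c + h) with z in K by (unfold h; ring).
  replace (g z - g c - g1 c * h) with (g z - h * g1 c - (g c - 0 * (h * g1 c))) by ring.
  eapply Rle_trans; [apply K|].
  - intros t Ht. auto_derive; auto. apply Rmult_1_l.
  - intros t Ht. replace (h * g1 (c + t * h) - h * g1 c) with (h * (g1 (c + t * h) - g1 c)) by ring.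
    rewrite Cmod_mult.
    assert (L := Hlip (c + t * h)).
    assert (Y := Hth t Ht). specialize (L ltac:(lra)).
    apply Rle_trans with (Cmod h * ((Cmod (g2 c) + 1) * Cmod h))%R; [|right; ring].
    apply Rmult_le_compat_l; auto. eapply Rle_trans; [apply L|]. apply Rmult_le_compat_l; lra.
  - right. ring.
Qed.

Definition Cdiff (f : C -> C) (z : C) : Prop := exists l, Cder f z l.

Lemma Cdiff_const (c z : C) : Cdiff (fun _ => c) z.
Proof. eexists; apply Cder_const. Qed.
Lemma Cdiff_plus (f g : C -> C) (z : C) : Cdiff f z -> Cdiff g z -> Cdiff (fun x => f x + g x) z.
Proof. intros [a Ha] [b Hb]. eexists; apply Cder_plus; eauto. Qed.
Lemma Cdiff_minus (f g : C -> C) (z : C) : Cdiff f z -> Cdiff g z -> Cdiff (fun x => f x - g x) z.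
Proof. intros [a Ha] [b Hb]. eexists; apply Cder_minus; eauto. Qed.
Lemma Cdiff_mult (f g : C -> C) (z : C) : Cdiff f z -> Cdiff g z -> Cdiff (fun x => f x * g x) z.
Proof. intros [a Ha] [b Hb]. eexists; apply Cder_mult; eauto. Qed.
Lemma Cdiff_lin (c d z : C) : Cdiff (fun x => c * (x - d)) z.
Proof. eexists; apply Cder_lin. Qed.
Lemma Cdiff_inv (f : C -> C) (z : C) : f z <> 0 -> Cdiff f z -> Cdiff (fun x => / f x) z.
Proof. intros Hf [a Ha]. eexists; apply (Cder_comp Cinv f); [apply Cder_inv; auto|eauto]. Qed.
Lemma Cdiff_cexp (f : C -> C) (z : C) : Cdiff f z -> Cdiff (fun x => cexp (f x)) z.
Proof. intros [a Ha]. eexists; apply (Cder_comp cexp f); [apply Cder_cexp|eauto]. Qed.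
Lemma Cdiff_ext (f g : C -> C) (z : C) : (forall x, f x = g x) -> Cdiff f z -> Cdiff g z.
Proof. intros E [a Ha]. exists a. eapply Cder_ext; eauto. Qed.

(* The double pole of [kern] at c is cancelled by subtracting from g its
   first-order Taylor polynomial; integrating the difference around the strip
   then gives 0, and the polynomial contributes the residue. *)
Lemma residue_step (g g1 g2 : C -> C) (c A B : R) (l1 l2 : C) :
  (1 <= A < 2 * PI)%R ->
  (forall z, (Rabs (Re z - c) < 1)%R -> Cder g z (g1 z) /\ Cder g1 z (g2 z)) ->
  (forall z, (Rabs (Re z - c) <= / 2)%R -> (Cmod (g z) <= B * exp (A * Rabs (Im z)))%R) ->
  isInt (fun t => g (c + - / 2, t)%R * weight t) l1 ->
  isInt (fun t => g (c + / 2, t)%R * weight t) l2 ->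
  l1 - l2 = - g1 c.
Proof.
  intros [HA1 HA2] Hd Hg H1 H2. assert (HPI := PI_RGT_0).
  assert (Hc1 : forall z, (Cmod (z - c) < 1)%R -> (Rabs (Re z - c) < 1)%R).
  { intros z Hz. eapply Rle_lt_trans; [|exact Hz]. exact (re_le_Cmod (z - c)). }
  set (gt := fun z : C => g z - g c - g1 c * (z - c)).
  set (F := fun z : C => gt z * kern (z - c)).
  set (sd := fun z : C => Ci * PI * (cexp (Ci * PI * (z - c)) + cexp (- (Ci * PI * (z - c))))).
  set (s := fun z : C => sinus (z - c)).
  set (kd := fun z : C => - (2 * PI) * ((sd z * s z + s z * sd z) * - / ((s z * s z) * (s z * s z)))).
  set (F1 := fun z : C => (g1 z - g1 c) * kern (z - c) + gt z * kd z).
  assert (Hs0 : forall z, (Rabs (Re z - c) < 1)%R -> z <> c -> s z <> 0).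
  { intros z Hz Hzc. unfold s. destruct z as [y t].
    replace ((y, t) - c) with ((y - c)%R, t) by (apply C_ext; simpl; ring).
    apply sinus_neq_0; auto. destruct (Req_dec t 0) as [E|E]; auto. left. intros E'.
    apply Hzc. apply C_ext; simpl; lra. }
  assert (Hgtd : forall z, (Rabs (Re z - c) < 1)%R -> Cder gt z (g1 z - g1 c)).
  { intros z Hz.
    assert (X := Cder_minus _ _ _ _ _
                   (Cder_minus _ _ _ _ _ (proj1 (Hd z Hz)) (Cder_const (g c) z)) (Cder_lin (g1 c) c z)).
    replace (g1 z - 0 - g1 c) with (g1 z - g1 c) in X by ring. exact X. }
  assert (HK : forall z, (Rabs (Re z - c) < 1)%R -> z <> c -> Cder (fun z => kern (z - c)) z (kd z)).
  { intros z Hz Hzc. assert (Hsz := Hs0 z Hz Hzc).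
    assert (Hss := Cder_mult s s z _ _ (Cder_sinus c z) (Cder_sinus c z)).
    assert (Hi := Cder_comp Cinv (fun z => s z * s z) z _ _ (Cder_inv _ (Cmult_neq_0 _ _ Hsz Hsz)) Hss).
    assert (X := Cder_mult _ _ _ _ _ (Cder_const (- (2 * PI)) z) Hi). cbv beta in X.
    replace (kd z) with (0 * / (s z * s z) + - (2 * PI) * ((Ci * PI * (cexp (Ci * PI * (z - c)) + cexp (- (Ci * PI * (z - c)))) * s z +
             s z * (Ci * PI * (cexp (Ci * PI * (z - c)) + cexp (- (Ci * PI * (z - c)))))) * - / (s z * s z * (s z * s z)))).
    - exact X.
    - unfold kd, sd. ring. }
  assert (HF : forall z, (Rabs (Re z - c) < 1)%R -> z <> c -> Cder F z (F1 z)).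
  { intros z Hz Hzc. exact (Cder_mult _ _ _ _ _ (Hgtd z Hz) (HK z Hz Hzc)). }
  assert (Hsd : forall z, Cdiff s z) by (intros z; eexists; apply Cder_sinus).
  assert (HF1 : forall z, (Rabs (Re z - c) < 1)%R -> z <> c -> Ccont F1 z).
  { intros z Hz Hzc.
    assert (Hsz := Hs0 z Hz Hzc).
    assert (Hsdd : Cdiff sd z).
    { apply (Cdiff_mult (fun _ => Ci * PI)); [apply Cdiff_const|].
      apply (Cdiff_plus (fun z => cexp (Ci * PI * (z - c))) (fun z => cexp (- (Ci * PI * (z - c))))).
      - apply (Cdiff_cexp (fun z => Ci * PI * (z - c))), Cdiff_lin.
      - apply (Cdiff_cexp (fun z => - (Ci * PI * (z - c)))).
        apply (Cdiff_ext (fun x => - (Ci * PI) * (x - c))); [intros x; ring|apply Cdiff_lin]. }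
    assert (Hs2 := Cdiff_mult s s z (Hsd z) (Hsd z)).
    assert (Hs4 := Cdiff_mult (fun z => s z * s z) (fun z => s z * s z) z Hs2 Hs2).
    assert (Hi4 := Cdiff_inv (fun z => s z * s z * (s z * s z)) z (Cmult_neq_0 _ _ (Cmult_neq_0 _ _ Hsz Hsz) (Cmult_neq_0 _ _ Hsz Hsz)) Hs4).
    assert (Hi4' := Cdiff_minus _ _ _ (Cdiff_const 0 z) Hi4).
    assert (Hnum := Cdiff_plus _ _ _ (Cdiff_mult _ _ _ Hsdd (Hsd z)) (Cdiff_mult _ _ _ (Hsd z) Hsdd)).
    assert (Hkd : Cdiff kd z).
    { apply (Cdiff_ext (fun z => - (2 * PI) * ((sd z * s z + s z * sd z) * (0 - / (s z * s z * (s z * s z)))))).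
      - intros x. unfold kd. ring.
      - exact (Cdiff_mult _ _ _ (Cdiff_const (- (2 * PI)) z) (Cdiff_mult _ _ _ Hnum Hi4')). }
    assert (HD : Cdiff F1 z).
    { exact (Cdiff_plus _ _ _
               (Cdiff_mult _ _ _
                  (Cdiff_minus _ _ _ (ex_intro _ _ (proj2 (Hd z Hz))) (Cdiff_const (g1 c) z))
                  (ex_intro _ _ (HK z Hz Hzc)))
               (Cdiff_mult _ _ _ (ex_intro _ _ (Hgtd z Hz)) Hkd)). }
    destruct HD as [l Hl]. eapply Cder_Ccont; eauto. }
  assert (HFy : forall y t : R, (Rabs (y - c) < 1)%R -> (y <> c \/ t <> 0)%R ->
             Cder F (y, t) (F1 (y, t)) /\ Ccont F1 (y, t)).
  { intros y t Hy Hyt. assert ((y, t) <> RtoC c).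
    { intros E. injection E; intros; subst. destruct Hyt; auto. }
    split; [apply HF|apply HF1]; auto. }
  assert (HFc : forall y, (Rabs (y - c) < 1)%R -> y <> c -> contC (fun t => F (y, t))).
  { intros y Hy Hyc. apply contC_vert. intros t. eexists. apply HFy; auto. }

  assert (Hnear : exists M r : R, (0 < r)%R /\ (0 <= M)%R /\
            forall z : C, z <> c -> (Cmod (z - c) < r)%R -> (Cmod (F z) <= M)%R).
  { destruct (taylor1_quad g g1 g2 c 1) as [M [r [Hr [HM Hq]]]]; [lra| |apply Hd|].
    { intros z Hz. apply Hd, Hc1, Hz. }
    { simpl. rewrite Rminus_diag, Rabs_R0. lra. }
    destruct sinus_near_0 as [r' [Hr' Hs]].
    exists (M * (2 * PI))%R, (Rmin r r'). split; [apply Rmin_pos; auto|].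
    split; [apply Rmult_le_pos; lra|].
    intros z Hzc Hz. assert (X1 := Rmin_l r r'). assert (X2 := Rmin_r r r').
    specialize (Hq z ltac:(lra)). specialize (Hs (z - c) ltac:(lra)).
    assert (Hp := proj1 (Cmod_gt_0 _) (Cminus_eq_contra _ _ Hzc)).
    set (m := Cmod (z - c)) in *.
    assert (Hsn : sinus (z - c) <> 0) by (apply Cmod_gt_0; lra).
    unfold F, kern. rewrite Cmod_mult, Cmod_div by (apply Cmult_neq_0; auto).
    rewrite Cmod_opp, !Cmod_mult, !Cmod_R, (Rabs_pos_eq PI), (Rabs_pos_eq 2) by lra.
    apply Rle_trans with ((M * (m * m)) * (2 * PI / (m * m)))%R.
    - apply Rmult_le_compat; [apply Cmod_ge_0| |exact Hq|].
      + apply Rdiv_le_0_compat; [lra|]. apply Rmult_lt_0_compat; lra.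
      + unfold Rdiv. apply Rmult_le_compat_l; [lra|]. apply Rinv_le_contravar; [nra|].
        apply Rmult_le_compat; lra.
    - right. field. lra. }
  destruct Hnear as [M [r [Hr [HM Hnear]]]].
  assert (Hlines : forall (T E : R), (1 <= T)%R -> (0 <= E)%R ->
     (forall y, (Rabs (y - c) <= / 2)%R -> (Cmod (F (y, T)) <= E /\ Cmod (F (y, (- T)%R)) <= E)%R) ->
     (Cmod (CI (fun t => F (c + / 2, t)%R) (- T) T - CI (fun t => F (c + - / 2, t)%R) (- T) T) <= 2 * E)%R).
  { intros T E HT HE HEb.
    assert (Hsmall : forall eta, (0 < eta)%R -> (eta < / 2)%R -> (2 * eta < r)%R ->
      (Cmod (CI (fun t => F (c + / 2, t)%R) (- T) T - CI (fun t => F (c + - / 2, t)%R) (- T) T)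
        <= 2 * E + eta * (12 * M + 8 * E))%R).
    { intros eta He1 He2 He3.
      assert (R1 : (Cmod (CI (fun t => F (c + / 2, t)%R) (- T) T - CI (fun t => F (c + eta, t)%R) (- T) T)
                     <= (c + / 2 - (c + eta)) * (2 * E))%R).
      { apply (rect_bound F F1 _ _ _ _ (eta / 2)); try lra.
        - intros y t Hy Ht. apply HFy; [apply Rabs_lt_between; lra|lra].
        - intros y Hy. destruct (HEb y); [apply Rabs_le_between; lra|]. auto. }
      assert (R2 : (Cmod (CI (fun t => F (c + - eta, t)%R) (- T) T - CI (fun t => F (c + - / 2, t)%R) (- T) T)
                     <= (c + - eta - (c + - / 2)) * (2 * E))%R).
      { apply (rect_bound F F1 _ _ _ _ (eta / 2)); try lra.
        - intros y t Hy Ht. apply HFy; [apply Rabs_lt_between; lra|lra].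
        - intros y Hy. destruct (HEb y); [apply Rabs_le_between; lra|]. auto. }
      assert (Hin : forall y t, (Rabs (y - c) <= eta)%R -> (Rabs t <= eta)%R -> (y <> c \/ t <> 0)%R ->
                 (Cmod (F (y, t)) <= M)%R).
      { intros y t Hy Ht Hyt. apply Hnear.
        - intros X. injection X; intros; subst. destruct Hyt; auto.
        - eapply Rle_lt_trans; [apply Cmod_le_abs|]. simpl.
          replace (y + - c)%R with (y - c)%R by ring. replace (t + - 0)%R with t by ring. lra. }
      assert (R3 : (Cmod (CI (fun t => F (c + eta, t)%R) eta T - CI (fun t => F (c + - eta, t)%R) eta T)
                     <= (c + eta - (c + - eta)) * (2 * (M + E)))%R).
      { apply (rect_bound F F1 _ _ _ _ (eta / 2)); try lra.
        - intros y t Hy Ht. apply HFy; [apply Rabs_lt_between; lra|lra].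
        - intros y Hy. destruct (HEb y); [apply Rabs_le_between; lra|].
          assert (Y := Hin y eta). split; [|lra].
          specialize (Y ltac:(apply Rabs_le_between; lra) ltac:(rewrite Rabs_pos_eq; lra) ltac:(lra)). lra. }
      assert (R4 : (Cmod (CI (fun t => F (c + eta, t)%R) (- T) (- eta) - CI (fun t => F (c + - eta, t)%R) (- T) (- eta))
                     <= (c + eta - (c + - eta)) * (2 * (M + E)))%R).
      { apply (rect_bound F F1 _ _ _ _ (eta / 2)); try lra.
        - intros y t Hy Ht. apply HFy; [apply Rabs_lt_between; lra|lra].
        - intros y Hy. destruct (HEb y); [apply Rabs_le_between; lra|].
          assert (Y := Hin y (- eta)%R). split; [lra|].
          specialize (Y ltac:(apply Rabs_le_between; lra) ltac:(rewrite Rabs_left; lra) ltac:(lra)). lra. }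
      assert (C1 : contC (fun t => F (c + eta, t)%R)) by (apply HFc; [apply Rabs_lt_between; lra|lra]).
      assert (C2 : contC (fun t => F (c + - eta, t)%R)) by (apply HFc; [apply Rabs_lt_between; lra|lra]).
      assert (R5 : (Cmod (CI (fun t => F (c + eta, t)%R) (- eta) eta) <= (eta - - eta) * M)%R).
      { apply CI_bound; auto; [lra|]. intros t Ht.
        apply Hin; [apply Rabs_le_between; lra|apply Rabs_le_between; lra|lra]. }
      assert (R6 : (Cmod (CI (fun t => F (c + - eta, t)%R) (- eta) eta) <= (eta - - eta) * M)%R).
      { apply CI_bound; auto; [lra|]. intros t Ht.
        apply Hin; [apply Rabs_le_between; lra|apply Rabs_le_between; lra|lra]. }
      assert (E1 : CI (fun t => F (c + eta, t)%R) (- T) T =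
        CI (fun t => F (c + eta, t)%R) (- T) (- eta) + CI (fun t => F (c + eta, t)%R) (- eta) eta
        + CI (fun t => F (c + eta, t)%R) eta T) by (rewrite !CI_Chasles; auto).
      assert (E2 : CI (fun t => F (c + - eta, t)%R) (- T) T =
        CI (fun t => F (c + - eta, t)%R) (- T) (- eta) + CI (fun t => F (c + - eta, t)%R) (- eta) eta
        + CI (fun t => F (c + - eta, t)%R) eta T) by (rewrite !CI_Chasles; auto).
      set (a1 := CI (fun t => F (c + / 2, t)%R) (- T) T) in *.
      set (a2 := CI (fun t => F (c + - / 2, t)%R) (- T) T) in *.
      set (p1 := CI (fun t => F (c + eta, t)%R) (- T) T) in *.
      set (p2 := CI (fun t => F (c + - eta, t)%R) (- T) T) in *.
      set (b1 := CI (fun t => F (c + eta, t)%R) (- T) (- eta)) in *.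
      set (b2 := CI (fun t => F (c + - eta, t)%R) (- T) (- eta)) in *.
      set (m1 := CI (fun t => F (c + eta, t)%R) (- eta) eta) in *.
      set (m2 := CI (fun t => F (c + - eta, t)%R) (- eta) eta) in *.
      set (u1 := CI (fun t => F (c + eta, t)%R) eta T) in *.
      set (u2 := CI (fun t => F (c + - eta, t)%R) eta T) in *.
      replace (a1 - a2) with ((a1 - p1) + (p2 - a2) + ((b1 - b2) + (u1 - u2) + (m1 - m2)))
        by (rewrite E1, E2; ring).
      assert (Q1 := Cmod_triangle ((a1 - p1) + (p2 - a2)) ((b1 - b2) + (u1 - u2) + (m1 - m2))).
      assert (Q2 := Cmod_triangle (a1 - p1) (p2 - a2)).
      assert (Q3 := Cmod_triangle ((b1 - b2) + (u1 - u2)) (m1 - m2)).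
      assert (Q4 := Cmod_triangle (b1 - b2) (u1 - u2)).
      assert (Q5 := Cmod_minus_le m1 m2).
      assert (0 <= eta * E)%R by (apply Rmult_le_pos; lra).
      lra. }
    apply le_epsilon. intros eps Heps.
    set (K0 := (12 * M + 8 * E + 1)%R). assert (HKp : (0 < K0)%R) by (unfold K0; lra).
    set (eta := Rmin (/ 4) (Rmin (r / 4) (eps / K0))).
    assert (X1 := Rmin_l (/ 4) (Rmin (r / 4) (eps / K0))). assert (X2 := Rmin_r (/ 4) (Rmin (r / 4) (eps / K0))).
    assert (X3 := Rmin_l (r / 4) (eps / K0)). assert (X4 := Rmin_r (r / 4) (eps / K0)).
    fold eta in X1, X2.
    assert (Heta : (0 < eta)%R).
    { unfold eta. repeat apply Rmin_pos; try lra. apply Rdiv_lt_0_compat; auto. }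
    eapply Rle_trans; [apply (Hsmall eta); lra|].
    assert (eta * (12 * M + 8 * E) <= eps)%R; [|lra].
    apply Rle_trans with (eps / K0 * K0)%R; [|right; field; lra].
    apply Rmult_le_compat; [lra|lra|lra|unfold K0; lra]. }

  set (q := exp (A - 2 * PI)).
  set (C0 := ((B + Cmod (g c) + Cmod (g1 c)) * (8 * PI))%R).
  assert (HB : (0 <= B)%R).
  { specialize (Hg c). simpl in Hg. rewrite Rminus_diag, Rabs_R0, Rmult_0_r, exp_0 in Hg.
    assert (X := Cmod_ge_0 (g c)). lra. }
  assert (HC0 : (0 <= C0)%R).
  { unfold C0. assert (X := Cmod_ge_0 (g c)). assert (Y := Cmod_ge_0 (g1 c)). apply Rmult_le_pos; lra. }
  assert (Hedge : forall (n : nat) y t, (1 <= INR n)%R -> (Rabs (y - c) <= / 2)%R -> Rabs t = INR n ->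
             (Cmod (F (y, t)) <= C0 * q ^ n)%R).
  { intros n y t Hn Hy Ht. unfold F, gt. rewrite Cmod_mult.
    assert (Hk : (Cmod (kern ((y, t) - c)) <= 8 * PI * exp (- (2 * PI) * INR n))%R).
    { replace ((y, t) - c) with ((y - c)%R, t) by (apply C_ext; simpl; ring).
      rewrite <- Ht. apply kern_far. lra. }
    set (e := exp (A * INR n)).
    assert (He : (1 + INR n <= e)%R).
    { unfold e. apply Rle_trans with (exp (INR n)); [left; apply exp_ineq1; lra|apply exp_le; nra]. }
    assert (Hgt : (Cmod (g (y, t) - g c - g1 c * ((y, t) - c)) <= (B + Cmod (g c) + Cmod (g1 c)) * e)%R).
    { eapply Rle_trans; [apply Cmod_minus_le|].
      assert (X1 := Cmod_minus_le (g (y, t)) (g c)).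
      assert (X2 := Hg (y, t) Hy). simpl in X2. rewrite Ht in X2. fold e in X2.
      rewrite Cmod_mult.
      assert (X3 : (Cmod ((y, t) - c) <= e)%R).
      { eapply Rle_trans; [apply Cmod_le_abs|]. simpl.
        replace (y + - c)%R with (y - c)%R by ring. replace (t + - 0)%R with t by ring. lra. }
      assert (X4 := Cmod_ge_0 (g c)). assert (X5 := Cmod_ge_0 (g1 c)).
      assert (Cmod (g1 c) * Cmod ((y, t) - c) <= Cmod (g1 c) * e)%R by (apply Rmult_le_compat_l; auto).
      assert (Cmod (g c) * 1 <= Cmod (g c) * e)%R by (apply Rmult_le_compat_l; lra). lra. }
    apply Rle_trans with (((B + Cmod (g c) + Cmod (g1 c)) * e) * (8 * PI * exp (- (2 * PI) * INR n)))%R.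
    - apply Rmult_le_compat; auto; apply Cmod_ge_0.
    - right. unfold C0, q. rewrite <- exp_INR. unfold e.
      replace (INR n * (A - 2 * PI))%R with (A * INR n + - (2 * PI) * INR n)%R by ring.
      rewrite exp_plus. ring. }
  assert (Cg : forall x, (Rabs x <= / 2)%R -> contC (fun t => g (c + x, t)%R)).
  { intros x Hx. apply contC_vert. intros t. exists (g1 (c + x, t)%R).
    refine (proj1 (Hd _ _)). simpl. replace (c + x - c)%R with x by ring. lra. }
  assert (Cw : contC (fun t => RtoC (weight t))) by (apply contC_RtoC, weight_continuous).
  assert (Ctw : contC (fun t => RtoC t * weight t)).
  { apply contC_mult; auto. apply contC_RtoC. intros t. apply continuous_id. }
  set (W := fun n => CI (fun t => RtoC (weight t)) (- INR n) (INR n)).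
  assert (HJ : forall x n, (x = / 2 \/ x = - / 2)%R ->
     CI (fun t => F (c + x, t)%R) (- INR n) (INR n) =
     CI (fun t => g (c + x, t)%R * weight t) (- INR n) (INR n) - (g c + g1 c * x) * W n
       - (g1 c * Ci) * CI (fun t => RtoC t * weight t) (- INR n) (INR n)).
  { intros x n Hx.
    assert (Hx2 : (Rabs x <= / 2)%R) by (destruct Hx; subst x; [rewrite Rabs_pos_eq|rewrite Rabs_left]; lra).
    rewrite (CI_ext _ (fun t => g (c + x, t)%R * weight t - (g c + g1 c * x) * weight t
                - (g1 c * Ci) * (RtoC t * weight t))).
    - assert (Cgx := Cg x Hx2).
      assert (D1 : contC (fun t => g (c + x, t)%R * weight t)) by (apply contC_mult; auto).
      assert (D2 : forall a, contC (fun t => a * RtoC (weight t))) by (intros a; apply contC_mult; auto; apply contC_const).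
      assert (D3 : forall a, contC (fun t => a * (RtoC t * weight t))) by (intros a; apply contC_mult; auto; apply contC_const).
      rewrite CI_minus, CI_minus, !CI_scal; auto. apply contC_minus; auto.
    - intros t _. unfold F, gt.
      replace ((c + x, t)%R - c) with (x, t) by (apply C_ext; simpl; ring).
      rewrite kern_half by auto.
      replace ((x, t) : C) with (x + t * Ci) by (apply C_ext; simpl; ring). ring. }
  assert (Hcv : Ccv (fun n => CI (fun t => F (c + / 2, t)%R) (- INR n) (INR n)
                     - CI (fun t => F (c + - / 2, t)%R) (- INR n) (INR n)) (l2 - l1 - g1 c * 1)).
  { apply (Ccv_ext (fun n => CI (fun t => g (c + / 2, t)%R * weight t) (- INR n) (INR n)
       - CI (fun t => g (c + - / 2, t)%R * weight t) (- INR n) (INR n) - g1 c * W n)).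
    - intros n. rewrite !HJ by auto.
      replace (RtoC (/ 2)) with (/ 2) by (rewrite RtoC_inv by lra; auto).
      replace (RtoC (- / 2)) with (- / 2) by (rewrite RtoC_opp, RtoC_inv by lra; auto).
      field.
    - apply Ccv_minus; [apply Ccv_minus; auto|]. apply Ccv_scal. exact isInt_weight. }
  assert (H0 : l2 - l1 - g1 c * 1 = 0).
  { apply (Ccv_unique (fun n => CI (fun t => F (c + / 2, t)%R) (- INR (S n)) (INR (S n))
                     - CI (fun t => F (c + - / 2, t)%R) (- INR (S n)) (INR (S n)))).
    - apply (Ccv_subseq _ _ S) in Hcv; [exact Hcv|]. intros n; lia.
    - apply (Ccv_squeeze _ _ (fun n => 2 * C0 * q * q ^ n)%R).
      + intros n. cbv beta. unfold Cminus at 1. rewrite Copp_0, Cplus_0_r.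
        replace (2 * C0 * q * q ^ n)%R with (2 * (C0 * q ^ S n))%R by (simpl; ring).
        assert (Hn : (1 <= INR (S n))%R) by (rewrite S_INR; assert (X := pos_INR n); lra).
        assert (Hq : (0 <= q ^ S n)%R) by (left; apply pow_lt, exp_pos).
        apply Hlines; auto; [apply Rmult_le_pos; auto|].
        intros y Hy. split; apply Hedge; auto; [apply Rabs_pos_eq; lra|rewrite Rabs_Ropp; apply Rabs_pos_eq; lra].
      + replace (Finite 0) with (Rbar_mult (2 * C0 * q)%R 0) by (simpl; f_equal; ring).
        apply is_lim_seq_scal_l. apply is_lim_seq_geom. unfold q.
        rewrite Rabs_pos_eq by (left; apply exp_pos). rewrite <- exp_0. apply exp_increasing. lra. }
  replace (l1 - l2) with (- (l2 - l1 - g1 c * 1) - g1 c) by ring. rewrite H0. ring.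
Qed.

(** * Power series and the identity theorem *)

Definition psum (a : nat -> C) (v : C) (n : nat) : C := sum_n (fun k => v ^ k * a k) n.

Lemma pow_n_Cpow (v : C) (n : nat) : pow_n (K := C_Ring) v n = v ^ n.
Proof. induction n as [|n IH]; simpl; [reflexivity|]. rewrite IH. reflexivity. Qed.

Lemma is_pseries_psum (a : nat -> C) (v l : C) :
  is_pseries (K := C_AbsRing) (V := C_NormedModule) a v l <-> Ccv (psum a v) l.
Proof.
  unfold is_pseries. rewrite is_series_Ccv. unfold psum.
  split; apply Ccv_ext; intros n; apply sum_n_ext; intros k; rewrite <- pow_n_Cpow; reflexivity.
Qed.

Lemma analytic_at_iff (f : C -> C) (z0 : C) :
  analytic_at f z0 <-> exists (a : nat -> C) (r : R), (0 < r)%R /\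
    forall z, (Cmod (z - z0) < r)%R -> Ccv (psum a (z - z0)) (f z).
Proof.
  split; intros [a [r [Hr H]]]; exists a, r; split; auto; intros z Hz;
    apply is_pseries_psum; auto.
Qed.

Lemma psum_S (a : nat -> C) (v : C) (n : nat) : psum a v (S n) = psum a v n + v ^ S n * a (S n).
Proof. unfold psum. rewrite sum_Sn. reflexivity. Qed.

Lemma psum_O (a : nat -> C) (v : C) : psum a v 0 = a 0%nat.
Proof. unfold psum. rewrite sum_O. simpl. ring. Qed.

Lemma analytic_at_ext_loc (f g : C -> C) (z0 : C) (r : R) : (0 < r)%R ->
  (forall z, (Cmod (z - z0) < r)%R -> f z = g z) -> analytic_at f z0 -> analytic_at g z0.
Proof.
  intros Hr E. rewrite !analytic_at_iff. intros [a [r' [Hr' H]]].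
  exists a, (Rmin r r'). split; [apply Rmin_pos; auto|]. intros z Hz.
  assert (X1 := Rmin_l r r'). assert (X2 := Rmin_r r r').
  rewrite <- E by lra. apply H. lra.
Qed.

Lemma analytic_at_ext (f g : C -> C) (z0 : C) :
  (forall z, f z = g z) -> analytic_at f z0 -> analytic_at g z0.
Proof. intros E. apply (analytic_at_ext_loc f g z0 1); auto; lra. Qed.

Lemma analytic_at_plus (f g : C -> C) (z0 : C) :
  analytic_at f z0 -> analytic_at g z0 -> analytic_at (fun z => f z + g z) z0.
Proof.
  rewrite !analytic_at_iff. intros [a [r [Hr H]]] [b [r' [Hr' H']]].
  exists (fun n => a n + b n), (Rmin r r'). split; [apply Rmin_pos; auto|]. intros z Hz.
  assert (X1 := Rmin_l r r'). assert (X2 := Rmin_r r r').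
  eapply Ccv_ext; [|apply (Ccv_plus _ _ _ _ (H z ltac:(lra)) (H' z ltac:(lra)))].
  intros n; cbv beta. induction n as [|n IH]; [rewrite !psum_O; auto|].
  rewrite !psum_S, <- IH. ring.
Qed.

Lemma analytic_at_scal (c : C) (f : C -> C) (z0 : C) :
  analytic_at f z0 -> analytic_at (fun z => c * f z) z0.
Proof.
  rewrite !analytic_at_iff. intros [a [r [Hr H]]].
  exists (fun n => c * a n), r. split; auto. intros z Hz.
  eapply Ccv_ext; [|apply (Ccv_scal _ c _ (H z Hz))].
  intros n; cbv beta. induction n as [|n IH]; [rewrite !psum_O; auto|].
  rewrite !psum_S, <- IH. ring.
Qed.

Lemma analytic_at_minus (f g : C -> C) (z0 : C) :
  analytic_at f z0 -> analytic_at g z0 -> analytic_at (fun z => f z - g z) z0.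
Proof.
  intros Hf Hg. apply (analytic_at_ext (fun z => f z + (- (1)) * g z)); [intros z; ring|].
  apply analytic_at_plus; auto. apply analytic_at_scal; auto.
Qed.

Lemma analytic_at_shift (f : C -> C) (d z0 : C) :
  analytic_at f (z0 + d) -> analytic_at (fun z => f (z + d)) z0.
Proof.
  rewrite !analytic_at_iff. intros [a [r [Hr H]]]. exists a, r. split; auto. intros z Hz.
  specialize (H (z + d)). replace (z + d - (z0 + d)) with (z - z0) in H by ring. auto.
Qed.

Lemma analytic_at_mul_lin (f : C -> C) (p z0 : C) :
  analytic_at f z0 -> analytic_at (fun z => (z - p) * f z) z0.
Proof.
  rewrite !analytic_at_iff. intros [a [r [Hr H]]].
  set (b := fun n => (z0 - p) * a n + match n with O => 0 | S m => a m end).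
  exists b, r. split; auto. intros z Hz. specialize (H z Hz).
  set (v := z - z0) in *.
  apply (Ccv_ext (fun n => (z0 - p) * psum a v n + v * match n with O => 0 | S m => psum a v m end)).
  { intros n. induction n as [|n IH]; [rewrite !psum_O; unfold b; ring|].
    rewrite (psum_S b), <- IH, psum_S. unfold b. destruct n.
    - rewrite psum_O. simpl. ring.
    - rewrite psum_S, !Cpow_S. ring. }
  replace ((z - p) * f z) with ((z0 - p) * f z + v * f z) by (unfold v; ring).
  apply Ccv_plus; apply Ccv_scal; auto.
  unfold Ccv. apply is_lim_seq_incr_1. exact H.
Qed.

Lemma Ccv_terms_0 (a : nat -> C) (v l : C) : Ccv (psum a v) l -> Ccv (fun n => v ^ n * a n) 0.
Proof.
  intros H. unfold Ccv. apply is_lim_seq_incr_1.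
  assert (H1 : Ccv (fun n => psum a v (S n)) l) by (apply (Ccv_subseq _ _ S); auto).
  assert (H2 := Ccv_minus _ _ _ _ H1 H). replace (l - l) with (RtoC 0) in H2 by ring.
  eapply is_lim_seq_ext; [|exact H2]. intros n; simpl. f_equal. rewrite psum_S. simpl. ring.
Qed.

Lemma Ccv_bounded (u : nat -> C) (l : C) : Ccv u l -> exists M, forall n, (Cmod (u n) <= M)%R.
Proof.
  rewrite Ccv_spec. intros H. destruct (H 1%R ltac:(lra)) as [N HN].
  assert (HM : exists M, forall n, (n < N)%nat -> (Cmod (u n) <= M)%R).
  { clear HN. induction N as [|N [M HM]]; [exists 0%R; intros; lia|].
    exists (Rmax M (Cmod (u N))). intros n Hn. destruct (Nat.eq_dec n N) as [->|Hne]; [apply Rmax_r|].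
    eapply Rle_trans; [apply HM; lia|apply Rmax_l]. }
  destruct HM as [M HM]. exists (Rmax M (Cmod l + 1)). intros n.
  destruct (Nat.lt_ge_cases n N) as [Hn|Hn].
  - eapply Rle_trans; [apply HM; auto|apply Rmax_l].
  - eapply Rle_trans; [|apply Rmax_r]. specialize (HN n Hn).
    assert (X := Cmod_minus_ge (u n) l). lra.
Qed.

Lemma pseries_coef_bound (a : nat -> C) (f : C -> C) (z0 : C) (r : R) : (0 < r)%R ->
  (forall z, (Cmod (z - z0) < r)%R -> Ccv (psum a (z - z0)) (f z)) ->
  exists M, (0 < M)%R /\ forall n, (Cmod (a n) * (r / 2) ^ n <= M)%R.
Proof.
  intros Hr H. specialize (H (z0 + (r / 2)%R)).
  replace (z0 + (r / 2)%R - z0) with (RtoC (r / 2)%R) in H by ring.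
  rewrite Cmod_R, Rabs_pos_eq in H by lra. specialize (H ltac:(lra)).
  destruct (Ccv_bounded _ _ (Ccv_terms_0 _ _ _ H)) as [M HM].
  exists (Rmax M 1). split; [assert (X := Rmax_r M 1); lra|].
  intros n. specialize (HM n). rewrite Cmod_mult, Cmod_pow, Cmod_R, Rabs_pos_eq in HM by lra.
  assert (X := Rmax_l M 1). lra.
Qed.

(* The coefficients b of the quotient satisfy (z0 - p) b_n + b_(n-1) = a_n. *)
Lemma analytic_at_div_lin (f : C -> C) (p z0 : C) : z0 <> p ->
  analytic_at f z0 -> analytic_at (fun z => f z / (z - p)) z0.
Proof.
  intros Hp. rewrite !analytic_at_iff. intros [a [r [Hr H]]].
  destruct (pseries_coef_bound a f z0 r Hr H) as [M [HM Ha]].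
  set (c := z0 - p). assert (Hc : c <> 0) by (apply Cminus_eq_contra; auto).
  assert (Hcp := proj1 (Cmod_gt_0 _) Hc).
  set (b := fix b n := match n with O => a O / c | S m => (a (S m) - b m) / c end).
  set (rho := Rmin (r / 2) (Cmod c / 2)).
  assert (Hr1 : (rho <= r / 2)%R) by apply Rmin_l. assert (Hr2 : (rho <= Cmod c / 2)%R) by apply Rmin_r.
  assert (Hrho : (0 < rho)%R) by (apply Rmin_pos; lra).
  assert (Hb : forall n, (Cmod (b n) * rho ^ n <= 2 * M / Cmod c)%R).
  { assert (Ha' : forall n, (Cmod (a n) * rho ^ n <= M)%R).
    { intros n. eapply Rle_trans; [|apply (Ha n)]. apply Rmult_le_compat_l; [apply Cmod_ge_0|].
      apply pow_incr; lra. }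
    induction n as [|n IH].
    - simpl b. rewrite Cmod_div by auto. specialize (Ha' 0%nat). simpl in *.
      rewrite Rmult_1_r in *. unfold Rdiv. apply Rmult_le_compat_r; [left; apply Rinv_0_lt_compat; auto|lra].
    - simpl b. rewrite Cmod_div by auto. specialize (Ha' (S n)).
      apply Rmult_le_reg_r with (Cmod c); auto.
      replace (Cmod (a (S n) - b n) / Cmod c * rho ^ S n * Cmod c)%R
        with (Cmod (a (S n) - b n) * rho ^ S n)%R by (field; lra).
      replace (2 * M / Cmod c * Cmod c)%R with (2 * M)%R by (field; lra).
      assert (X := Cmod_minus_le (a (S n)) (b n)).
      assert (Hpw : (0 < rho ^ S n)%R) by (apply pow_lt; auto).
      apply Rle_trans with (Cmod (a (S n)) * rho ^ S n + rho * (Cmod (b n) * rho ^ n))%R.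
      { apply Rle_trans with ((Cmod (a (S n)) + Cmod (b n)) * rho ^ S n)%R;
          [apply Rmult_le_compat_r; lra|]. simpl. right. ring. }
      assert (rho * (Cmod (b n) * rho ^ n) <= (Cmod c / 2) * (2 * M / Cmod c))%R.
      { apply Rmult_le_compat; auto; [lra|]. apply Rmult_le_pos; [apply Cmod_ge_0|left; apply pow_lt; auto]. }
      replace (Cmod c / 2 * (2 * M / Cmod c))%R with M in H0 by (field; lra). lra. }
  exists b, rho. split; auto. intros z Hz. specialize (H z ltac:(lra)).
  set (v := z - z0) in *.
  assert (Hcv : c + v <> 0).
  { apply Cmod_gt_0. assert (X := Cmod_minus_ge c (- v)). rewrite Cmod_opp in X.
    replace (c - - v) with (c + v) in X by ring. lra. }
  apply (Ccv_ext (fun n => / (c + v) * (psum a v n + v * (v ^ n * b n)))).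
  { intros n.
    assert (E : (c + v) * psum b v n = psum a v n + v * (v ^ n * b n)).
    { induction n as [|n IH]; [rewrite !psum_O; simpl; field; auto|].
      rewrite !psum_S. simpl b.
      replace ((c + v) * (psum b v n + v ^ S n * ((a (S n) - b n) / c))) with
        ((c + v) * psum b v n + (c + v) * v ^ S n * ((a (S n) - b n) / c)) by ring.
      rewrite IH, !Cpow_S. field. auto. }
    rewrite <- E. field. auto. }
  replace (f z / (z - p)) with (/ (c + v) * (f z + v * 0)).
  2:{ replace (z - p) with (c + v) by (unfold c, v; ring). field. auto. }
  apply Ccv_scal. apply Ccv_plus; auto. apply Ccv_scal.
  apply (Ccv_squeeze _ _ (fun n => 2 * M / Cmod c * (Cmod v / rho) ^ n)%R).
  - intros n. unfold Cminus. rewrite Copp_0, Cplus_0_r, Cmod_mult, Cmod_pow.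
    unfold Rdiv at 2. rewrite Rpow_mult_distr, pow_inv.
    assert (Hpw : (0 < rho ^ n)%R) by (apply pow_lt; auto).
    apply Rmult_le_reg_r with (rho ^ n)%R; auto.
    replace (2 * M / Cmod c * (Cmod v ^ n * / rho ^ n) * rho ^ n)%R with (Cmod v ^ n * (2 * M / Cmod c))%R by (field; lra).
    rewrite Rmult_assoc. apply Rmult_le_compat_l; auto. apply pow_le, Cmod_ge_0.
  - replace (Finite 0) with (Rbar_mult (2 * M / Cmod c)%R 0) by (simpl; f_equal; ring).
    apply is_lim_seq_scal_l. apply is_lim_seq_geom.
    assert (Hv := Cmod_ge_0 v).
    rewrite Rabs_pos_eq by (apply Rdiv_le_0_compat; lra).
    apply Rmult_lt_reg_r with rho; auto. unfold Rdiv. rewrite Rmult_assoc, Rinv_l by lra. lra.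
Qed.

Lemma psum_tail (a : nat -> C) (M rho : R) (n : nat) (v : C) (m : nat) : (0 < M)%R -> (0 < rho)%R ->
  (forall k, (Cmod (a k) * rho ^ k <= M)%R) -> (forall k, (k < n)%nat -> a k = 0) ->
  (Cmod v <= rho / 2)%R ->
  (Cmod (psum a v (n + m) - v ^ n * a n) <= 2 * M * (Cmod v / rho) ^ S n * (1 - (/ 2) ^ m))%R.
Proof.
  intros HM Hrho Ha IH Hv.
  assert (Hv0 := Cmod_ge_0 v).
  set (x := (Cmod v / rho)%R).
  assert (Hx0 : (0 <= x)%R) by (apply Rdiv_le_0_compat; lra).
  assert (Hx : (x <= / 2)%R).
  { unfold x. apply Rmult_le_reg_r with rho; auto. unfold Rdiv. rewrite Rmult_assoc, Rinv_l by lra. lra. }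
  induction m as [|m IHm].
  - rewrite Nat.add_0_r.
    assert (E : psum a v n = v ^ n * a n).
    { destruct n as [|n]; [rewrite psum_O; simpl; ring|]. rewrite psum_S.
      assert (E0 : forall k, (k <= n)%nat -> psum a v k = 0).
      { induction k as [|k IHk]; intros Hk; [rewrite psum_O; apply IH; lia|].
        rewrite psum_S, IHk, IH by lia. ring. }
      rewrite E0 by lia. ring. }
    rewrite E. replace (v ^ n * a n - v ^ n * a n) with (RtoC 0) by ring. rewrite Cmod_0.
    simpl. lra.
  - rewrite Nat.add_succ_r, psum_S.
    replace (psum a v (n + m) + v ^ S (n + m) * a (S (n + m)) - v ^ n * a n) with
      ((psum a v (n + m) - v ^ n * a n) + v ^ S (n + m) * a (S (n + m))) by ring.
    eapply Rle_trans; [apply Cmod_triangle|].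
    assert (Ht : (Cmod (v ^ S (n + m) * a (S (n + m))) <= M * x ^ S n * (/ 2) ^ m)%R).
    { rewrite Cmod_mult, Cmod_pow.
      replace (Cmod v) with (rho * x)%R by (unfold x; field; lra).
      rewrite Rpow_mult_distr. specialize (Ha (S (n + m))).
      replace (rho ^ S (n + m) * x ^ S (n + m) * Cmod (a (S (n + m))))%R with
        ((Cmod (a (S (n + m))) * rho ^ S (n + m)) * (x ^ S n * x ^ m))%R.
      2:{ rewrite <- pow_add. replace (S n + m)%nat with (S (n + m)) by lia. ring. }
      replace (M * x ^ S n * (/ 2) ^ m)%R with (M * (x ^ S n * (/ 2) ^ m))%R by ring.
      apply Rmult_le_compat; auto.
      - apply Rmult_le_pos; [apply Cmod_ge_0|left; apply pow_lt; auto].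
      - apply Rmult_le_pos; apply pow_le; auto.
      - apply Rmult_le_compat_l; [apply pow_le; auto|]. apply pow_incr; lra. }
    simpl pow in *. lra.
Qed.

Lemma isolated_zeros (f : C -> C) (z0 : C) : analytic_at f z0 ->
  (forall eps, (0 < eps)%R -> exists z, z <> z0 /\ (Cmod (z - z0) < eps)%R /\ f z = 0) ->
  exists r, (0 < r)%R /\ forall z, (Cmod (z - z0) < r)%R -> f z = 0.
Proof.
  rewrite analytic_at_iff. intros [a [r [Hr H]]] Hacc.
  destruct (pseries_coef_bound a f z0 r Hr H) as [M [HM Ha]].
  set (rho := (r / 2)%R) in *. assert (Hrho : (0 < rho)%R) by (unfold rho; lra).
  assert (Hz : forall n, a n = 0).
  { induction n as [n IH] using (well_founded_induction Nat.lt_wf_0).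
    assert (Htail := fun v m => psum_tail a M rho n v m HM Hrho Ha IH).
    apply Cmod_eq_0. apply Rle_antisym; [|apply Cmod_ge_0]. apply le_epsilon. intros eps Heps.
    set (K := (2 * M / rho ^ S n)%R).
    assert (HK : (0 < K)%R) by (apply Rdiv_lt_0_compat; [lra|apply pow_lt; auto]).
    destruct (Hacc (Rmin (rho / 2) (eps / K))) as [z [Hzn [Hzd Hfz]]].
    { apply Rmin_pos; [lra|]. apply Rdiv_lt_0_compat; auto. }
    assert (X1 := Rmin_l (rho / 2) (eps / K)). assert (X2 := Rmin_r (rho / 2) (eps / K)).
    specialize (H z ltac:(unfold rho in *; lra)). rewrite Hfz in H.
    set (v := z - z0) in *.
    assert (Hvp : (0 < Cmod v)%R) by (apply (proj1 (Cmod_gt_0 v)); apply Cminus_eq_contra; auto).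
    assert (Hx0 : (0 <= (Cmod v / rho) ^ S n)%R) by (apply pow_le; apply Rdiv_le_0_compat; lra).
    assert (Hlim : (Cmod (0 - v ^ n * a n) <= 2 * M * (Cmod v / rho) ^ S n)%R).
    { apply (Ccv_bound (fun m => psum a v (n + m) - v ^ n * a n)).
      - intros m. eapply Rle_trans; [apply (Htail v m); lra|].
        rewrite <- (Rmult_1_r (2 * M * (Cmod v / rho) ^ S n)) at 2.
        apply Rmult_le_compat_l; [apply Rmult_le_pos; lra|].
        assert (0 < (/ 2) ^ m)%R by (apply pow_lt; lra). lra.
      - apply Ccv_minus; [|apply Ccv_const]. apply (Ccv_subseq (psum a v)); auto. intros m; lia. }
    rewrite Cmod_minus_sym in Hlim. unfold Cminus in Hlim. rewrite Copp_0, Cplus_0_r, Cmod_mult, Cmod_pow in Hlim.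
    assert (Hpw : (0 < Cmod v ^ n)%R) by (apply pow_lt; auto).
    replace (2 * M * (Cmod v / rho) ^ S n)%R with (Cmod v ^ n * (K * Cmod v))%R in Hlim.
    2:{ unfold K, Rdiv. rewrite Rpow_mult_distr, pow_inv. simpl. ring. }
    apply Rmult_le_reg_l in Hlim; auto.
    assert (K * Cmod v <= K * (eps / K))%R by (apply Rmult_le_compat_l; lra).
    replace (K * (eps / K))%R with eps in H0 by (field; lra). lra. }
  exists r. split; auto. intros z Hzr. apply (Ccv_unique (psum a (z - z0))); auto.
  apply (Ccv_ext (fun _ => 0)); [|apply Ccv_const].
  intros n. induction n as [|n IH]; [rewrite psum_O; auto|]. rewrite psum_S, <- IH, Hz. ring.
Qed.

Lemma identity_segment (f : C -> C) (a b : C) (t0 : R) : a <> b ->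
  (forall t : R, (0 <= t <= 1)%R -> analytic_at f (a + t * (b - a))) ->
  (0 < t0 <= 1)%R -> (forall t : R, (0 <= t <= t0)%R -> f (a + t * (b - a)) = 0) ->
  f b = 0.
Proof.
  intros Hab Han Ht0 Hz.
  set (g := fun t : R => a + t * (b - a)) in *.
  assert (Hgd : forall s t : R, Cmod (g s - g t) = (Rabs (s - t) * Cmod (b - a))%R).
  { intros s t. unfold g. replace (a + s * (b - a) - (a + t * (b - a))) with ((s - t)%R * (b - a)).
    - rewrite Cmod_mult, Cmod_R. reflexivity.
    - rewrite RtoC_minus. ring. }
  assert (Hba : (0 < Cmod (b - a))%R) by (apply (proj1 (Cmod_gt_0 _)); apply Cminus_eq_contra; auto).
  set (E := fun t : R => (0 <= t <= 1)%R /\ forall u, (0 <= u <= t)%R -> f (g u) = 0).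
  destruct (completeness E) as [sg [Hub Hlub]].
  { exists 1%R. intros t [Ht _]. lra. }
  { exists t0. split; [lra|exact Hz]. }
  assert (Hs0 : (t0 <= sg)%R) by (apply Hub; split; [lra|exact Hz]).
  assert (Hs1 : (sg <= 1)%R) by (apply Hlub; intros t [Ht _]; lra).
  assert (Hbelow : forall u, (0 <= u < sg)%R -> f (g u) = 0).
  { intros u Hu. destruct (classic (exists t, E t /\ (u < t)%R)) as [[t [[_ Ht] Hut]]|Hno].
    - apply Ht. lra.
    - exfalso. assert (sg <= u)%R; [|lra]. apply Hlub. intros t Ht.
      destruct (Rle_dec t u); auto. exfalso. apply Hno. exists t. split; auto. lra. }
  destruct (isolated_zeros f (g sg)) as [r [Hr Hzr]].
  { apply Han. lra. }
  { intros eps Heps.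
    set (d := Rmin (sg / 2) (eps / (2 * Cmod (b - a)))).
    assert (Hd0 : (0 < d)%R) by (apply Rmin_pos; [lra|apply Rdiv_lt_0_compat; lra]).
    assert (Hd1 : (d <= sg / 2)%R) by apply Rmin_l.
    assert (Hd2 : (d <= eps / (2 * Cmod (b - a)))%R) by apply Rmin_r.
    assert (Hdist : Cmod (g (sg - d)%R - g sg) = (d * Cmod (b - a))%R).
    { rewrite Hgd. f_equal. replace (sg - d - sg)%R with (- d)%R by ring. rewrite Rabs_Ropp, Rabs_pos_eq; lra. }
    exists (g (sg - d)%R). repeat split.
    - intros Eq. rewrite Eq in Hdist. replace (g sg - g sg) with (RtoC 0) in Hdist by ring.
      rewrite Cmod_0 in Hdist. nra.
    - rewrite Hdist. apply Rle_lt_trans with (eps / (2 * Cmod (b - a)) * Cmod (b - a))%R;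
        [apply Rmult_le_compat_r; lra|]. replace (eps / (2 * Cmod (b - a)) * Cmod (b - a))%R with (eps / 2)%R by (field; lra). lra.
    - apply Hbelow. lra. }
  set (d := (r / (2 * Cmod (b - a)))%R).
  assert (Hd : (0 < d)%R) by (apply Rdiv_lt_0_compat; lra).
  assert (Hext : forall u, (0 <= u <= Rmin 1 (sg + d))%R -> f (g u) = 0).
  { intros u Hu. assert (X1 := Rmin_l 1 (sg + d)). assert (X2 := Rmin_r 1 (sg + d)).
    destruct (Rlt_dec u sg) as [H|H]; [apply Hbelow; lra|]. apply Hzr. rewrite Hgd.
    rewrite Rabs_pos_eq by lra.
    apply Rle_lt_trans with (d * Cmod (b - a))%R; [apply Rmult_le_compat_r; lra|].
    unfold d. replace (r / (2 * Cmod (b - a)) * Cmod (b - a))%R with (r / 2)%R by (field; lra). lra. }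
  assert (HE : E (Rmin 1 (sg + d))).
  { split; auto. split; [apply Rmin_glb; lra|apply Rmin_l]. }
  assert (HE' := Hub _ HE).
  assert (sg = 1)%R.
  { unfold Rmin in HE'. destruct (Rle_dec 1 (sg + d)); lra. }
  subst sg. replace b with (g 1%R) by (unfold g; ring). apply Hext.
  rewrite Rmin_left by lra. lra.
Qed.

Lemma identity_from_right (f : C -> C) (a b : C) : Re a = 3%R ->
  (forall t : R, (0 <= t <= 1)%R -> analytic_at f (a + t * (b - a))) ->
  (forall s, (2 < Re s)%R -> f s = 0) -> f b = 0.
Proof.
  intros Ha Han Hz. destruct (Rlt_dec 2 (Re b)) as [Hb|Hb]; [auto|].
  assert (Hp : (0 < 3 - Re b)%R) by lra.
  assert (Ht0 : (0 < / (2 * (3 - Re b)))%R) by (apply Rinv_0_lt_compat; lra).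
  apply (identity_segment f a b (/ (2 * (3 - Re b)))); auto.
  - intros ->. lra.
  - split; auto. rewrite <- Rinv_1. apply Rinv_le_contravar; lra.
  - intros t Ht. apply Hz. rewrite re_plus, re_scal_l, Re_minus, Ha.
    assert (t * (3 - Re b) <= / 2)%R.
    { apply Rle_trans with (/ (2 * (3 - Re b)) * (3 - Re b))%R; [apply Rmult_le_compat_r; lra|].
      right. field. lra. }
    lra.
Qed.

Lemma identity_entire (f : C -> C) : (forall s, analytic_at f s) ->
  (forall s, (2 < Re s)%R -> f s = 0) -> forall s, f s = 0.
Proof. intros Han Hz s. apply (identity_from_right f (RtoC 3)); auto. Qed.

Lemma identity_punctured (f : C -> C) : (forall s : C, s <> 1 -> analytic_at f s) ->
  (forall s, (2 < Re s)%R -> f s = 0) -> forall s : C, s <> 1 -> f s = 0.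
Proof.
  intros Han Hz s Hs. destruct (Req_dec (Im s) 0) as [E|E].
  - apply (identity_from_right f (3, 1)%R); auto. intros t Ht. apply Han. intros Eq.
    assert (E1 := f_equal Im Eq). assert (E2 := f_equal Re Eq).
    rewrite im_plus, im_scal_l, Im_minus, E in E1. rewrite re_plus, re_scal_l, Re_minus in E2.
    simpl in E1, E2. assert (t = 1)%R by lra. subst t.
    apply Hs. apply C_ext; simpl in *; lra.
  - apply (identity_from_right f (3, Im s)%R); auto. intros t Ht. apply Han. intros Eq.
    assert (E1 := f_equal Im Eq). rewrite im_plus, im_scal_l, Im_minus in E1. simpl in E1.
    unfold Im in *. lra.
Qed.

(** * Integrals depending analytically on a parameter *)

Definition sublinear (L : R -> C) : Prop :=
  contC L /\ forall eps, (0 < eps)%R -> exists K, forall t, (Cmod (L t) <= eps * Rabs t + K)%R.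

Lemma expb_mul_exp (L phi : R -> C) (d B A : R) :
  sublinear L -> (0 < d)%R -> expb d B phi -> (0 < A)%R ->
  exists B', forall psi, contC psi ->
    (forall t, (Cmod (psi t) <= exp (A * Cmod (L t)) * Cmod (phi t))%R) -> expb (d / 2) B' psi.
Proof.
  intros [HLc HL] Hd [Hpc Hp] HA.
  destruct (HL (d / 2 / A)%R) as [K HK]; [apply Rdiv_lt_0_compat; lra|].
  exists (B * exp (A * K))%R. intros f Hf Hb. split; auto. intros t.
  eapply Rle_trans; [apply Hb|].
  apply Rle_trans with (exp (d / 2 * Rabs t + A * K) * (B * exp (- d * Rabs t)))%R.
  - apply Rmult_le_compat; [left; apply exp_pos|apply Cmod_ge_0| |apply Hp].
    apply exp_le. specialize (HK t).
    apply Rle_trans with (A * (d / 2 / A * Rabs t + K))%R; [apply Rmult_le_compat_l; lra|].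
    right. field. lra.
  - right. rewrite exp_plus.
    replace (- d * Rabs t)%R with (- (d / 2) * Rabs t + - (d / 2) * Rabs t)%R by field.
    rewrite exp_plus. replace (- (d / 2) * Rabs t)%R with (- (d / 2 * Rabs t))%R by ring.
    rewrite exp_Ropp. field. apply Rgt_not_eq, exp_pos.
Qed.

Lemma Cmod_cpow_fact (u : C) (n : nat) : (Cmod (u ^ n / INR (fact n)) <= exp (Cmod u))%R.
Proof.
  rewrite Cmod_div, Cmod_pow, Cmod_R, Rabs_pos_eq by (try apply fact_neq_0_C; apply Rlt_le, INR_fact_pos).
  apply pow_fact_le_exp, Cmod_ge_0.
Qed.

Lemma isInt_sum (f : nat -> R -> C) (I : nat -> C) (n : nat) :
  (forall k, contC (f k)) -> (forall k, isInt (f k) (I k)) ->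
  isInt (fun t => sum_n (fun k => f k t) n) (sum_n I n).
Proof.
  intros Hc Hi. induction n as [|n IH].
  - rewrite sum_O. apply (isInt_ext (f 0%nat)); [intros t; rewrite sum_O; auto|auto].
  - rewrite sum_Sn. apply (isInt_ext (fun t => sum_n (fun k => f k t) n + f (S n) t)).
    + intros t. rewrite sum_Sn. reflexivity.
    + apply isInt_plus; auto. apply contC_sum; auto.
Qed.

Lemma IntR_exp_series (u phi : R -> C) (d B q : R) : contC u -> contC phi ->
  (0 < q < 1)%R -> (0 < d)%R ->
  (forall t, (exp ((1 + / q) * Cmod (u t)) * Cmod (phi t) <= B * exp (- d * Rabs t))%R) ->
  Ccv (fun n => sum_n (fun k => IntR (fun t => u t ^ k / INR (fact k) * phi t)) n)
      (IntR (fun t => cexp (u t) * phi t)).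
Proof.
  intros Hu Hp Hq Hd Hb.
  assert (Hiq : (1 < / q)%R) by (rewrite <- Rinv_1; apply Rinv_lt_contravar; lra).
  assert (Hle : forall t, (exp (Cmod (u t)) <= exp ((1 + / q) * Cmod (u t)))%R).
  { intros t. apply exp_le. assert (X := Cmod_ge_0 (u t)). nra. }
  assert (Ht : forall k, expb d B (fun t => u t ^ k / INR (fact k) * phi t)).
  { intros k. split.
    - apply contC_mult; auto. apply contC_mult; [apply contC_pow; auto|apply contC_const].
    - intros t. eapply Rle_trans; [|apply Hb]. rewrite Cmod_mult.
      apply Rmult_le_compat_r; [apply Cmod_ge_0|].
      eapply Rle_trans; [apply Cmod_cpow_fact|apply Hle]. }
  assert (He : expb d B (fun t => cexp (u t) * phi t)).
  { split; [apply contC_mult; auto; apply contC_cexp; auto|].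
    intros t. eapply Rle_trans; [|apply Hb]. rewrite Cmod_mult.
    apply Rmult_le_compat_r; [apply Cmod_ge_0|].
    eapply Rle_trans; [apply Cmod_cexp_le|apply Hle]. }
  set (S := fun n t => sum_n (fun k => u t ^ k / INR (fact k) * phi t) n).
  assert (ES : forall n t, S n t = ctay (u t) n * phi t).
  { intros n t. unfold S. induction n as [|n IH].
    - rewrite sum_O. unfold ctay. rewrite sum_O. reflexivity.
    - rewrite sum_Sn, IH, ctay_S, Cmult_plus_distr_r. reflexivity. }
  assert (HS : forall n, isInt (S n) (sum_n (fun k => IntR (fun t => u t ^ k / INR (fact k) * phi t)) n)).
  { intros n. apply (isInt_sum (fun k t => u t ^ k / INR (fact k) * phi t)).
    - intros k. apply Ht.
    - intros k. apply (IntR_correct d B); auto. }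
  apply (Ccv_ext (fun n => IntR (S n))); [intros n; apply IntR_eq; auto|].
  apply (IntR_cv d B _ _ (fun n => q ^ Datatypes.S n)%R); auto.
  - intros n. eexists. split; [|apply HS]. apply contC_sum. intros k; apply Ht.
  - eexists. split; [apply He|]. eapply IntR_correct; eauto.
  - intros n t. rewrite ES.
    replace (ctay (u t) n * phi t - cexp (u t) * phi t) with (- ((cexp (u t) - ctay (u t) n) * phi t)) by ring.
    rewrite Cmod_opp, Cmod_mult.
    apply Rle_trans with (q ^ Datatypes.S n * exp ((1 + / q) * Cmod (u t)) * Cmod (phi t))%R.
    + apply Rmult_le_compat_r; [apply Cmod_ge_0|]. apply cexp_taylor_geom. lra.
    + rewrite Rmult_assoc. apply Rmult_le_compat_l; [apply pow_le; lra|apply Hb].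
  - apply (is_lim_seq_incr_1 (fun n => q ^ n)%R). apply is_lim_seq_geom. rewrite Rabs_pos_eq; lra.
Qed.

Lemma analytic_at_IntR (L phi : R -> C) (d B : R) (s0 : C) :
  sublinear L -> (0 < d)%R -> expb d B phi ->
  analytic_at (fun s => IntR (fun t => cexp (- (s * L t)) * phi t)) s0.
Proof.
  intros HL Hd Hp. apply analytic_at_iff.
  set (phi0 := fun t => cexp (- (s0 * L t)) * phi t).
  assert (Hd2 : (0 < d / 2)%R) by lra.
  assert (HLc := proj1 HL). assert (Hpc := proj1 Hp).
  assert (HLn : contC (fun t => - L t)).
  { apply (contC_ext (fun t => (- (1)) * L t)); [intros t; ring|]. apply contC_mult; auto. apply contC_const. }
  assert (Hs0L : contC (fun t => cexp (- (s0 * L t)))).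
  { apply contC_cexp. apply (contC_ext (fun t => (- s0) * L t)); [intros t; ring|].
    apply contC_mult; auto. apply contC_const. }
  assert (Hc0 : contC phi0) by (apply contC_mult; auto).
  exists (fun n => IntR (fun t => (- L t) ^ n / INR (fact n) * phi0 t)), 1%R. split; [lra|].
  intros s Hs. set (v := s - s0) in *.
  destruct (expb_mul_exp L phi d B (3 + Cmod s0) HL Hd Hp) as [B' HB'].
  { assert (X := Cmod_ge_0 s0). lra. }
  assert (Hphi0 : forall t, (Cmod (phi0 t) <= exp (Cmod s0 * Cmod (L t)) * Cmod (phi t))%R).
  { intros t. unfold phi0. rewrite Cmod_mult. apply Rmult_le_compat_r; [apply Cmod_ge_0|].
    eapply Rle_trans; [apply Cmod_cexp_le|]. rewrite Cmod_opp, Cmod_mult. lra. }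
  assert (Hterm : forall k, expb (d / 2) B' (fun t => (- L t) ^ k / INR (fact k) * phi0 t)).
  { intros k. apply HB'.
    - apply contC_mult; auto. apply contC_mult; [apply contC_pow; auto|apply contC_const].
    - intros t. rewrite Cmod_mult.
      apply Rle_trans with (exp (Cmod (L t)) * (exp (Cmod s0 * Cmod (L t)) * Cmod (phi t)))%R.
      + apply Rmult_le_compat; try apply Cmod_ge_0; auto.
        eapply Rle_trans; [apply Cmod_cpow_fact|]. rewrite Cmod_opp. lra.
      + rewrite <- Rmult_assoc. apply Rmult_le_compat_r; [apply Cmod_ge_0|].
        rewrite <- exp_plus. apply exp_le. assert (X := Cmod_ge_0 (L t)). lra. }
  apply (Ccv_ext (fun n => sum_n (fun k => IntR (fun t => (v * (- L t)) ^ k / INR (fact k) * phi0 t)) n)).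
  { intros n. unfold psum. apply sum_n_ext. intros k.
    rewrite <- (IntR_eq _ _ (isInt_scal (v ^ k) _ _ (proj1 (Hterm k)) (IntR_correct _ _ _ Hd2 (Hterm k)))).
    f_equal. apply functional_extensionality. intros t.
    rewrite Cpow_mult_l. unfold Cdiv. ring. }
  replace (IntR (fun t => cexp (- (s * L t)) * phi t)) with (IntR (fun t => cexp (v * (- L t)) * phi0 t)).
  2:{ f_equal. apply functional_extensionality. intros t.
      unfold phi0. rewrite Cmult_assoc, <- cexp_plus. f_equal. f_equal. unfold v. ring. }
  apply (IntR_exp_series _ _ (d / 2) B' (/ 2)); auto; try lra.
  { apply contC_mult; auto. apply contC_const. }
  intros t.
  assert (X : expb (d / 2) B' (fun t => exp ((1 + / / 2) * Cmod (v * - L t)) * phi0 t)).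
  { apply HB'.
    - apply contC_mult; auto. apply contC_RtoC. intros x.
      apply (continuous_comp (fun x => (1 + / / 2) * Cmod (v * - L x))%R exp).
      2:{ apply (ex_derive_continuous (K := R_AbsRing) (V := R_NormedModule)). auto_derive; auto. }
      apply (continuous_scal_r (K := R_AbsRing) (V := R_NormedModule) (1 + / / 2)%R).
      assert (HvL : contC (fun t => v * - L t)) by (apply contC_mult; auto; apply contC_const).
      destruct (HvL x) as [H1 H2]. unfold Cmod.
      apply (continuous_comp _ sqrt); [|apply continuous_sqrt].
      apply (continuous_ext (fun y => (Re (v * - L y) * Re (v * - L y) + Im (v * - L y) * Im (v * - L y))%R)).
      { intros y. unfold Re, Im. simpl. ring. }
      apply (continuous_plus (V := R_NormedModule)); apply (continuous_mult (K := R_AbsRing)); assumption.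
    - intros x. rewrite Cmod_mult, Cmod_R, Rabs_pos_eq by (left; apply exp_pos).
      apply Rle_trans with (exp (3 * Cmod (L x)) * (exp (Cmod s0 * Cmod (L x)) * Cmod (phi x)))%R.
      + apply Rmult_le_compat; auto; [left; apply exp_pos|apply Cmod_ge_0|].
        apply exp_le. rewrite Rinv_inv, Cmod_mult, Cmod_opp.
        assert (Y := Cmod_ge_0 (L x)). assert (Z := Cmod_ge_0 v).
        apply Rle_trans with ((1 + 2) * (1 * Cmod (L x)))%R; [|lra].
        apply Rmult_le_compat_l; [lra|]. apply Rmult_le_compat_r; lra.
      + rewrite <- Rmult_assoc. apply Rmult_le_compat_r; [apply Cmod_ge_0|].
        rewrite <- exp_plus. apply exp_le. lra. }
  destruct X as [_ X]. specialize (X t). rewrite Cmod_mult, Cmod_R, Rabs_pos_eq in X by (left; apply exp_pos).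
  exact X.
Qed.

(** * The integral representation of zeta *)

Definition Lg (lam : R) (t : R) : C := Log ((/ 2)%R, t) + lam.

Definition phi (th : R) (t : R) : C := cexp (Ci * th * ((/ 2)%R, t)) * weight t.

(* Q lam th s is the integral of (e^lam z)^(-s) e^(i th z) over the line Re z = 1/2. *)
Definition Q (lam th : R) (s : C) : C :=
  IntR (fun t => cexp (- (s * Lg lam t)) * phi th t).

Lemma contC_Log (x : R) : (0 < x)%R -> contC (fun t => Log (x, t)).
Proof. intros Hx. apply contC_vert. intros t. eexists. exact (Cder_Log (x, t) Hx). Qed.

Lemma sublinear_Lg (lam : R) : sublinear (Lg lam).
Proof.
  split.
  - apply contC_plus; [apply contC_Log; lra|apply contC_const].
  - intros eps He. destruct (Log_growth eps (/ 2) (/ 2) He ltac:(lra)) as [K HK].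
    exists (K + Rabs lam)%R. intros t. eapply Rle_trans; [apply Cmod_triangle|].
    specialize (HK (/ 2)%R t ltac:(lra)). rewrite Cmod_R. lra.
Qed.

Lemma contC_phi (th : R) : contC (phi th).
Proof.
  apply contC_mult; [|apply contC_RtoC, weight_continuous].
  apply contC_cexp. apply contC_mult; [apply contC_const|].
  apply (contC_ext (fun t => RtoC (/ 2) + RtoC t * Ci)); [intros t; apply C_ext; simpl; ring|].
  apply contC_plus; [apply contC_const|]. apply contC_mult; [|apply contC_const].
  apply contC_RtoC. intros t. apply continuous_id.
Qed.

Lemma Re_Ci_mult (th y t : R) : Re (Ci * th * ((y, t) : C)) = (- (th * t))%R.
Proof. simpl; ring. Qed.

Lemma mult_le_Rabs (a b : R) : (- (a * b) <= Rabs a * Rabs b)%R.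
Proof. rewrite <- Rabs_mult. rewrite <- Rabs_Ropp. apply Rle_abs. Qed.

Lemma expb_phi (th : R) : (Rabs th < 2 * PI)%R -> expb (2 * PI - Rabs th) (2 * PI) (phi th).
Proof.
  intros Hth. split; [apply contC_phi|]. intros t. unfold phi.
  destruct (weight_bound t) as [W1 W2].
  rewrite Cmod_mult, Cmod_cexp, Cmod_R, (Rabs_pos_eq (weight t)), Re_Ci_mult by lra.
  apply Rle_trans with (exp (Rabs th * Rabs t) * (2 * PI * exp (- (2 * PI) * Rabs t)))%R.
  - apply Rmult_le_compat; [left; apply exp_pos|lra| |auto]. apply exp_le, mult_le_Rabs.
  - right. replace (- (2 * PI - Rabs th) * Rabs t)%R with (Rabs th * Rabs t + - (2 * PI) * Rabs t)%R by ring.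
    rewrite exp_plus. ring.
Qed.

Lemma analytic_at_Q (lam th : R) (s0 : C) : (Rabs th < 2 * PI)%R -> analytic_at (Q lam th) s0.
Proof.
  intros Hth. apply (analytic_at_IntR (Lg lam) (phi th) (2 * PI - Rabs th) (2 * PI)).
  - apply sublinear_Lg.
  - lra.
  - apply expb_phi; auto.
Qed.

Lemma Q_scal (lam th : R) (s : C) : (Rabs th < 2 * PI)%R ->
  Q lam th s = cexp (- (s * lam)) * Q 0 th s.
Proof.
  intros Hth. unfold Q.
  destruct (expb_mul_exp (Lg 0) (phi th) (2 * PI - Rabs th) (2 * PI) (Cmod s + 1)
              (sublinear_Lg 0) ltac:(lra) (expb_phi th Hth)) as [B HB].
  { assert (X := Cmod_ge_0 s). lra. }
  assert (He : expb ((2 * PI - Rabs th) / 2) B (fun t => cexp (- (s * Lg 0 t)) * phi th t)).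
  { apply HB.
    - apply contC_mult; [|apply contC_phi]. apply contC_cexp.
      apply (contC_ext (fun t => (- s) * Lg 0 t)); [intros t; ring|].
      apply contC_mult; [apply contC_const|apply sublinear_Lg].
    - intros t. rewrite Cmod_mult. apply Rmult_le_compat_r; [apply Cmod_ge_0|].
      eapply Rle_trans; [apply Cmod_cexp_le|]. apply exp_le.
      rewrite Cmod_opp, Cmod_mult. assert (X := Cmod_ge_0 (Lg 0 t)). lra. }
  assert (Hd : (0 < (2 * PI - Rabs th) / 2)%R) by lra.
  rewrite <- (IntR_eq _ _ (isInt_scal (cexp (- (s * lam))) _ _ (proj1 He) (IntR_correct _ _ _ Hd He))).
  f_equal. apply functional_extensionality. intros t.
  rewrite Cmult_assoc, <- cexp_plus. f_equal. f_equal. unfold Lg. ring.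
Qed.

Lemma cexp_pow (u : C) (n : nat) : cexp (INR n * u) = cexp u ^ n.
Proof.
  induction n as [|n IH]; [simpl; rewrite Cmult_0_l, cexp_0; auto|].
  rewrite S_INR, RtoC_plus, Cmult_plus_distr_r, cexp_plus, IH, Cmult_1_l, Cpow_S. ring.
Qed.

Lemma Q_taylor (th : R) (s : C) : (Rabs th <= 2 * PI / 3)%R ->
  Ccv (fun n => sum_n (fun k => (Ci * th) ^ k / INR (fact k) * Q 0 0 (s - INR k)) n) (Q 0 th s).
Proof.
  intros Hth. assert (HPI := PI_RGT_0).
  set (u := fun t : R => Ci * th * ((/ 2)%R, t)).
  set (p := fun t : R => cexp (- (s * Lg 0 t)) * phi 0 t).
  assert (Hz : contC (fun t => ((/ 2)%R, t) : C)).
  { apply (contC_ext (fun t => RtoC (/ 2) + RtoC t * Ci)); [intros t; apply C_ext; simpl; ring|].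
    apply contC_plus; [apply contC_const|]. apply contC_mult; [|apply contC_const].
    apply contC_RtoC. intros t. apply continuous_id. }
  assert (Hu : contC u) by (apply contC_mult; [apply contC_const|auto]).
  assert (Hs : forall s, contC (fun t => cexp (- (s * Lg 0 t)))).
  { intros s'. apply contC_cexp.
    apply (contC_ext (fun t => (- s') * Lg 0 t)); [intros t; ring|].
    apply contC_mult; [apply contC_const|apply sublinear_Lg]. }
  assert (Hp : contC p) by (apply contC_mult; [apply Hs|apply contC_phi]).
  assert (Hphi0 : forall t, phi 0 t = weight t).
  { intros t. unfold phi. replace (Ci * 0 * ((/ 2)%R, t)) with (RtoC 0) by ring.
    rewrite cexp_0. ring. }
  set (S0 := (Cmod s + 1)%R). assert (HS0 : (0 < S0)%R) by (unfold S0; assert (X := Cmod_ge_0 s); lra).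
  destruct (proj2 (sublinear_Lg 0) (PI / 9 / S0)%R) as [K HK].
  { apply Rdiv_lt_0_compat; lra. }
  assert (Hbd : forall t, (exp ((1 + / (3 / 4)) * Cmod (u t)) * Cmod (p t) <=
     (2 * PI * exp (7 / 9 * PI + S0 * K)) * exp (- (PI / 3) * Rabs t))%R).
  { intros t.
    assert (Hut : (Cmod (u t) <= 2 * PI / 3 * (/ 2 + Rabs t))%R).
    { unfold u. rewrite !Cmod_mult, Cmod_Ci, Cmod_R, Rmult_1_l.
      apply Rmult_le_compat; try apply Rabs_pos; try apply Cmod_ge_0; auto.
      eapply Rle_trans; [apply Cmod_le_abs|]. simpl. rewrite (Rabs_pos_eq (/ 2)); lra. }
    assert (Hpt : (Cmod (p t) <= exp (S0 * (PI / 9 / S0 * Rabs t + K)) * (2 * PI * exp (- (2 * PI) * Rabs t)))%R).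
    { unfold p. destruct (weight_bound t). rewrite Cmod_mult, Hphi0, Cmod_R, (Rabs_pos_eq (weight t)) by lra.
      apply Rmult_le_compat; [apply Cmod_ge_0|lra| |auto].
      eapply Rle_trans; [apply Cmod_cexp_le|]. apply exp_le.
      rewrite Cmod_opp, Cmod_mult. specialize (HK t).
      apply Rmult_le_compat; try apply Cmod_ge_0; auto. unfold S0; lra. }
    apply Rle_trans with (exp (7 / 3 * (2 * PI / 3 * (/ 2 + Rabs t))) *
        (exp (S0 * (PI / 9 / S0 * Rabs t + K)) * (2 * PI * exp (- (2 * PI) * Rabs t))))%R.
    - apply Rmult_le_compat; auto; [left; apply exp_pos|apply Cmod_ge_0|]. apply exp_le. lra.
    - right.
      replace (S0 * (PI / 9 / S0 * Rabs t + K))%R with (PI / 9 * Rabs t + S0 * K)%R by (field; lra).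
      rewrite Rmult_comm.
      transitivity (2 * PI * (exp (PI / 9 * Rabs t + S0 * K) * exp (- (2 * PI) * Rabs t) * exp (7 / 3 * (2 * PI / 3 * (/ 2 + Rabs t)))))%R; [ring|].
      rewrite <- !exp_plus. symmetry.
      transitivity (2 * PI * (exp (7 / 9 * PI + S0 * K) * exp (- (PI / 3) * Rabs t)))%R; [ring|].
      rewrite <- exp_plus. f_equal. f_equal. field. }
  assert (Hd : (0 < PI / 3)%R) by lra.
  assert (Hq : (0 < 3 / 4 < 1)%R) by lra.
  assert (H := IntR_exp_series u p (PI / 3) _ (3 / 4) Hu Hp Hq Hd Hbd).
  replace (Q 0 th s) with (IntR (fun t => cexp (u t) * p t)).
  2:{ unfold Q. f_equal. apply functional_extensionality. intros t.
      unfold p, u. rewrite Hphi0. unfold phi. ring. }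
  eapply Ccv_ext; [|exact H]. intros n. apply sum_n_ext. intros k. cbv beta.
  unfold Q.
  destruct (expb_mul_exp (Lg 0) (phi 0) (2 * PI - Rabs 0) (2 * PI) (Cmod (s - INR k) + 1)
              (sublinear_Lg 0) ltac:(rewrite Rabs_R0; lra) (expb_phi 0 ltac:(rewrite Rabs_R0; lra))) as [B HB].
  { assert (X := Cmod_ge_0 (s - INR k)). lra. }
  assert (He : expb ((2 * PI - Rabs 0) / 2) B (fun t => cexp (- ((s - INR k) * Lg 0 t)) * phi 0 t)).
  { apply HB.
    - apply contC_mult; [apply Hs|apply contC_phi].
    - intros t. rewrite Cmod_mult. apply Rmult_le_compat_r; [apply Cmod_ge_0|].
      eapply Rle_trans; [apply Cmod_cexp_le|]. apply exp_le.
      rewrite Cmod_opp, Cmod_mult. assert (X := Cmod_ge_0 (Lg 0 t)). lra. }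
  assert (Hd' : (0 < (2 * PI - Rabs 0) / 2)%R) by (rewrite Rabs_R0; lra).
  rewrite <- (IntR_eq _ _ (isInt_scal ((Ci * th) ^ k / INR (fact k)) _ _ (proj1 He) (IntR_correct _ _ _ Hd' He))).
  f_equal. apply functional_extensionality. intros t.
  unfold p, u.
  replace (- ((s - INR k) * Lg 0 t)) with (- (s * Lg 0 t) + INR k * Lg 0 t) by ring.
  rewrite cexp_plus, cexp_pow, Cpow_mult_l.
  replace (cexp (Lg 0 t)) with ((/ 2)%R, t).
  - unfold Cdiv. ring.
  - unfold Lg. rewrite Cplus_0_r, cexp_Log; auto. simpl. lra.
Qed.

Lemma is_lim_seq_exp_ln (sg : R) : (0 < sg)%R ->
  is_lim_seq (fun n => exp (- (sg * ln (/ 2 + INR (S n))))) 0%R.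
Proof.
  intros Hs.
  apply (is_lim_comp_seq exp (fun n => - (sg * ln (/ 2 + INR (S n))))%R m_infty 0%R).
  - exact is_lim_exp_m.
  - exists 0%nat. intros n _. discriminate.
  - apply (is_lim_seq_ext (fun n => - sg * ln (/ 2 + INR (S n)))%R); [intros n; ring|].
    replace m_infty with (Rbar_mult (- sg)%R p_infty).
    2:{ unfold Rbar_mult, Rbar_mult'. destruct (Rle_dec 0 (- sg)); [exfalso; lra|]. reflexivity. }
    apply is_lim_seq_scal_l.
    apply (is_lim_comp_seq ln (fun n => / 2 + INR (S n))%R p_infty p_infty).
    + exact is_lim_ln_p.
    + exists 0%nat. intros n _. discriminate.
    + apply (is_lim_seq_le_p_loc INR).
      * exists 0%nat. intros n _. rewrite S_INR. lra.
      * exact is_lim_seq_INR.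
Qed.

(* g is z^(-s) e^(i th z). *)
Definition gfun (th : R) (s z : C) : C := cexp (- (s * Log z) + Ci * th * z).
Definition gfun1 (th : R) (s z : C) : C := (- (s * / z) + Ci * th) * gfun th s z.

Lemma Cder_gfun (th : R) (s z : C) : (0 < Re z)%R -> Cder (gfun th s) z (gfun1 th s z).
Proof.
  intros Hz.
  assert (H1 := Cder_mult _ _ _ _ _ (Cder_const (- s) z) (Cder_Log z Hz)).
  assert (H2 := Cder_mult _ _ _ _ _ (Cder_const (Ci * th) z) (Cder_id z)).
  assert (H3 := Cder_plus _ _ _ _ _ H1 H2).
  assert (H4 := Cder_comp cexp _ z _ _ (Cder_cexp _) H3). cbv beta in H4.
  apply (Cder_ext (fun z => cexp (- s * Log z + Ci * th * z))).
  { intros x. unfold gfun. f_equal. ring. }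
  eapply Cder_eq; [exact H4|]. unfold gfun1, gfun.
  replace (- s * Log z) with (- (s * Log z)) by ring. ring.
Qed.

Lemma Cder_gfun1 (th : R) (s z : C) : (0 < Re z)%R -> exists l, Cder (gfun1 th s) z l.
Proof.
  intros Hz. assert (Hz0 : z <> 0).
  { intros E. rewrite E in Hz. simpl in Hz. lra. }
  assert (H1 := Cder_mult _ _ _ _ _ (Cder_const (- s) z) (Cder_inv z Hz0)).
  assert (H2 := Cder_plus _ _ _ _ _ H1 (Cder_const (Ci * th) z)).
  assert (H3 := Cder_mult _ _ _ _ _ H2 (Cder_gfun th s z Hz)).
  eexists. eapply Cder_ext; [|exact H3]. intros x. unfold gfun1. ring.
Qed.

Lemma gfun_bound (th : R) (s : C) (x x0 t : R) : (0 <= Re s)%R -> (0 < x0 <= x)%R ->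
  (Cmod (gfun th s (x, t)) <= exp (2 * Cmod s) * exp (- (Re s * ln x0)) * exp (Rabs th * Rabs t))%R.
Proof.
  intros Hs Hx. unfold gfun. rewrite Cmod_cexp, re_plus, re_opp, re_mult, Re_Ci_mult.
  rewrite <- !exp_plus. apply exp_le. rewrite Re_Log.
  assert (H1 := mult_le_Rabs th t). assert (H2 := Im_Log_bound (x, t)).
  assert (Hm : (x <= Cmod (x, t))%R).
  { assert (X := re_le_Cmod (x, t)). simpl in X. rewrite Rabs_pos_eq in X; lra. }
  assert (H3 : (ln x0 <= ln (Cmod (x, t)))%R) by (apply ln_le; lra).
  assert (H4 : (Re s * ln x0 <= Re s * ln (Cmod (x, t)))%R) by (apply Rmult_le_compat_l; auto).
  assert (H5 : (Im s * Im (Log (x, t)) <= 2 * Cmod s)%R).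
  { eapply Rle_trans; [apply Rle_abs|]. rewrite Rabs_mult, Rmult_comm.
    apply Rmult_le_compat; try apply Rabs_pos; auto. apply im_le_Cmod. }
  lra.
Qed.

Lemma gfun_line (th : R) (s : C) (t : R) :
  gfun th s ((/ 2)%R, t) * weight t = cexp (- (s * Lg 0 t)) * phi th t.
Proof.
  unfold gfun, phi, Lg. rewrite cexp_plus, Cplus_0_r. ring.
Qed.

Lemma gfun_expb (th : R) (s : C) (x : R) : (Rabs th < 2 * PI)%R -> (0 <= Re s)%R -> (0 < x)%R ->
  expb (2 * PI - Rabs th) (2 * PI * exp (2 * Cmod s) * exp (- (Re s * ln x)))
    (fun t => gfun th s (x, t) * weight t).
Proof.
  intros Hth Hs Hx. split.
  - apply contC_mult; [|apply contC_RtoC, weight_continuous].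
    apply contC_vert. intros t. eexists. exact (Cder_gfun th s (x, t) Hx).
  - intros t. destruct (weight_bound t).
    assert (Hg := gfun_bound th s x x t Hs ltac:(lra)).
    rewrite Cmod_mult, Cmod_R, (Rabs_pos_eq (weight t)) by lra.
    apply Rle_trans with ((exp (2 * Cmod s) * exp (- (Re s * ln x)) * exp (Rabs th * Rabs t))
                           * (2 * PI * exp (- (2 * PI) * Rabs t)))%R.
    + apply Rmult_le_compat; auto; [apply Cmod_ge_0|lra].
    + right. replace (- (2 * PI - Rabs th) * Rabs t)%R with (Rabs th * Rabs t + - (2 * PI) * Rabs t)%R by ring.
      rewrite exp_plus. ring.
Qed.

Lemma Q_series (th : R) (s : C) : (Rabs th < 2 * PI)%R -> (0 < Re s)%R ->
  Ccv (fun n => sum_n (fun k => - gfun1 th s (INR (S k))) n) (Q 0 th s).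
Proof.
  intros Hth Hs. assert (HPI := PI_RGT_0). assert (HPI2 := PI2_1).
  set (h := fun x : R => IntR (fun t => gfun th s (x, t) * weight t)).
  assert (Hh : forall x, (0 < x)%R -> isInt (fun t => gfun th s (x, t) * weight t) (h x)).
  { intros x Hx. eapply IntR_correct; [|apply gfun_expb; auto; lra]. lra. }
  assert (HQ : Q 0 th s = h (/ 2)%R).
  { unfold Q, h. f_equal. apply functional_extensionality. intros t.
    symmetry. apply gfun_line. }
  assert (Hstep : forall k, h (/ 2 + INR k)%R - h (/ 2 + INR (S k))%R = - gfun1 th s (INR (S k))).
  { intros k. assert (Hk := pos_INR k).
    apply (residue_step (gfun th s) (gfun1 th s)
             (fun z => epsilon (inhabits (RtoC 0)) (fun l => Cder (gfun1 th s) z l))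
             (INR (S k)) (Rmax 1 (Rabs th)) (exp (2 * Cmod s) * exp (- (Re s * ln (/ 2))))).
    - split; [apply Rmax_l|]. apply Rmax_lub_lt; lra.
    - intros z Hz. apply Rabs_lt_between in Hz. rewrite S_INR in Hz.
      assert (Hz0 : (0 < Re z)%R) by lra.
      split; [exact (Cder_gfun th s z Hz0)|].
      exact (epsilon_spec _ _ (Cder_gfun1 th s z Hz0)).
    - intros [x t] Hz. apply Rabs_le_between in Hz. rewrite S_INR in Hz. simpl in Hz. simpl Im.
      eapply Rle_trans; [apply (gfun_bound th s x (/ 2) t); lra|].
      apply Rmult_le_compat_l; [apply Rmult_le_pos; left; apply exp_pos|].
      apply exp_le. apply Rmult_le_compat_r; [apply Rabs_pos|apply Rmax_r].
    - replace (INR (S k) + - / 2)%R with (/ 2 + INR k)%R by (rewrite S_INR; lra). apply Hh. lra.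
    - replace (INR (S k) + / 2)%R with (/ 2 + INR (S k))%R by ring. apply Hh. rewrite S_INR. lra. }
  assert (Hsum : forall n, sum_n (fun k => - gfun1 th s (INR (S k))) n = h (/ 2)%R - h (/ 2 + INR (S n))%R).
  { induction n as [|n IH].
    - rewrite sum_O, <- Hstep. simpl INR. rewrite Rplus_0_r. reflexivity.
    - rewrite sum_Sn, IH, <- Hstep.
      change (h (/ 2)%R - h (/ 2 + INR (S n))%R + (h (/ 2 + INR (S n))%R - h (/ 2 + INR (S (S n)))%R)
               = h (/ 2)%R - h (/ 2 + INR (S (S n)))%R). ring. }
  rewrite HQ. apply (Ccv_ext (fun n => h (/ 2)%R - h (/ 2 + INR (S n))%R)); [intros n; auto|].
  replace (h (/ 2)%R) with (h (/ 2)%R - 0) at 1 by ring.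
  apply Ccv_minus; [apply Ccv_const|].
  assert (Hdp : (0 < 2 * PI - Rabs th)%R) by lra.
  set (K := (2 * (2 * PI * exp (2 * Cmod s)) / (1 - exp (- (2 * PI - Rabs th))))%R).
  apply (Ccv_squeeze _ _ (fun n => K * exp (- (Re s * ln (/ 2 + INR (S n)))))%R).
  - intros n. unfold Cminus. rewrite Copp_0, Cplus_0_r.
    assert (Hx : (0 < / 2 + INR (S n))%R) by (assert (X := pos_INR (S n)); lra).
    eapply Rle_trans; [apply (IntR_bound _ _ _ Hdp (gfun_expb th s _ Hth (Rlt_le _ _ Hs) Hx))|].
    unfold K. right. unfold Rdiv. ring.
  - replace (Finite 0) with (Rbar_mult K 0) by (simpl; f_equal; ring).
    apply is_lim_seq_scal_l. apply is_lim_seq_exp_ln; auto.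
Qed.

Lemma gfun_INR (th : R) (s : C) (n : nat) :
  gfun th s (INR (S n)) = cpow (INR (S n)) (- s) * cexp (Ci * th * INR (S n)).
Proof.
  unfold gfun. rewrite cexp_plus, cpow_cexp, Log_R by (apply lt_0_INR; lia).
  f_equal. f_equal. ring.
Qed.

Lemma cpow_plus (a : R) (z w : C) : cpow a (z + w) = cpow a z * cpow a w.
Proof. rewrite !cpow_cexp, <- cexp_plus. f_equal. ring. Qed.

Lemma cpow_1 (a : R) : (0 < a)%R -> cpow a 1 = a.
Proof. intros Ha. rewrite cpow_cexp, Cmult_1_l, cexp_R, exp_ln; auto. Qed.

Lemma cpow_opp (a : R) (z : C) : cpow a (- z) = / cpow a z.
Proof. rewrite !cpow_cexp, <- cexp_opp. f_equal. ring. Qed.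

Lemma cpow_neq_0 (a : R) (z : C) : cpow a z <> 0.
Proof. rewrite cpow_cexp. apply cexp_neq_0. Qed.

Lemma INR_S_neq_0 (n : nat) : RtoC (INR (S n)) <> 0.
Proof. apply RtoC_neq_0, not_0_INR. lia. Qed.

Lemma opp_gfun1_INR (th : R) (s : C) (n : nat) :
  - gfun1 th s (INR (S n)) =
  (s * cpow (INR (S n)) (- (s + 1)) - Ci * th * cpow (INR (S n)) (- s)) * cexp (Ci * th * INR (S n)).
Proof.
  unfold gfun1. rewrite gfun_INR.
  replace (- (s + 1)) with (- s + - (1)) by ring.
  rewrite cpow_plus, (cpow_opp _ 1), cpow_1 by (apply lt_0_INR; lia).
  field. apply INR_S_neq_0.
Qed.

Lemma Rabs0_lt : (Rabs 0 < 2 * PI)%R.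
Proof. rewrite Rabs_R0. assert (X := PI_RGT_0). lra. Qed.

Lemma sum_n_CS (a : nat -> C) (n : nat) : sum_n a (S n) = sum_n a n + a (S n).
Proof. exact (sum_Sn a n). Qed.

Lemma sum_n_Cplus (a b : nat -> C) (n : nat) :
  sum_n (fun k => a k + b k) n = sum_n a n + sum_n b n.
Proof. exact (sum_n_plus (G := C_AbelianMonoid) a b n). Qed.

Lemma sum_n_Cmult_l (c : C) (a : nat -> C) (n : nat) :
  sum_n (fun k => c * a k) n = c * sum_n a n.
Proof. exact (sum_n_mult_l (K := C_Ring) c a n). Qed.

Lemma sum_n_Cext (a b : nat -> C) (n : nat) :
  (forall k, a k = b k) -> sum_n a n = sum_n b n.
Proof. exact (sum_n_ext a b n). Qed.

Lemma Q_dirichlet (s : C) : (1 < Re s)%R ->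
  Ccv (fun n => sum_n (fun k => cpow (INR (S k)) (- s)) n) (Q 0 0 (s - 1) / (s - 1)).
Proof.
  intros Hs. assert (Hs1 : s - 1 <> 0).
  { intros E. apply (f_equal Re) in E. rewrite Re_minus in E. simpl in E. unfold Re in *. lra. }
  assert (H := Q_series 0 (s - 1) Rabs0_lt ltac:(rewrite Re_minus; simpl; unfold Re in *; lra)).
  unfold Cdiv. rewrite Cmult_comm.
  eapply Ccv_ext; [|apply (Ccv_scal _ (/ (s - 1)) _ H)].
  intros n. cbv beta. rewrite <- sum_n_Cmult_l. apply sum_n_Cext. intros k.
  rewrite opp_gfun1_INR.
  replace (Ci * 0 * INR (S k)) with (RtoC 0) by ring. rewrite cexp_0.
  replace (- (s - 1 + 1)) with (- s) by ring. field. auto.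
Qed.

Lemma is_riemann_zeta_Q : is_riemann_zeta (fun s => Q 0 0 (s - 1) / (s - 1)).
Proof.
  split.
  - intros s Hs. apply analytic_at_div_lin; auto.
    apply (analytic_at_shift (Q 0 0) (- (1))). apply analytic_at_Q, Rabs0_lt.
  - intros s Hs. apply is_series_Ccv. apply Q_dirichlet; auto.
Qed.

Lemma is_riemann_zeta_zeta : is_riemann_zeta zeta.
Proof. unfold zeta. apply epsilon_spec. eexists. apply is_riemann_zeta_Q. Qed.

Lemma zeta_Q (s : C) : s <> 1 -> (s - 1) * zeta s = Q 0 0 (s - 1).
Proof.
  intros Hs. destruct is_riemann_zeta_zeta as [Han Hser].
  apply Ceq_minus.
  apply (identity_punctured (fun s => (s - 1) * zeta s - Q 0 0 (s - 1))); auto.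
  - intros z Hz. apply analytic_at_minus; [apply analytic_at_mul_lin; auto|].
    apply (analytic_at_shift (Q 0 0) (- (1))). apply analytic_at_Q, Rabs0_lt.
  - intros z Hz. assert (Hz1 : z - 1 <> 0).
    { intros E. apply (f_equal Re) in E. rewrite Re_minus in E. simpl in E. unfold Re in *. lra. }
    assert (E : zeta z = Q 0 0 (z - 1) / (z - 1)).
    { assert (Hz' : (1 < Re z)%R) by lra.
      apply (Ccv_unique (sum_n (fun k => cpow (INR (S k)) (- z)))).
      - apply is_series_Ccv. apply Hser; auto.
      - apply Q_dirichlet; auto. }
    rewrite E. field. auto.
Qed.

Lemma analytic_at_Ccont (f : C -> C) (p : C) : analytic_at f p -> Ccont f p.
Proof.
  rewrite analytic_at_iff. intros [a [r [Hr H]]] eps Heps.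
  destruct (pseries_coef_bound a f p r Hr H) as [M [HM Ha]].
  set (rho := (r / 2)%R) in *. assert (Hrho : (0 < rho)%R) by (unfold rho; lra).
  assert (Hp : f p = a 0%nat).
  { specialize (H p). replace (p - p) with (RtoC 0) in H by ring. rewrite Cmod_0 in H.
    apply (Ccv_unique (psum a 0)); auto.
    apply (Ccv_ext (fun _ => a 0%nat)); [|apply Ccv_const].
    intros n. induction n as [|n IH]; [rewrite psum_O; auto|]. rewrite psum_S, <- IH, Cpow_S. ring. }
  set (K := (2 * M / rho)%R). assert (HK : (0 < K)%R) by (apply Rdiv_lt_0_compat; lra).
  exists (Rmin (rho / 2) (eps / K)). split.
  { apply Rmin_pos; [lra|]. apply Rdiv_lt_0_compat; auto. }
  intros y Hy. assert (X1 := Rmin_l (rho / 2) (eps / K)). assert (X2 := Rmin_r (rho / 2) (eps / K)).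
  set (v := y - p) in *. assert (Hv := Cmod_ge_0 v).
  apply Rle_lt_trans with (K * Cmod v)%R.
  - rewrite Hp. apply (Ccv_bound (fun m => psum a v m - a 0%nat)).
    + intros m. assert (T := psum_tail a M rho 0 v m HM Hrho Ha ltac:(intros; lia) ltac:(lra)).
      replace (v ^ 0 * a 0%nat) with (a 0%nat) in T by (simpl; ring). simpl (0 + m)%nat in T.
      eapply Rle_trans; [exact T|].
      assert (0 < (/ 2) ^ m)%R by (apply pow_lt; lra).
      replace (2 * M * (Cmod v / rho) ^ 1)%R with (K * Cmod v)%R by (unfold K; field; lra).
      assert (0 <= K * Cmod v)%R by (apply Rmult_le_pos; lra). nra.
    + apply Ccv_minus; [apply H; unfold v, rho in *; lra|apply Ccv_const].
  - apply Rlt_le_trans with (K * (eps / K))%R; [apply Rmult_lt_compat_l; lra|]. right. field. lra.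
Qed.

Lemma by_continuity_analytic (p : C) (f r : C -> C) (s : C) :
  (forall w, w <> p -> f w = r w) -> analytic_at r p -> by_continuity p f s = r s.
Proof.
  intros E Hr. unfold by_continuity. destruct (excluded_middle_informative (s = p)) as [->|Hs]; auto.
  apply is_C_lim_unique. intros P [eps HP].
  destruct (analytic_at_Ccont r p Hr eps (cond_pos eps)) as [d [Hd Hy]].
  assert (Hd2 : (0 < d / 2)%R) by lra.
  exists (mkposreal _ Hd2). intros y [B1 B2] Hyp. rewrite E by auto. apply HP.
  change (Rabs (Re (y - p)) < d / 2)%R in B1. change (Rabs (Im (y - p)) < d / 2)%R in B2.
  assert (Hlt : (Cmod (r y - r p) < eps)%R).
  { apply Hy. eapply Rle_lt_trans; [apply Cmod_le_abs|]. lra. }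
  split.
  - change (Rabs (Re (r y - r p)) < eps)%R. eapply Rle_lt_trans; [apply re_le_Cmod|auto].
  - change (Rabs (Im (r y - r p)) < eps)%R. eapply Rle_lt_trans; [apply im_le_Cmod|auto].
Qed.

(** * The right-hand side as an entire function *)

Definition V (th : R) (s : C) : C := (s - 1) * Q 0 th s + Ci * th * Q 0 th (s - 1).

Definition rhs_sum (th : R) (s : C) : C := (V th s + V (- th) s) / 2.

Lemma analytic_at_V (th : R) (s : C) : (Rabs th < 2 * PI)%R -> analytic_at (V th) s.
Proof.
  intros Hth. apply analytic_at_plus.
  - apply analytic_at_mul_lin, analytic_at_Q; auto.
  - apply analytic_at_scal. apply (analytic_at_shift (Q 0 th) (- (1))), analytic_at_Q; auto.
Qed.

Lemma analytic_at_rhs_sum (th : R) (s : C) : (Rabs th < 2 * PI)%R -> analytic_at (rhs_sum th) s.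
Proof.
  intros Hth. apply (analytic_at_ext (fun s => / 2 * (V th s + V (- th) s))).
  { intros z. unfold rhs_sum, Cdiv. ring. }
  apply analytic_at_scal, analytic_at_plus; apply analytic_at_V; auto. rewrite Rabs_Ropp; auto.
Qed.

Lemma V_taylor (th : R) (s : C) : (Rabs th <= 2 * PI / 3)%R ->
  Ccv (sum_n (fun k => (s - 1 + INR k) * ((Ci * th) ^ k / INR (fact k) * Q 0 0 (s - INR k)))) (V th s).
Proof.
  intros Hth. set (mu := Ci * th). set (q := fun s k => mu ^ k / INR (fact k) * Q 0 0 (s - INR k)).
  assert (H1 : Ccv (sum_n (q s)) (Q 0 th s)) by (apply Q_taylor; auto).
  assert (H2 : Ccv (sum_n (q (s - 1))) (Q 0 th (s - 1))) by (apply Q_taylor; auto).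
  apply (Ccv_ext (fun n => (s - 1) * sum_n (q s) n + mu * match n with O => 0 | S m => sum_n (q (s - 1)) m end)).
  - intros n. induction n as [|n IH].
    + rewrite !sum_O. unfold q. simpl INR. ring.
    + rewrite !sum_n_CS, <- IH.
      assert (E : mu * sum_n (q (s - 1)) n = mu * match n with O => 0 | S m => sum_n (q (s - 1)) m end
                  + INR (S n) * q s (S n)).
      { assert (Eq : INR (S n) * q s (S n) = mu * q (s - 1) n).
        { unfold q. replace (s - 1 - INR n) with (s - INR (S n)) by (rewrite S_INR, RtoC_plus; ring).
          rewrite fact_S_C, Cpow_S. field. split; [apply fact_neq_0_C|apply INR_S_neq_0]. }
        rewrite Eq. destruct n; [rewrite sum_O; ring|]. rewrite sum_n_CS. ring. }
      rewrite E. unfold q. ring.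
  - apply Ccv_plus; apply Ccv_scal; [exact H1|].
    unfold Ccv. apply is_lim_seq_incr_1. exact H2.
Qed.

Definition rhs_reg (th : R) (k : nat) (w : C) : C :=
  (-1) ^ k * ((w + 2 * INR k - 1) / INR (fact (2 * k))) * RtoC th ^ (2 * k) * Q 0 0 (w - 2 * INR k).

Lemma analytic_at_const (c p : C) : analytic_at (fun _ => c) p.
Proof.
  apply analytic_at_iff. exists (fun n => match n with O => c | _ => 0 end), 1%R. split; [lra|].
  intros z _. apply (Ccv_ext (fun _ => c)); [|apply Ccv_const].
  intros n. induction n as [|n IH]; [rewrite psum_O; auto|]. rewrite psum_S, <- IH. ring.
Qed.

Lemma rhs_term_reg (th : R) (s : C) (k : nat) : rhs_term th s k = rhs_reg th k s.
Proof.
  unfold rhs_term. apply by_continuity_analytic.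
  - intros w Hw. unfold rhs_reg.
    rewrite RtoC_mult in Hw.
    assert (H1 : w + 1 - 2 * INR k <> 1).
    { intros E. apply Hw. replace w with (w + 1 - 2 * INR k - 1 + 2 * INR k) by ring. rewrite E. ring. }
    assert (Z := zeta_Q _ H1).
    replace (w + 1 - 2 * INR k - 1) with (w - 2 * INR k) in Z by ring.
    rewrite <- Z. unfold Cdiv. ring.
  - apply (analytic_at_ext (fun w => ((-1) ^ k / INR (fact (2 * k)) * RtoC th ^ (2 * k)) *
      ((w - (1 - 2 * INR k)) * Q 0 0 (w + - (2 * INR k))))).
    + intros z. unfold rhs_reg, Cdiv, Cminus. ring.
    + apply analytic_at_scal, analytic_at_mul_lin.
      apply (analytic_at_shift (Q 0 0)), analytic_at_Q, Rabs0_lt.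
Qed.

Lemma Ci_pow_even (k : nat) : Ci ^ (2 * k) = (-1) ^ k.
Proof.
  rewrite Cpow_mult_r. f_equal. apply C_ext; simpl; ring.
Qed.

Lemma is_series_rhs (th : R) (s : C) : (Rabs th <= 2 * PI / 3)%R ->
  is_series (K := C_AbsRing) (V := C_NormedModule) (rhs_term th s) (rhs_sum th s).
Proof.
  intros Hth. apply is_series_Ccv.
  assert (H1 := V_taylor th s Hth). assert (H2 := V_taylor (- th) s ltac:(rewrite Rabs_Ropp; auto)).
  set (a := fun k => (s - 1 + INR k) * ((Ci * th) ^ k / INR (fact k) * Q 0 0 (s - INR k))) in *.
  set (b := fun k => (s - 1 + INR k) * ((Ci * (- th)%R) ^ k / INR (fact k) * Q 0 0 (s - INR k))) in *.
  assert (H3 := Ccv_scal _ (/ 2) _ (Ccv_plus _ _ _ _ H1 H2)).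
  replace (rhs_sum th s) with (/ 2 * (V th s + V (- th) s)) by (unfold rhs_sum, Cdiv; ring).
  apply (Ccv_subseq _ _ (fun n => 2 * n)%nat) in H3; [|intros n; lia].
  eapply Ccv_ext; [|exact H3]. intros n. cbv beta.
  assert (Ev : forall k, / 2 * (a (2 * k)%nat + b (2 * k)%nat) = rhs_term th s k).
  { intros k. rewrite rhs_term_reg. unfold a, b, rhs_reg.
    rewrite RtoC_opp, !Cpow_mult_l, Ci_pow_even.
    replace ((- RtoC th) ^ (2 * k)) with (RtoC th ^ (2 * k)).
    2:{ rewrite !Cpow_mult_r. f_equal. simpl. ring. }
    replace (RtoC (INR (2 * k))) with (2 * INR k) by (rewrite mult_INR, RtoC_mult; reflexivity).
    field. apply fact_neq_0_C. }
  assert (Od : forall k, a (S (2 * k)) + b (S (2 * k)) = 0).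
  { intros k. unfold a, b. rewrite RtoC_opp, !Cpow_S, !Cpow_mult_l.
    replace ((- RtoC th) ^ (2 * k)) with (RtoC th ^ (2 * k)).
    2:{ rewrite !Cpow_mult_r. f_equal. simpl. ring. }
    unfold Cdiv. ring. }
  induction n as [|n IH].
  - simpl (2 * 0)%nat. rewrite !sum_O, <- (Ev 0%nat). reflexivity.
  - rewrite sum_n_CS, <- IH, <- Ev.
    replace (2 * S n)%nat with (S (S (2 * n))) by lia. rewrite !sum_n_CS.
    set (x := sum_n a (2 * n)). set (y := sum_n b (2 * n)).
    replace (/ 2 * (x + a (S (2 * n)) + a (S (S (2 * n))) + (y + b (S (2 * n)) + b (S (S (2 * n)))))) with
      (/ 2 * (x + y) + / 2 * (a (S (2 * n)) + b (S (2 * n))) + / 2 * (a (S (S (2 * n))) + b (S (S (2 * n))))) by ring.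
    rewrite Od. ring.
Qed.

Definition trig_term (th : R) (s : C) (n : nat) : C :=
  cos (INR n * th) * (s * (s - 1) * cpow (INR n) (- (s + 1)) + RtoC th ^ 2 * cpow (INR n) (- (s - 1))).

Lemma V_series (th : R) (s : C) : (Rabs th < 2 * PI)%R -> (1 < Re s)%R ->
  Ccv (sum_n (fun k => (s * (s - 1) * cpow (INR (S k)) (- (s + 1)) + RtoC th ^ 2 * cpow (INR (S k)) (- (s - 1)))
                        * cexp (Ci * th * INR (S k)))) (V th s).
Proof.
  intros Hth Hs.
  assert (H1 := Q_series th s Hth ltac:(lra)).
  assert (H2 := Q_series th (s - 1) Hth ltac:(rewrite Re_minus; simpl; unfold Re in *; lra)).
  assert (H3 := Ccv_plus _ _ _ _ (Ccv_scal _ (s - 1) _ H1) (Ccv_scal _ (Ci * th) _ H2)).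
  eapply Ccv_ext; [|exact H3]. intros n. cbv beta. rewrite <- !sum_n_Cmult_l.
  rewrite <- sum_n_Cplus. apply sum_n_Cext. intros k.
  rewrite !opp_gfun1_INR. replace (- (s - 1 + 1)) with (- s) by ring.
  replace (RtoC th ^ 2) with (- (Ci * th * (Ci * th))).
  2:{ apply C_ext; simpl; ring. }
  ring.
Qed.

Lemma rhs_sum_series (th : R) (s : C) : (Rabs th < 2 * PI)%R -> (1 < Re s)%R ->
  Ccv (sum_n (fun k => trig_term th s (S k))) (rhs_sum th s).
Proof.
  intros Hth Hs.
  assert (H1 := V_series th s Hth Hs).
  assert (H2 := V_series (- th) s ltac:(rewrite Rabs_Ropp; auto) Hs).
  assert (H3 := Ccv_scal _ (/ 2) _ (Ccv_plus _ _ _ _ H1 H2)).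
  replace (rhs_sum th s) with (/ 2 * (V th s + V (- th) s)) by (unfold rhs_sum, Cdiv; ring).
  eapply Ccv_ext; [|exact H3]. intros n. cbv beta.
  rewrite <- sum_n_Cplus, <- sum_n_Cmult_l. apply sum_n_Cext. intros k.
  unfold trig_term.
  replace (RtoC (- th) ^ 2) with (RtoC th ^ 2) by (rewrite RtoC_opp; simpl; ring).
  replace (RtoC (cos (INR (S k) * th))) with (/ 2 * (cexp (Ci * th * INR (S k)) + cexp (Ci * RtoC (- th) * INR (S k)))).
  { ring. }
  assert (E1 : forall x : R, cexp (Ci * x * INR (S k)) = (cos (INR (S k) * x), sin (INR (S k) * x))).
  { intros x. unfold cexp. replace (Re (Ci * x * INR (S k))) with 0%R by (cbn -[INR]; ring).
    replace (Im (Ci * x * INR (S k))) with (INR (S k) * x)%R by (cbn -[INR]; ring).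
    rewrite exp_0, !Rmult_1_l. reflexivity. }
  rewrite !E1. replace (INR (S k) * - th)%R with (- (INR (S k) * th))%R by ring.
  rewrite cos_neg, sin_neg. apply C_ext; cbn -[INR]; field.
Qed.

(** * Rational angles *)

Fixpoint fsum (f : nat -> C) (n : nat) : C :=
  match n with O => 0 | S m => fsum f m + f n end.

Lemma sum_n_fsum (f : nat -> C) (n : nat) : sum_n (fun k => f (S k)) n = fsum f (S n).
Proof.
  induction n as [|n IH]; [rewrite sum_O; simpl; ring|]. rewrite sum_Sn, IH. reflexivity.
Qed.

Definition lsum (L : list (nat * R)) (F : nat -> C) : C :=
  fold_right (fun x acc => RtoC (snd x) * F (fst x) + acc) 0 L.

Lemma lsum_ext (L : list (nat * R)) (F G : nat -> C) :
  (forall d e, In (d, e) L -> F d = G d) -> lsum L F = lsum L G.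
Proof.
  induction L as [|[d e] L IH]; intros H; simpl; auto.
  rewrite (H d e) by (left; auto). rewrite IH; auto. intros d' e' H'. apply (H d' e'). right; auto.
Qed.

Lemma lsum_scal (L : list (nat * R)) (c : C) (F : nat -> C) :
  lsum L (fun d => c * F d) = c * lsum L F.
Proof. induction L as [|[d e] L IH]; simpl; [ring|]. rewrite IH. ring. Qed.

Lemma lsum_plus (L : list (nat * R)) (F G : nat -> C) :
  lsum L (fun d => F d + G d) = lsum L F + lsum L G.
Proof. induction L as [|[d e] L IH]; simpl; [ring|]. rewrite IH. ring. Qed.

Lemma Ccv_lsum (L : list (nat * R)) (u : nat -> nat -> C) (l : nat -> C) :
  (forall d e, In (d, e) L -> Ccv (u d) (l d)) ->
  Ccv (fun n => lsum L (fun d => u d n)) (lsum L l).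
Proof.
  induction L as [|[d e] L IH]; intros H; simpl; [apply Ccv_const|].
  apply Ccv_plus; [apply Ccv_scal, (H d e); left; auto|].
  apply IH. intros d' e' H'. apply (H d' e'). right; auto.
Qed.

Lemma analytic_at_lsum (L : list (nat * R)) (F : nat -> C -> C) (s : C) :
  (forall d, analytic_at (F d) s) -> analytic_at (fun z => lsum L (fun d => F d z)) s.
Proof.
  intros H. induction L as [|[d e] L IH]; simpl; [apply analytic_at_const|].
  apply analytic_at_plus; auto. apply analytic_at_scal; auto.
Qed.

(* cos (n th) is half the sum of e d over the pairs (d, e) of L with d | n. *)
Definition trig_decomp (th : R) (P : nat) (L : list (nat * R)) : Prop :=
  (0 < P)%nat /\ (forall d e, In (d, e) L -> (0 < d <= P)%nat) /\
  forall (f : nat -> C) (M : nat),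
    fsum (fun n => RtoC (cos (INR n * th)) * f n) (P * M) =
    / 2 * lsum L (fun d => INR d * fsum (fun m => f (d * m)%nat) (P / d * M)).

Definition lhs_sum (L : list (nat * R)) (s : C) : C := / 2 * lsum L (fun d => Q (ln (INR d)) 0 s).

Lemma analytic_at_lhs_sum (L : list (nat * R)) (s : C) : analytic_at (lhs_sum L) s.
Proof.
  apply analytic_at_scal. apply analytic_at_lsum. intros d. apply analytic_at_Q, Rabs0_lt.
Qed.

Lemma fsum_plus (f g : nat -> C) (n : nat) : fsum (fun k => f k + g k) n = fsum f n + fsum g n.
Proof. induction n as [|n IH]; simpl; [ring|]. rewrite IH. ring. Qed.

Lemma fsum_scal (c : C) (f : nat -> C) (n : nat) : fsum (fun k => c * f k) n = c * fsum f n.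
Proof. induction n as [|n IH]; simpl; [ring|]. rewrite IH. ring. Qed.

Lemma fsum_ext (f g : nat -> C) (n : nat) : (forall k, (0 < k)%nat -> f k = g k) -> fsum f n = fsum g n.
Proof. intros H. induction n as [|n IH]; simpl; auto. rewrite IH, H by lia. auto. Qed.

Lemma cpow_mul_INR (d m : nat) (z : C) : (0 < d)%nat -> (0 < m)%nat ->
  cpow (INR (d * m)) z = cpow (INR d) z * cpow (INR m) z.
Proof.
  intros Hd Hm. rewrite !cpow_cexp, mult_INR, ln_mult by (apply lt_0_INR; auto).
  rewrite RtoC_plus, <- cexp_plus. f_equal. ring.
Qed.

Lemma fsum_dirichlet (s : C) : (1 < Re s)%R ->
  Ccv (fun n => fsum (fun m => cpow (INR m) (- s)) n) (Q 0 0 (s - 1) / (s - 1)).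
Proof.
  intros Hs. unfold Ccv. apply is_lim_seq_incr_1.
  eapply is_lim_seq_ext; [|exact (Q_dirichlet s Hs)].
  intros n. cbv beta. rewrite <- sum_n_fsum. reflexivity.
Qed.

Lemma rhs_sum_right (th : R) (P : nat) (L : list (nat * R)) (s : C) :
  (Rabs th < 2 * PI)%R -> trig_decomp th P L -> (2 < Re s)%R ->
  (s - 2) * rhs_sum th s = (s - 2) * (s - 1) * lhs_sum L s + RtoC th ^ 2 * lhs_sum L (s - 2).
Proof.
  intros Hth [HP [HL Hdec]] Hs.
  assert (Hs0 : s <> 0) by (intros E; rewrite E in Hs; simpl in Hs; lra).
  assert (Hs2 : s - 2 <> 0).
  { intros E. apply (f_equal Re) in E. rewrite Re_minus in E. simpl in E. unfold Re in *. lra. }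
  set (F := fun n : nat => s * (s - 1) * cpow (INR n) (- (s + 1)) + RtoC th ^ 2 * cpow (INR n) (- (s - 1))).
  set (lim := fun d : nat => INR d * (s * (s - 1) * cpow (INR d) (- (s + 1)) * (Q 0 0 s / s)
                  + RtoC th ^ 2 * cpow (INR d) (- (s - 1)) * (Q 0 0 (s - 2) / (s - 2)))).
  assert (H1 := rhs_sum_series th s Hth ltac:(lra)).
  apply (Ccv_subseq _ _ (fun n => pred (P * S n))) in H1; [|intros n; nia].
  assert (H2 : Ccv (fun n => / 2 * lsum L (fun d => INR d * fsum (fun m => F (d * m)%nat) (P / d * S n)))
                 (/ 2 * lsum L lim)).
  { apply Ccv_scal. apply (Ccv_lsum L (fun d n => INR d * fsum (fun m => F (d * m)%nat) (P / d * S n))).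
    intros d e Hde. assert (Hd := HL d e Hde). apply Ccv_scal.
    apply (Ccv_subseq (fun n => fsum (fun m => F (d * m)%nat) n) _ (fun n => (P / d * S n)%nat)).
    { intros n. assert (1 <= P / d)%nat by (apply Nat.div_le_lower_bound; lia). nia. }
    assert (D1 := fsum_dirichlet (s + 1) ltac:(rewrite re_plus; simpl; unfold Re in *; lra)).
    assert (D2 := fsum_dirichlet (s - 1) ltac:(rewrite Re_minus; simpl; unfold Re in *; lra)).
    replace (s + 1 - 1) with s in D1 by ring. replace (s - 1 - 1) with (s - 2) in D2 by ring.
    eapply Ccv_ext; [|apply (Ccv_plus _ _ _ _
       (Ccv_scal _ (s * (s - 1) * cpow (INR d) (- (s + 1))) _ D1)
       (Ccv_scal _ (RtoC th ^ 2 * cpow (INR d) (- (s - 1))) _ D2))].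
    intros n. cbv beta. rewrite <- !fsum_scal, <- fsum_plus. apply fsum_ext.
    intros m Hm. unfold F. rewrite !cpow_mul_INR by lia. ring. }
  assert (E : rhs_sum th s = / 2 * lsum L lim).
  { eapply Ccv_unique; [exact H1|]. eapply Ccv_ext; [|exact H2]. intros n. cbv beta.
    rewrite <- Hdec. destruct (P * S n)%nat as [|k] eqn:Ek; [nia|].
    simpl pred. rewrite sum_n_fsum. apply fsum_ext. intros m _. reflexivity. }
  rewrite E. unfold lhs_sum.
  rewrite (lsum_ext L lim (fun d => (s - 1) * Q (ln (INR d)) 0 s
                              + (RtoC th ^ 2 / (s - 2)) * Q (ln (INR d)) 0 (s - 2))).
  - rewrite lsum_plus, !lsum_scal. field. auto.
  - intros d e Hde. assert (Hd := HL d e Hde). assert (Hd0 : (0 < INR d)%R) by (apply lt_0_INR; lia).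
    assert (HdC : RtoC (INR d) <> 0) by (apply RtoC_neq_0; lra).
    unfold lim. rewrite (Q_scal (ln (INR d)) 0 s Rabs0_lt), (Q_scal (ln (INR d)) 0 (s - 2) Rabs0_lt).
    replace (cexp (- (s * ln (INR d)))) with (INR d * cpow (INR d) (- (s + 1))).
    2:{ rewrite <- (cpow_1 (INR d) Hd0) at 1. rewrite <- cpow_plus, cpow_cexp. f_equal. ring. }
    replace (cexp (- ((s - 2) * ln (INR d)))) with (INR d * cpow (INR d) (- (s - 1))).
    2:{ rewrite <- (cpow_1 (INR d) Hd0) at 1. rewrite <- cpow_plus, cpow_cexp. f_equal. ring. }
    field. auto.
Qed.

Lemma rhs_sum_eq (th : R) (P : nat) (L : list (nat * R)) (s : C) :
  (Rabs th < 2 * PI)%R -> trig_decomp th P L ->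
  (s - 2) * rhs_sum th s = (s - 2) * (s - 1) * lhs_sum L s + RtoC th ^ 2 * lhs_sum L (s - 2).
Proof.
  intros Hth HL. apply Ceq_minus.
  apply (identity_entire (fun s => (s - 2) * rhs_sum th s
      - ((s - 2) * (s - 1) * lhs_sum L s + RtoC th ^ 2 * lhs_sum L (s - 2)))).
  - intros z. apply analytic_at_minus; [|apply analytic_at_plus].
    + apply analytic_at_mul_lin, analytic_at_rhs_sum; auto.
    + apply (analytic_at_ext (fun s => (s - 2) * ((s - 1) * lhs_sum L s))); [intros; ring|].
      do 2 apply analytic_at_mul_lin. apply analytic_at_lhs_sum.
    + apply analytic_at_scal. apply (analytic_at_shift (lhs_sum L) (- (2))), analytic_at_lhs_sum.
  - intros z Hz. rewrite (rhs_sum_right th P L z Hth HL Hz). ring.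
Qed.

Lemma identity_of_decomp (th : R) (P : nat) (L : list (nat * R)) (f0 f2 : C -> C) :
  (Rabs th <= 2 * PI / 3)%R -> trig_decomp th P L ->
  (forall w : C, w <> 0 -> f0 w = (w - 1) * lhs_sum L w) ->
  (forall w : C, w <> 2 -> (w - 2) * f2 w = RtoC th ^ 2 * lhs_sum L (w - 2)) ->
  forall s, is_series (K := C_AbsRing) (V := C_NormedModule) (rhs_term th s)
    (by_continuity 0 f0 s + by_continuity 2 f2 s).
Proof.
  intros Hth HL H0 H2 s. assert (HPI := PI_RGT_0).
  assert (Hth' : (Rabs th < 2 * PI)%R) by lra.
  assert (A0 : forall z, analytic_at (fun w => (w - 1) * lhs_sum L w) z).
  { intros z. apply analytic_at_mul_lin, analytic_at_lhs_sum. }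
  rewrite (by_continuity_analytic 0 f0 (fun w => (w - 1) * lhs_sum L w)); auto.
  rewrite (by_continuity_analytic 2 f2 (fun w => rhs_sum th w - (w - 1) * lhs_sum L w)).
  - match goal with |- is_series _ ?x => replace x with (rhs_sum th s) end.
    + apply is_series_rhs; auto.
    + change (rhs_sum th s = (s - 1) * lhs_sum L s + (rhs_sum th s - (s - 1) * lhs_sum L s)). ring.
  - intros w Hw. assert (Hw2 : w - 2 <> 0) by (apply Cminus_eq_contra; auto).
    assert (E := rhs_sum_eq th P L w Hth' HL). specialize (H2 w Hw).
    replace (f2 w) with (/ (w - 2) * ((w - 2) * f2 w)) by (field; auto).
    rewrite H2.
    replace (RtoC th ^ 2 * lhs_sum L (w - 2)) with ((w - 2) * rhs_sum th w - (w - 2) * (w - 1) * lhs_sum L w)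
      by (rewrite E; ring).
    field. auto.
  - apply analytic_at_minus; auto. apply analytic_at_rhs_sum; auto.
Qed.

Lemma fsum_add (f : nat -> C) (n p : nat) :
  fsum f (n + p) = fsum f n + fsum (fun k => f (n + k)%nat) p.
Proof.
  induction p as [|p IH]; [rewrite Nat.add_0_r; simpl; ring|].
  rewrite Nat.add_succ_r. simpl. rewrite IH, Nat.add_succ_r. ring.
Qed.

Lemma cos_mod (th : R) (P c M j : nat) : (INR P * th = 2 * INR c * PI)%R ->
  cos (INR (P * M + j) * th) = cos (INR j * th).
Proof.
  intros H. rewrite <- (cos_period (INR j * th) (c * M)). f_equal.
  rewrite plus_INR, !mult_INR.
  replace (2 * (INR c * INR M) * PI)%R with (INR M * (2 * INR c * PI))%R by ring.
  rewrite <- H. ring.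
Qed.

Lemma INR_lit_C (n : nat) (x : R) : INR n = x -> RtoC (INR n) = RtoC x.
Proof. intros ->; auto. Qed.

Lemma RtoC_neg_half : RtoC (- / 2)%R = - / 2.
Proof. rewrite RtoC_opp, RtoC_inv by lra. reflexivity. Qed.

Lemma RtoC_half : RtoC (/ 2)%R = / 2.
Proof. rewrite RtoC_inv by lra. reflexivity. Qed.

Lemma trig_decomp_2PI3 : trig_decomp (2 * PI / 3) 3 ((3%nat, 1%R) :: (1%nat, (-1)%R) :: nil).
Proof.
  split; [lia|]. split.
  { intros d e [E|[E|[]]]; injection E; intros; subst; lia. }
  intros f M.
  assert (C1 : cos (INR 1 * (2 * PI / 3)) = (- / 2)%R).
  { replace (INR 1 * (2 * PI / 3))%R with (2 * (PI / 3))%R by (simpl; field). rewrite cos_2PI3. lra. }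
  assert (C2 : cos (INR 2 * (2 * PI / 3)) = (- / 2)%R).
  { replace (INR 2 * (2 * PI / 3))%R with (- (2 * (PI / 3)) + 2 * INR 1 * PI)%R by (simpl; field).
    rewrite cos_period, cos_neg, cos_2PI3. lra. }
  assert (C3 : cos (INR 3 * (2 * PI / 3)) = 1%R).
  { replace (INR 3 * (2 * PI / 3))%R with (2 * PI)%R by (simpl; field). apply cos_2PI. }
  assert (HP : (INR 3 * (2 * PI / 3) = 2 * INR 1 * PI)%R) by (simpl; field).
  unfold lsum; cbn [fold_right fst snd].
  change (3 / 3)%nat with 1%nat. change (3 / 1)%nat with 3%nat.
  rewrite (INR_lit_C 3 3), (INR_lit_C 1 1) by (simpl; ring).
  induction M as [|M IH]; [simpl; ring|].
  replace (3 * S M)%nat with (3 * M + 3)%nat by lia. replace (1 * S M)%nat with (1 * M + 1)%nat by lia.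
  rewrite !fsum_add, IH. cbn [fsum].
  rewrite !(cos_mod _ 3 1 M _ HP), C1, C2, C3, RtoC_neg_half.
  replace (3 * (1 * M + 1))%nat with (3 * M + 3)%nat by lia.
  rewrite !(Nat.mul_1_l (3 * M + _)). field.
Qed.

Lemma trig_decomp_PI2 : trig_decomp (PI / 2) 4 ((4%nat, 1%R) :: (2%nat, (-1)%R) :: nil).
Proof.
  split; [lia|]. split.
  { intros d e [E|[E|[]]]; injection E; intros; subst; lia. }
  intros f M.
  assert (C1 : cos (INR 1 * (PI / 2)) = 0%R).
  { replace (INR 1 * (PI / 2))%R with (PI / 2)%R by (simpl; field). apply cos_PI2. }
  assert (C2 : cos (INR 2 * (PI / 2)) = (-1)%R).
  { replace (INR 2 * (PI / 2))%R with PI by (simpl; field). apply cos_PI. }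
  assert (C3 : cos (INR 3 * (PI / 2)) = 0%R).
  { replace (INR 3 * (PI / 2))%R with (- (PI / 2) + 2 * INR 1 * PI)%R by (simpl; field).
    rewrite cos_period, cos_neg. apply cos_PI2. }
  assert (C4 : cos (INR 4 * (PI / 2)) = 1%R).
  { replace (INR 4 * (PI / 2))%R with (2 * PI)%R by (simpl; field). apply cos_2PI. }
  assert (HP : (INR 4 * (PI / 2) = 2 * INR 1 * PI)%R) by (simpl; field).
  unfold lsum; cbn [fold_right fst snd].
  change (4 / 4)%nat with 1%nat. change (4 / 2)%nat with 2%nat.
  rewrite (INR_lit_C 4 4), (INR_lit_C 2 2) by (simpl; ring).
  induction M as [|M IH]; [simpl; ring|].
  replace (4 * S M)%nat with (4 * M + 4)%nat by lia. replace (1 * S M)%nat with (1 * M + 1)%nat by lia.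
  replace (2 * S M)%nat with (2 * M + 2)%nat by lia.
  rewrite !fsum_add, IH. cbn [fsum].
  rewrite !(cos_mod _ 4 1 M _ HP), C1, C2, C3, C4.
  replace (4 * (1 * M + 1))%nat with (4 * M + 4)%nat by lia.
  replace (2 * (2 * M + 1))%nat with (4 * M + 2)%nat by lia.
  replace (2 * (2 * M + 2))%nat with (4 * M + 4)%nat by lia. field.
Qed.

Lemma trig_decomp_PI3 :
  trig_decomp (PI / 3) 6
    ((6%nat, 1%R) :: (3%nat, (-1)%R) :: (2%nat, (-1)%R) :: (1%nat, 1%R) :: nil).
Proof.
  split; [lia|]. split.
  { intros d e [E|[E|[E|[E|[]]]]]; injection E; intros; subst; lia. }
  intros f M.
  assert (C1 : cos (INR 1 * (PI / 3)) = (/ 2)%R).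
  { replace (INR 1 * (PI / 3))%R with (PI / 3)%R by (simpl; field). rewrite cos_PI3. lra. }
  assert (C2 : cos (INR 2 * (PI / 3)) = (- / 2)%R).
  { replace (INR 2 * (PI / 3))%R with (2 * (PI / 3))%R by (simpl; field). rewrite cos_2PI3. lra. }
  assert (C3 : cos (INR 3 * (PI / 3)) = (-1)%R).
  { replace (INR 3 * (PI / 3))%R with PI by (simpl; field). apply cos_PI. }
  assert (C4 : cos (INR 4 * (PI / 3)) = (- / 2)%R).
  { replace (INR 4 * (PI / 3))%R with (- (2 * (PI / 3)) + 2 * INR 1 * PI)%R by (simpl; field).
    rewrite cos_period, cos_neg, cos_2PI3. lra. }
  assert (C5 : cos (INR 5 * (PI / 3)) = (/ 2)%R).
  { replace (INR 5 * (PI / 3))%R with (- (PI / 3) + 2 * INR 1 * PI)%R by (simpl; field).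
    rewrite cos_period, cos_neg, cos_PI3. lra. }
  assert (C6 : cos (INR 6 * (PI / 3)) = 1%R).
  { replace (INR 6 * (PI / 3))%R with (2 * PI)%R by (simpl; field). apply cos_2PI. }
  assert (HP : (INR 6 * (PI / 3) = 2 * INR 1 * PI)%R) by (simpl; field).
  unfold lsum; cbn [fold_right fst snd].
  change (6 / 6)%nat with 1%nat. change (6 / 3)%nat with 2%nat.
  change (6 / 2)%nat with 3%nat. change (6 / 1)%nat with 6%nat.
  rewrite (INR_lit_C 6 6), (INR_lit_C 3 3), (INR_lit_C 2 2), (INR_lit_C 1 1) by (simpl; ring).
  induction M as [|M IH]; [simpl; ring|].
  replace (6 * S M)%nat with (6 * M + 6)%nat by lia. replace (1 * S M)%nat with (1 * M + 1)%nat by lia.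
  replace (2 * S M)%nat with (2 * M + 2)%nat by lia. replace (3 * S M)%nat with (3 * M + 3)%nat by lia.
  rewrite !fsum_add, IH. cbn [fsum].
  rewrite !(cos_mod _ 6 1 M _ HP), C1, C2, C3, C4, C5, C6, RtoC_neg_half, RtoC_half.
  replace (6 * (1 * M + 1))%nat with (6 * M + 6)%nat by lia.
  replace (3 * (2 * M + 1))%nat with (6 * M + 3)%nat by lia.
  replace (3 * (2 * M + 2))%nat with (6 * M + 6)%nat by lia.
  replace (2 * (3 * M + 1))%nat with (6 * M + 2)%nat by lia.
  replace (2 * (3 * M + 2))%nat with (6 * M + 4)%nat by lia.
  replace (2 * (3 * M + 3))%nat with (6 * M + 6)%nat by lia.
  rewrite !(Nat.mul_1_l (6 * M + _)). field.
Qed.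

Lemma Q_INR (d : nat) (x : R) (s : C) : INR d = x ->
  Q (ln (INR d)) 0 s = cpow x (- s) * Q 0 0 s.
Proof.
  intros <-. rewrite (Q_scal _ _ _ Rabs0_lt), cpow_cexp. f_equal. f_equal. ring.
Qed.

Lemma Q_0_zeta (w : C) : w <> 0 -> Q 0 0 w = w * zeta (w + 1).
Proof.
  intros Hw. assert (H : w + 1 <> 1).
  { intros E. apply Hw. replace w with (w + 1 - 1) by ring. rewrite E. ring. }
  assert (Z := zeta_Q _ H). replace (w + 1 - 1) with w in Z by ring. auto.
Qed.

Lemma Q_2_zeta (w : C) : w <> 2 -> Q 0 0 (w - 2) = (w - 2) * zeta (w - 1).
Proof.
  intros Hw. rewrite Q_0_zeta by (apply Cminus_eq_contra; auto). f_equal. f_equal. ring.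
Qed.

Lemma cpow_base_1 (z : C) : cpow 1 z = 1.
Proof. rewrite cpow_cexp, ln_1, Cmult_0_r, cexp_0. reflexivity. Qed.

Theorem theorem4p9 :
  forall s : C,
    is_series (K := C_AbsRing) (V := C_NormedModule)
      (rhs_term (2 * PI / 3) s)
      (by_continuity 0
         (fun w : C => w * (w - 1) * ((cpow 3 (- w) - 1) / 2) * zeta (w + 1)) s
       + by_continuity 2
         (fun w : C => RtoC (2 * PI / 3) ^ 2 * ((cpow 3 (2 - w) - 1) / 2)
                       * zeta (w - 1)) s)
    /\
    is_series (K := C_AbsRing) (V := C_NormedModule)
      (rhs_term (PI / 2) s)
      (by_continuity 0
         (fun w : C => w * (w - 1) * ((cpow 2 (- w) - 1) / cpow 2 (w + 1))
                       * zeta (w + 1)) s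
       + by_continuity 2
         (fun w : C => RtoC (PI / 2) ^ 2 * ((cpow 2 (2 - w) - 1) / cpow 2 (w - 1))
                       * zeta (w - 1)) s)
    /\
    is_series (K := C_AbsRing) (V := C_NormedModule)
      (rhs_term (PI / 3) s)
      (by_continuity 0
         (fun w : C => w * (w - 1)
                       * ((cpow 6 (- w) - cpow 3 (- w) - cpow 2 (- w) + 1) / 2)
                       * zeta (w + 1)) s
       + by_continuity 2
         (fun w : C => RtoC (PI / 3) ^ 2
                       * ((cpow 6 (2 - w) - cpow 3 (2 - w) - cpow 2 (2 - w) + 1) / 2)
                       * zeta (w - 1)) s).
Proof.
  intros s. assert (HPI := PI_RGT_0).
  assert (E2 : forall w : C, - (w - 2) = 2 - w) by (intros; ring).
  assert (B1 : (Rabs (2 * PI / 3) <= 2 * PI / 3)%R) by (rewrite Rabs_pos_eq; lra).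
  assert (B2 : (Rabs (PI / 2) <= 2 * PI / 3)%R) by (rewrite Rabs_pos_eq; lra).
  assert (B3 : (Rabs (PI / 3) <= 2 * PI / 3)%R) by (rewrite Rabs_pos_eq; lra).
  assert (E4 : forall z, cpow 4 z = cpow 2 z * cpow 2 z).
  { intros z. rewrite !cpow_cexp, <- cexp_plus. f_equal.
    replace 4%R with (2 * 2)%R by ring. rewrite ln_mult, RtoC_plus by lra. ring. }
  split; [|split].
  - apply (identity_of_decomp _ _ _ _ _ B1 trig_decomp_2PI3);
      intros w Hw; unfold lhs_sum, lsum; cbn [fold_right fst snd];
      rewrite (Q_INR 3 3), (Q_INR 1 1) by (simpl; ring); rewrite cpow_base_1.
    + rewrite Q_0_zeta by auto. field.
    + rewrite Q_2_zeta, E2 by auto. field.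
  - apply (identity_of_decomp _ _ _ _ _ B2 trig_decomp_PI2);
      intros w Hw; unfold lhs_sum, lsum; cbn [fold_right fst snd];
      rewrite (Q_INR 4 4), (Q_INR 2 2) by (simpl; ring).
    + rewrite Q_0_zeta, E4, cpow_plus, cpow_1, cpow_opp by (auto; lra).
      field. apply cpow_neq_0.
    + rewrite Q_2_zeta, E2, E4 by auto.
      replace (2 - w) with (1 + - (w - 1)) by ring.
      rewrite cpow_plus, cpow_1, cpow_opp by lra. field. apply cpow_neq_0.
  - apply (identity_of_decomp _ _ _ _ _ B3 trig_decomp_PI3);
      intros w Hw; unfold lhs_sum, lsum; cbn [fold_right fst snd];
      rewrite (Q_INR 6 6), (Q_INR 3 3), (Q_INR 2 2), (Q_INR 1 1) by (simpl; ring); rewrite cpow_base_1.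
    + rewrite Q_0_zeta by auto. field.
    + rewrite Q_2_zeta, E2 by auto. field.
Qed.
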